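(* Fix integers $(n,m)$ with either $m=1,\ n\ge 3$, or $m,n\ge 2$. Let $(\pi:\mathcal{G}\to M,\omega)$ be a regular, normal Cartan geometry of type $(G,P)$ associated to a system of $m$ ODEs of order $n+1$. Then for any $u\in\mathcal{G}$ we have $\mathfrak{s}(u)\subseteq\mathfrak{a}^{\kappa_H(u)}$. Moreover, $\mathfrak{S}\le\mathfrak{U}<\dim\mathfrak{g}$.
   Context: All objects are real and smooth. Lie algebra. $\mathfrak{g}=(\mathfrak{sl}_2\times\mathfrak{gl}_m)\ltimes(\mathbb{V}_n\otimes W)$, with $\mathbb{V}_n\otimes W$ an abelian ideal, $W=\mathbb{R}^m$ the standard representation of $\mathfrak{gl}_m$, and $\mathbb{V}_n$ the $(n+1)$-dimensional $\mathfrak{sl}_2$-irrep of homogeneous degree $n$ polynomials in $x,y$, with basis $E_i=\frac{1}{i!}x^{n-i}y^i$, $0\le i\le n$. Set $\mathsf{X}=x\partial_y$, $\mathsf{H}=x\partial_x-y\partial_y$, $\mathsf{Y}=y\partial_x$ (basis of $\mathfrak{sl}_2$), and let $\mathrm{id}_m$ be the identity of $\mathfrak{gl}_m$. Put $\mathsf{Z}=-\frac12(\mathsf{H}+(n+2)\,\mathrm{id}_m)$. The grading $\mathfrak{g}=\mathfrak{g}_{-n-1}\oplus\cdots\oplus\mathfrak{g}_1$ is by eigenvalues of $\mathrm{ad}_{\mathsf{Z}}$: $\mathfrak{g}_1=\mathbb{R}\mathsf{Y}$, $\mathfrak{g}_0=\mathbb{R}\mathsf{H}\oplus\mathfrak{gl}_m$,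 $\mathfrak{g}_{-1}=\mathbb{R}\mathsf{X}\oplus(\mathbb{R}E_n\otimes W)$, $\mathfrak{g}_i=\mathbb{R}E_{n+1+i}\otimes W$ for $i\le-2$. Put $\mathfrak{g}_-=\bigoplus_{i<0}\mathfrak{g}_i$, $\mathfrak{g}^i=\bigoplus_{j\ge i}\mathfrak{g}_j$, $\mathfrak{p}=\mathfrak{g}^0$. Groups. If $m=1$: $G=\mathrm{GL}_2\ltimes\mathbb{V}_n$ and $P\subset\mathrm{GL}_2$ is the lower triangular subgroup. If $m\ge2$: $G=(\mathrm{SL}_2\times\mathrm{GL}_m)\ltimes(\mathbb{V}_n\otimes W)$ and $P=\mathrm{ST}_2\times\mathrm{GL}_m$ with $\mathrm{ST}_2\subset\mathrm{SL}_2$ lower triangular. $G_0=\{g\in P:\mathrm{Ad}_g\mathfrak{g}_0\subset\mathfrak{g}_0\}$. Cartan geometries. A Cartan geometry $(\mathcal{G}\to M,\omega)$ of type $(G,P)$ is a principal $P$-bundle with $\omega\in\Omega^1(\mathcal{G},\mathfrak{g})$ that is a linear isomorphism on each tangent space, $P$-equivariant, and reproduces fundamental vertical vector fields. Its curvature $K(\xi,\eta)=d\omega(\xi,\eta)+[\omega(\xi),\omega(\eta)]$ gives the $P$-equivariant function $\kappa:\mathcal{G}\to\bigwedge^2(\mathfrak{g}/\mathfrak{p})^*\otimes\mathfrak{g}$, $\kappa(A,B)=K(\omega^{-1}(A),\omega^{-1}(B))$. It is regular if $\kappa(\mathfrak{g}^i,\mathfrak{g}^j)\subset\mathfrak{g}^{i+j+1}$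 for all $i,j$, and normal if $\partial^*\kappa=0$. Here $\partial^*:\bigwedge^k(\mathfrak{g}/\mathfrak{p})^*\otimes\mathfrak{g}\to\bigwedge^{k-1}(\mathfrak{g}/\mathfrak{p})^*\otimes\mathfrak{g}$ is the $P$-equivariant restriction of the adjoint of the Chevalley–Eilenberg differential of $C^\bullet(\mathfrak{g},\mathfrak{g})$ with respect to a fixed suitable inner product on $\mathfrak{g}$ (due to Čap–Doubrov–The; e.g. one with $\mathfrak{g}_i$ mutually orthogonal and the adjoint of $\mathrm{ad}_A$ equal to $\mathrm{ad}_{A^\top}$ for $A\in\mathfrak{sl}_2\times\mathfrak{gl}_m$). The harmonic curvature is $\kappa_H=\kappa \bmod \mathrm{im}\,\partial^*:\mathcal{G}\to\ker\partial^*/\mathrm{im}\,\partial^*$. It is known that on this quotient $\mathfrak{g}^1$ acts trivially, and as a $G_0$-module it is identified (by Hodge decomposition) with the Lie algebra cohomology $H^2(\mathfrak{g}_-,\mathfrak{g})$; by regularity $\kappa_H$ is valued in $H^2_+(\mathfrak{g}_-,\mathfrak{g})$, the part where $\mathsf{Z}$ has positive eigenvalues. ODEs. An ODE of order $n+1$ for $\mathbf{u}\in\mathbb{R}^m$ is the submanifold $\mathcal{E}=\{\mathbf{u}_{n+1}=\mathbf{f}\}\subset J^{n+1}(\mathbb{R},\mathbb{R}^m)$ with coordinates $(t,\mathbf{u}_0,\ldots,\mathbf{u}_n)$ and distributions $E=\langle\partial_t+\mathbf{u}_1\partial_{\mathbf{u}_0}+\cdots+\mathbf{u}_n\partial_{\mathbf{u}_{n-1}}+\mathbf{f}\partial_{\mathbf{u}_n}\rangle$,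 $V=\langle\partial_{\mathbf{u}_n}\rangle$. It has a canonically associated regular, normal Cartan geometry $(\pi:\mathcal{G}\to\mathcal{E},\omega)$ of type $(G,P)$, unique up to isomorphism, for which $E$ and $V$ are the images under $T\pi$ of $\omega^{-1}(\mathbb{R}\mathsf{X}+\mathfrak{p})$ and $\omega^{-1}(\mathbb{R}E_n\otimes W+\mathfrak{p})$. Effective part. $\mathbb{E}\subset H^2_+(\mathfrak{g}_-,\mathfrak{g})$ is the minimal $G_0$-submodule in which $\kappa_H$ is valued for all regular, normal Cartan geometries of type $(G,P)$ associated to ODEs (fixed $n,m$). Tanaka algebra. For $\phi$ in a $\mathfrak{g}_0$-module let $\mathfrak{ann}(\phi)\subset\mathfrak{g}_0$ be its annihilator and let $\mathfrak{a}^\phi\subset\mathfrak{g}$ be the graded subalgebra with $\mathfrak{a}^\phi_-=\mathfrak{g}_-$, $\mathfrak{a}^\phi_0=\mathfrak{ann}(\phi)$, $\mathfrak{a}^\phi_1=\{X\in\mathfrak{g}_1:[X,\mathfrak{g}_{-1}]\subset\mathfrak{ann}(\phi)\}$. Put $\mathfrak{U}=\max\{\dim\mathfrak{a}^\phi:0\ne\phi\in\mathbb{E}\}$. Symmetries. Base manifolds are connected. $\mathfrak{inf}(\mathcal{G},\omega)$ is the Lie algebra of $P$-invariant vector fields $\xi$ on $\mathcal{G}$ with $\mathcal{L}_\xi\omega=0$. For $u\in\mathcal{G}$, $\mathfrak{f}(u)=\{\omega(\xi_u):\xi\in\mathfrak{inf}(\mathcal{G},\omega)\}\subset\mathfrak{g}$,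 with filtration $\mathfrak{f}(u)^k=\mathfrak{f}(u)\cap\mathfrak{g}^k$, and $\mathfrak{s}(u)=\mathrm{gr}(\mathfrak{f}(u))=\bigoplus_k\mathfrak{f}(u)^k/\mathfrak{f}(u)^{k+1}$, which is a graded Lie subalgebra of $\mathfrak{g}\cong\mathrm{gr}(\mathfrak{g})$ of dimension $\dim\mathfrak{inf}(\mathcal{G},\omega)$. $\mathfrak{S}$ is the maximum of $\dim\mathfrak{inf}(\mathcal{G},\omega)$ over all regular, normal Cartan geometries of type $(G,P)$ associated to ODEs with $\kappa_H\not\equiv0$. *)

(* Defs.v *)
From HB Require Import structures.
From mathcomp Require Import all_boot all_order all_algebra.
From mathcomp Require Import all_classical all_reals all_analysis.

Set Implicit Arguments.
Unset Strict Implicit.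
Unset Printing Implicit Defensive.

Import Order.TTheory GRing.Theory Num.Theory.
Import numFieldNormedType.Exports.

Local Open Scope classical_set_scope.
Local Open Scope ring_scope.

(* The dimension of a linear subspace A of a possibly infinite-dimensional
   space, in [0, +oo]. *)
Definition dim_of (R : realType) (V : lmodType R) (A : set V) : \bar R :=
  ereal_sup [set k%:R%:E | k in [set k : nat |
    exists v : 'I_k -> V, (forall i, A (v i)) /\
      forall c : 'I_k -> R, \sum_i c i *: v i = 0 -> forall i, c i = 0]].

Section SmoothCalculus.
Context (R : realType).

(* U is meant to be open.  On finite-dimensional spaces, C^k amounts to the
   existence and continuity of all iterated directional derivatives of
   order at most k. *)
Fixpoint Ck (V W : normedModType R) (k : nat) (U : set V) (f : V -> W) : Prop :=
  (forall x, U x -> {for x, continuous f}) /\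
  (if k is k'.+1 then
     forall v, (forall x, U x -> derivable f x v) /\ Ck k' U (fun x => 'D_v f x)
   else True).

Definition Csmooth (V W : normedModType R) (U : set V) (f : V -> W) : Prop :=
  forall k, Ck k U f.

Record chart (M : topologicalType) (d : nat) := Chart {
  cdom : set M;
  cmap : M -> 'rV[R]_d;
  cinv : 'rV[R]_d -> M;
  cdom_open : open cdom;
  cimg_open : open (cmap @` cdom);
  cmapK : forall x, cdom x -> cinv (cmap x) = x;
  cmap_continuous : forall x, cdom x -> {for x, continuous cmap};
  cinv_continuous : forall y, (cmap @` cdom) y -> {for y, continuous cinv} }.

(* The atlas is the range of chart_at.  Choosing a preferred chart around
   each point realizes the tangent space at u as 'rV_d, via the coordinates
   of chart_at u. *)
Record manifold (d : nat) := Manifold {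
  mpoint :> topologicalType;
  m_hausdorff : hausdorff_space mpoint;
  m_second_countable : @second_countable mpoint;
  chart_at : mpoint -> chart mpoint d;
  chart_at_dom : forall u, cdom (chart_at u) u;
  chart_compat : forall u v,
    Csmooth (cmap (chart_at u) @` (cdom (chart_at u) `&` cdom (chart_at v)))
            (cmap (chart_at v) \o cinv (chart_at u)) }.

Section OnManifold.
Context (d : nat) (M : manifold d).
Implicit Types (W : normedModType R) (xi eta : M -> 'rV[R]_d).

(* the derivative at u of h along the tangent vector v *)
Definition dirD W (h : M -> W) (u : M) (v : 'rV[R]_d) : W :=
  'D_v (h \o cinv (chart_at u)) (cmap (chart_at u) u).

Definition smooth_fun W (O : set M) (h : M -> W) : Prop :=
  forall u, Csmooth (cmap (chart_at u) @` (cdom (chart_at u) `&` O))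
                    (h \o cinv (chart_at u)).

Definition smooth_into W (O : set W) (F : W -> M) : Prop :=
  (forall x, O x -> {for x, continuous F}) /\
  forall u, Csmooth (O `&` F @^-1` cdom (chart_at u)) (cmap (chart_at u) \o F).

(* smooth maps on an arbitrary subset S of a vector space: those which extend
   smoothly to a neighbourhood of each point *)
Definition smooth_from W (S : set W) (F : W -> M) : Prop :=
  forall x, S x -> exists (O : set W) (F' : W -> M),
    [/\ open O, O x, smooth_into O F' & forall y, O y -> S y -> F' y = F y].

(* A vector field assigns to u a tangent vector at u; vf_coord c xi are its
   components in the chart c, and coord_vf c w is the field with constant
   components w in the chart c. *)
Definition vf_coord (c : chart M d) xi : M -> 'rV[R]_d :=
  fun x => dirD (cmap c) x (xi x).

Definition coord_vf (c : chart M d) (w : 'rV[R]_d) : M -> 'rV[R]_d :=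
  fun x => 'D_w (cmap (chart_at x) \o cinv c) (cmap c x).

Definition smooth_vf xi : Prop :=
  forall u, smooth_fun (cdom (chart_at u)) (vf_coord (chart_at u) xi).

Definition lie_bracket xi eta : M -> 'rV[R]_d := fun u =>
  dirD (vf_coord (chart_at u) eta) u (xi u)
  - dirD (vf_coord (chart_at u) xi) u (eta u).

Definition tangent_map (F : M -> M) (u : M) (v : 'rV[R]_d) : 'rV[R]_d :=
  dirD (cmap (chart_at (F u)) \o F) u v.

Definition smooth_form W (om : M -> 'rV[R]_d -> W) : Prop :=
  forall u w, smooth_fun (cdom (chart_at u))
                         (fun x => om x (coord_vf (chart_at u) w x)).

Definition ext_d W (om : M -> 'rV[R]_d -> W) xi eta (u : M) : W :=
  dirD (fun x => om x (eta x)) u (xi u) - dirD (fun x => om x (xi x)) u (eta u)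
  - om u (lie_bracket xi eta u).

(* (L_xi om)(eta) *)
Definition lie_deriv W xi (om : M -> 'rV[R]_d -> W) eta (u : M) : W :=
  dirD (fun x => om x (eta x)) u (xi u) - om u (lie_bracket xi eta u).

End OnManifold.
End SmoothCalculus.

Section LieAlgebra.
Context (R : realType) (n m : nat).

(* The triple (x, h, y) stands for x X + h H + y Y, where X, H, Y act on the
   plane with basis (x, y) as the matrices E_01, E_00 - E_11, E_10. *)
Definition sl2 : Type := (R * R * R)%type.
Definition sl2_mx (a : sl2) : 'M[R]_2 :=
  let: (x, h, y) := a in
  \matrix_(i, j) if i == 0 then (if j == 0 then h else x)
                 else (if j == 0 then y else - h).
Definition mx_sl2 (A : 'M[R]_2) : sl2 := (A 0 1, A 0 0, A 1 0).

(* An element (a, b, v) has the component \sum_(i, k) v i k *: E_i (x) e_k in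
   V_n (x) W. *)
Definition galg : Type := (sl2 * 'M[R]_m * 'M[R]_(n.+1, m))%type.

Definition gX : galg := ((1, 0, 0), 0, 0).
Definition gH : galg := ((0, 1, 0), 0, 0).
Definition gY : galg := ((0, 0, 1), 0, 0).
Definition gid : galg := (0, 1%:M, 0).
Definition gE (w : 'rV[R]_m) : galg :=
  (0, 0, \matrix_(i, k) if i == ord_max then w 0 k else 0).
Definition gZ : galg := - (2^-1) *: (gH + (n + 2)%:R *: gid).

(* Entry (j, i) is the coefficient of E_j in a . E_i; recall
   X E_i = E_(i-1), H E_i = (n - 2i) E_i, Y E_i = (n - i)(i + 1) E_(i+1). *)
Definition sl2_act (a : sl2) : 'M[R]_n.+1 :=
  let: (x, h, y) := a in
  \matrix_(j, i) (x * (j.+1 == i)%:R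
                  + h * (n%:R - (2 * i)%:R) * (j == i)%:R
                  + y * ((n - i) * i.+1)%:R * (j == i.+1 :> nat)%:R).

Definition gact (A : galg) (v : 'M[R]_(n.+1, m)) : 'M[R]_(n.+1, m) :=
  sl2_act A.1.1 *m v + v *m A.1.2^T.

Definition br (A B : galg) : galg :=
  (mx_sl2 (sl2_mx A.1.1 *m sl2_mx B.1.1 - sl2_mx B.1.1 *m sl2_mx A.1.1),
   A.1.2 *m B.1.2 - B.1.2 *m A.1.2,
   gact A B.2 - gact B A.2).

(* the projection onto the eigenspace g_k of ad Z *)
Definition gpr (k : int) (A : galg) : galg :=
  let: (x, h, y) := A.1.1 in
  ((if k == -1 then x else 0, if k == 0 then h else 0, if k == 1 then y else 0),
   if k == 0 then A.1.2 else 0,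
   \matrix_(i, j) if k == i%:Z - n.+1%:Z then A.2 i j else 0).

Definition grade (k : int) : set galg := [set A | gpr k A = A].
Definition filt (k : int) : set galg := [set A | forall j, j < k -> gpr j A = 0].
Definition gneg : set galg := [set A | forall j : int, 0 <= j -> gpr j A = 0].
Definition gp : set galg := filt 0.

(* The structure group P, inside GL_2 x GL_m; for m = 1, P is the lower
   triangular subgroup of GL_2 and the second factor is trivial. *)
Definition pmx : Type := ('M[R]_2 * 'M[R]_m)%type.
Definition P : set pmx := [set p : pmx |
  [/\ p.1 0 1 = 0, p.1 \in unitmx, p.2 \in unitmx &
      if m == 1%N then p.2 = 1%:M else \det p.1 = 1]].
Definition pmul (p q : pmx) : pmx := (p.1 *m q.1, p.2 *m q.2).
Definition pinv (p : pmx) : pmx := (invmx p.1, invmx p.2).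
Definition pone : pmx := (1%:M, 1%:M).

(* The action of A in GL_2 on V_n by substituting A x, A y for x, y: entry
   (j, i) is the coefficient of E_j in (1/i!) (A x)^(n-i) (A y)^i, computed
   after setting x = 1 and y = 'X. *)
Definition sym_act (A : 'M[R]_2) : 'M[R]_n.+1 :=
  \matrix_(j, i) ((j`!)%:R / (i`!)%:R
    * (((A 0 0)%:P + A 1 0 *: 'X) ^+ (n - i) *
       ((A 0 1)%:P + A 1 1 *: 'X) ^+ i)`_j).

Definition Ad (p : pmx) (A : galg) : galg :=
  (mx_sl2 (p.1 *m sl2_mx A.1.1 *m invmx p.1),
   p.2 *m A.1.2 *m invmx p.2,
   sym_act p.1 *m A.2 *m p.2^T).

(* The identification of the Lie algebra of P with a subalgebra of g.  For
   m = 1, gl_2 is identified with sl_2 x gl_1 through its action on V_n, where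
   the identity of gl_2 acts as n.  For m > 1, \tr a.1 = 0. *)
Definition lieP (a : pmx) : galg :=
  (mx_sl2 (a.1 - (\tr a.1 / 2)%:M), a.2 + (n%:R * (\tr a.1 / 2))%:M, 0).

Definition G0 : set pmx :=
  [set p : pmx | P p /\ forall A, grade 0 A -> grade 0 (Ad p A)].

Definition cochain1 := galg -> galg.
Definition cochain2 := galg -> galg -> galg.
Definition cochain3 := galg -> galg -> galg -> galg.

Definition is_cochain1 (f : cochain1) : Prop := linear f.
Definition is_cochain2 (f : cochain2) : Prop :=
  [/\ forall A, linear (f A), forall B, linear (f^~ B) & forall A, f A A = 0].
Definition is_cochain3 (f : cochain3) : Prop :=
  [/\ forall A, is_cochain2 (f A), forall B C, linear (fun A => f A B C)
    & forall A B, f A A B = 0].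

(* /\^k (g/p)^* (x) g, as the cochains on g killed by insertion of p; through
   g/p = g_-, these are also the cochains of g_- with values in g *)
Definition hor1 : set cochain1 :=
  [set f | is_cochain1 f /\ forall A, gp A -> f A = 0].
Definition hor2 : set cochain2 :=
  [set f | is_cochain2 f /\ forall A B, gp A -> f A B = 0].
Definition hor3 : set cochain3 :=
  [set f | is_cochain3 f /\ forall A B C, gp A -> f A B C = 0].

(* Chevalley-Eilenberg differentials with values in the adjoint module *)
Definition d1 (f : cochain1) : cochain2 := fun A B =>
  br A (f B) - br B (f A) - f (br A B).
Definition d2 (f : cochain2) : cochain3 := fun A B C =>
  br A (f B C) - br B (f A C) + br C (f A B)
  - f (br A B) C + f (br A C) B - f (br B C) A.

Definition gtr (A : galg) : galg :=
  let: (x, h, y) := A.1.1 in ((y, h, x), A.1.2^T, 0).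

Record suitable (ip : galg -> galg -> R) : Prop := Suitable {
  ip_linear : forall A, scalar (ip A);
  ip_sym : forall A B, ip A B = ip B A;
  ip_pos : forall A, A != 0 -> 0 < ip A A;
  ip_grade : forall (i j : int) A B, i != j -> grade i A -> grade j B ->
    ip A B = 0;
  ip_ad : forall A B C, A.2 = 0 -> ip (br A B) C = ip B (br (gtr A) C) }.

Section Codifferential.
Context (ip : galg -> galg -> R).

Definition orthonormal_basis (N : nat) (e : 'I_N -> galg) : Prop :=
  (forall i j, ip (e i) (e j) = (i == j)%:R) /\
  forall A, A = \sum_i ip A (e i) *: e i.

(* f' = del^* f: f' is the image of f under the adjoint of d1, resp. d2, for
   the inner products induced by ip on cochains.  These are independent of
   the orthonormal basis e. *)
Definition codiff2 (f : cochain2) (f' : cochain1) : Prop :=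
  [/\ hor2 f, hor1 f' &
   forall N (e : 'I_N -> galg), orthonormal_basis e ->
   forall g : cochain1, is_cochain1 g ->
     \sum_i ip (f' (e i)) (g (e i)) =
     \sum_(i < N) \sum_(j < N | (i < j)%N) ip (f (e i) (e j)) (d1 g (e i) (e j))].
Definition codiff3 (f : cochain3) (f' : cochain2) : Prop :=
  [/\ hor3 f, hor2 f' &
   forall N (e : 'I_N -> galg), orthonormal_basis e ->
   forall g : cochain2, is_cochain2 g ->
     \sum_(i < N) \sum_(j < N | (i < j)%N) ip (f' (e i) (e j)) (g (e i) (e j)) =
     \sum_(i < N) \sum_(j < N | (i < j)%N) \sum_(k < N | (j < k)%N)
       ip (f (e i) (e j) (e k)) (d2 g (e i) (e j) (e k))].

Definition ker_codiff : set cochain2 := [set f | codiff2 f (fun=> 0)].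
Definition im_codiff : set cochain2 := [set f | exists g, codiff3 g f].
End Codifferential.

(* Elements of H^2(g_-, g) are represented by cocycles modulo B2, and
   submodules of H^2(g_-, g) by submodules of Z2 containing B2. *)
Definition Z2 : set cochain2 := [set f | hor2 f /\
  forall A B C, gneg A -> gneg B -> gneg C -> d2 f A B C = 0].
Definition B2 : set cochain2 := [set f | hor2 f /\
  exists2 g, hor1 g & forall A B, gneg A -> gneg B -> f A B = d1 g A B].

Definition lie_act (A : galg) (f : cochain2) : cochain2 := fun B C =>
  br A (f B C) - f (br A B) C - f B (br A C).
Definition grp_act (p : pmx) (f : cochain2) : cochain2 := fun B C =>
  Ad p (f (Ad (pinv p) B) (Ad (pinv p) C)).

(* H^2_+: sums of eigenvectors of Z in H^2(g_-, g) with positive eigenvalues *)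
Definition H2plus : set cochain2 := [set f | Z2 f /\
  exists (r : nat) (c : 'I_r -> cochain2) (lam : 'I_r -> R),
    (forall i, [/\ 0 < lam i, Z2 (c i) & B2 (lie_act gZ (c i) - lam i *: c i)])
    /\ B2 (f - \sum_i c i)].

Definition G0_submodule (S : set cochain2) : Prop :=
  [/\ B2 `<=` S, S `<=` Z2,
      forall (a : R) f g, S f -> S g -> S (a *: f + g)
    & forall p f, G0 p -> S f -> S (grp_act p f)].

(* The Hodge decomposition identifies ker del^* / im del^* with H^2(g_-, g):
   h is a harmonic representative of the class of f modulo im del^*. *)
Definition harmonic_rep ip (f h : cochain2) : Prop :=
  [/\ ker_codiff ip f, ker_codiff ip h, Z2 h & im_codiff ip (f - h)].

(* The annihilator and the Tanaka algebra of the class of f in a quotient by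
   the submodule N of cochains. *)
Definition ann (N : set cochain2) (f : cochain2) : set galg :=
  [set A | grade 0 A /\ N (lie_act A f)].
Definition tanaka (N : set cochain2) (f : cochain2) : set galg :=
  [set A | ann N f (gpr 0 A) /\
           forall B, grade (-1) B -> ann N f (br (gpr 1 A) B)].

End LieAlgebra.

Section CartanGeometry.
Context (R : realType) (n m : nat).
Local Notation galg := (galg R n m).
Local Notation pmx := (pmx R m).

(* (t, u), where the k-th row of u is u_k *)
Definition jet : Type := (R * 'M[R]_(n.+1, m))%type.

(* The manifold {u_(n+1) = f} is identified with the domain of f in J^n by the
   coordinates (t, u_0, .., u_n). *)
Record ode := Ode {
  odom : set jet;
  rhs : jet -> 'rV[R]_m;
  odom_open : open odom;
  odom_connected : connected odom;
  rhs_smooth : Csmooth odom rhs }.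

Definition total_deriv (Q : ode) (x : jet) : jet :=
  (1, \matrix_(k, a) if (k < n)%N then x.2 (inord k.+1) a else rhs Q x 0 a).
Definition dist_E (Q : ode) (x : jet) : set jet :=
  [set s *: total_deriv Q x | s in setT].
Definition dist_V : set jet :=
  [set w : jet | w.1 = 0 /\ forall (k : 'I_n.+1) a, (k < n)%N -> w.2 k a = 0].

(* The local trivializations are given by a local section s and the fibre
   coordinate tau.  Smoothness of the action follows from local triviality. *)
Record principal_bundle (D : set jet) := PrincipalBundle {
  bdim : nat;
  tot :> manifold R bdim;
  proj : tot -> jet;
  act : tot -> pmx -> tot;
  proj_dom : forall u, D (proj u);
  proj_smooth : smooth_fun setT proj;
  act1 : forall u, act u (pone R m) = u;
  actM : forall u p q, P p -> P q -> act (act u p) q = act u (pmul p q);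
  proj_act : forall u p, P p -> proj (act u p) = proj u;
  loc_triv : forall x, D x ->
    exists (O : set jet) (s : jet -> tot) (tau : tot -> pmx),
      [/\ open O, O x & O `<=` D] /\
      [/\ forall y, O y -> proj (s y) = y,
          forall u, O (proj u) -> P (tau u) /\ act (s (proj u)) (tau u) = u,
          forall y p, O y -> P p -> tau (act (s y) p) = p,
          smooth_fun (proj @^-1` O) tau
        & smooth_from (O `*` @P R m) (fun yp => act (s yp.1) yp.2)] }.

Record cartan_connection (D : set jet) (B : principal_bundle D) :=
  CartanConnection {
  om : B -> 'rV[R]_(bdim B) -> galg;
  omi : B -> galg -> 'rV[R]_(bdim B);
  om_linear : forall u, linear (om u);
  omK : forall u, cancel (om u) (omi u);
  omiK : forall u, cancel (omi u) (om u);
  om_smooth : smooth_form om;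
  om_equivariant : forall u p v, P p ->
    om (act u p) (tangent_map ((@act D B)^~ p) u v) = Ad (pinv p) (om u v);
  om_fundamental : forall u (c : R -> pmx),
    (forall t, P (c t)) -> c 0 = pone R m -> Csmooth setT c ->
    om u ('D_1 (fun t => cmap (chart_at u) (act u (c t))) 0)
    = lieP n ('D_1 c 0) }.

Section Curvature.
Context (D : set jet) (B : principal_bundle D) (w : cartan_connection B).

Definition curvature (xi eta : B -> 'rV[R]_(bdim B)) (u : B) : galg :=
  ext_d (om w) xi eta u + br (om w u (xi u)) (om w u (eta u)).

Definition kappa (u : B) : cochain2 R n m := fun A C =>
  curvature (fun x => omi w x A) (fun x => omi w x C) u.

Definition regular : Prop := forall u (i j : int) A C,
  filt i A -> filt j C -> filt (i + j + 1) (kappa u A C).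

Definition normal ip : Prop := forall u, ker_codiff ip (kappa u).

Definition infinitesimal_symmetries : set (B -> 'rV[R]_(bdim B)) :=
  [set xi | [/\ smooth_vf xi,
    forall u p, P p -> xi (act u p) = tangent_map ((@act D B)^~ p) u (xi u)
  & forall eta, smooth_vf eta -> forall u, lie_deriv xi (om w) eta u = 0]].

Definition sym_f (u : B) : set galg :=
  [set om w u (xi u) | xi in infinitesimal_symmetries].

(* gr (f u), as a graded subspace of g = gr g: the class of C in
   f^k / f^(k+1) is gpr k C *)
Definition sym_s (u : B) : set galg :=
  [set A | forall k : int,
     exists C, [/\ sym_f u C, filt k C & gpr k C = gpr k A]].
End Curvature.

(* regular normal Cartan geometries of type (G, P) associated to ODEs *)
Record ode_geometry (ip : galg -> galg -> R) := OdeGeometry {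
  og_ode : ode;
  og_bundle : principal_bundle (odom og_ode);
  og_conn : cartan_connection og_bundle;
  og_regular : regular og_conn;
  og_normal : normal og_conn ip;
  og_E : forall u,
    [set dirD (@proj _ og_bundle) u v | v in
       [set v | exists s : R, gp (om og_conn u v - s *: gX R n m)]]
    = dist_E og_ode (proj u);
  og_V : forall u,
    [set dirD (@proj _ og_bundle) u v | v in
       [set v | exists z : 'rV[R]_m, gp (om og_conn u v - gE n z)]]
    = dist_V }.

Section Numbers.
Context (ip : galg -> galg -> R).

(* kappa_H is not identically zero *)
Definition nonflat (X : ode_geometry ip) : Prop :=
  exists u, ~ im_codiff ip (kappa (og_conn X) u).

(* the minimal submodule of H^2_+ in which kappa_H takes its values *)
Definition effective : set (cochain2 R n m) :=
  [set f | forall S : set (cochain2 R n m),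
     G0_submodule S -> S `<=` @H2plus R n m ->
     (forall (X : ode_geometry ip) u h,
        harmonic_rep ip (kappa (og_conn X) u) h -> S h) ->
     S f].

(* The suprema below are maxima: their members are integers, bounded by the
   dimension of g. *)
Definition max_tanaka_dim : \bar R :=
  ereal_sup [set dim_of (tanaka (@B2 R n m) f) | f in
    [set f | effective f /\ ~ B2 f]].

Definition submax_sym_dim : \bar R :=
  ereal_sup [set d : \bar R | exists X : ode_geometry ip,
    nonflat X /\ d = dim_of (infinitesimal_symmetries (og_conn X))].
End Numbers.

End CartanGeometry.

(* Main.v *)
Require Import Defs.
From HB Require Import structures.
From mathcomp Require Import all_boot all_order all_algebra.
From mathcomp Require Import all_classical all_reals all_analysis.
From mathcomp Require Import ring lra zify.

(** Let kappa be the curvature function of a regular normal geometry. An infinitesimal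
    symmetry xi preserves kappa and commutes with the fields omega^-1(A), A in g. At a
    point u, put C = omega(xi_u).

    The symmetry algebra. If C lies in p, then omega^-1(C) and xi agree at u. As kappa is
    constant along xi and changes along omega^-1(C) by the action of - C
    ([flat_curv_vertical], the Bianchi identity), C kills kappa(u)
    ([isotropy_lie_act]). Since Y maps ker d* to im d* ([lie_act_gY]), the component of C
    in g_0 kills kappa(u) modulo im d*. If C = c Y, differentiating the equation
    xi . kappa = 0 once more, along omega^-1(A) with A in g_-1, shows that [C, A] acts on
    kappa(u) as - c Y acts on the derivative of kappa along omega^-1(A). By normality this
    derivative is in ker d*, so that [C, A] also kills kappa(u) modulo im d*
    ([isotropy_second_order]). Both facts together are the inclusion of s(u) in the Tanaka
    algebra ([sym_s_tanaka]). That Y maps ker d* to im d* is seen by duality: im d* is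
    the orthogonal complement of the cocycles of g_- ([im_codiffP]), the adjoint of Y is X,
    and by Cartan's formula X maps a cocycle to a coboundary of g_-, to which ker d* is
    orthogonal ([ker_codiffP]).

    The bound S <= U. A symmetry that vanishes at one point vanishes identically: it
    solves a linear first-order system, so its zero set is open and closed, and it is a
    union of fibres over a connected base ([symmetry_zero]). Hence the symmetries embed
    in f(u), whose dimension is that of s(u) ([dim_symmetries]). At a point u where kappa
    is not in im d*, let h be the orthogonal projection of kappa(u) onto the cocycles
    ([harmonic_rep_exists]). It belongs to the effective part by definition, it is not a
    coboundary ([harmonic_B2]), and its Tanaka algebra contains that of kappa(u)
    ([harmonic_tanaka]).

    The bound U < dim g. The space H^2_+ is a G_0-submodule ([H2plus_submodule]) and
    contains the harmonic representatives, because regularity leaves only components of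
    positive degree ([harmonic_H2plus]); so it contains the effective part. The element Z
    acts on H^2_+ with positive eigenvalues, hence it kills only the zero class
    ([H2plus_gZ]), and it lies in no Tanaka algebra ([max_tanaka_lt]).

    The calculus is carried out in charts, where a Cartan connection becomes a coframe on
    an open set of a coordinate space ([flat_curv], [kappa_chart]). *)

Set Implicit Arguments.
Unset Strict Implicit.
Unset Printing Implicit Defensive.

Import Order.TTheory GRing.Theory Num.Theory.
Import numFieldNormedType.Exports.

Local Open Scope classical_set_scope.
Local Open Scope ring_scope.

(** * Linear maps *)

(** The maps below mostly come with a proof of linearity, rather than as bundled
    linear maps. *)
Section LinearFunctions.
Context (R : pzRingType) (V W : lmodType R) (f : V -> W).
Hypothesis lf : linear f.

Let LM := GRing.isLinear.Build _ _ _ _ _ lf.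
Let LL : {linear V -> W} := HB.pack f LM.

Lemma lin0 : f 0 = 0. Proof. exact: (linear0 LL). Qed.
Lemma linN u : f (- u) = - f u. Proof. exact: (linearN LL). Qed.
Lemma linD u v : f (u + v) = f u + f v. Proof. exact: (linearD LL). Qed.
Lemma linB u v : f (u - v) = f u - f v. Proof. exact: (linearB LL). Qed.
Lemma linZ a u : f (a *: u) = a *: f u. Proof. exact: (linearZ_LR LL). Qed.
Lemma lin_sum (I : Type) (r : seq I) (P : pred I) (F : I -> V) :
  f (\sum_(i <- r | P i) F i) = \sum_(i <- r | P i) f (F i).
Proof. exact: (linear_sum LL). Qed.
End LinearFunctions.

(** * Differentiability of C^1 maps *)

Section Differentiability.
Context (R : realType).

Lemma continuous_at_sum (T : topologicalType) (W : normedModType R) (I : Type)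
    (r : seq I) (F : I -> T -> W) x :
  (forall i, {for x, continuous (F i)}) ->
  {for x, continuous (fun y => \sum_(i <- r) F i y)}.
Proof.
by move=> Fc; apply: cvg_big => [|i _]; [exact: add_continuous | exact: Fc].
Qed.

Lemma differentiable_from_bound (V W : normedModType R) (f : V -> W)
    (L : {linear V -> W}) x :
  continuous L ->
  (forall e, 0 < e ->
     \forall h \near (0 : V), `|f (h + x) - f x - L h| <= e * `|h|) ->
  differentiable f x.
Proof.
move=> Lc fL.
suff dE : f \o shift x = cst (f x) + L +o_ 0 id.
  by apply/diff_locallyP; rewrite (diff_unique Lc dE).
apply/eqaddoP => e e0; apply: filterS (fL e e0) => h /=.
by rewrite !fctE opprD addrA.
Qed.

Lemma is_derive_line (V W : normedModType R) (f : V -> W) (z v : V) (t : R) :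
  derivable f (z + t *: v) v ->
  is_derive t 1 (fun s => f (z + s *: v)) ('D_v f (z + t *: v)).
Proof.
have E : (fun h : R => h^-1 *: (((fun s => f (z + s *: v)) \o shift t) (h *: 1)
    - f (z + t *: v))) =
  (fun h => h^-1 *: ((f \o shift (z + t *: v)) (h *: v) - f (z + t *: v))).
  apply/funext => h /=; congr (_ *: (f _ - _)).
  by rewrite [h *: 1]mulr1 scalerDl addrCA addrC.
by move=> dv; split; rewrite /derivable /derive E.
Qed.

(** Absolute values, so that it applies to displacements of either sign. *)
Lemma line_MVT (V : normedModType R) (f : V -> R) (z v : V) (s : R) :
  (forall t, `|t| <= `|s| -> derivable f (z + t *: v) v) ->
  exists2 t, `|t| <= `|s| & f (z + s *: v) - f z = s * 'D_v f (z + t *: v).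
Proof.
move=> df; pose G t := f (z + t *: v).
have dG (t : R) : `|t| <= `|s| -> is_derive t 1 G ('D_v f (z + t *: v)).
  by move=> ts; exact/is_derive_line/df.
have cG (t : R) : `|t| <= `|s| -> {for t, continuous G}.
  move=> /dG dGt; apply: differentiable_continuous.
  by apply/derivable1_diffP.
have [s0|s0] := leP 0 s.
  have H (t : R) : t \in `[0, s] -> `|t| <= `|s|.
    by move=> /itvP ti; rewrite !ger0_norm ?ti.
  have [||t ti] := @MVT_segment _ G (fun t => 'D_v f (z + t *: v)) _ _ s0.
  - by move=> t /subset_itv_oo_cc ti; exact/dG/H.
  - by apply: continuous_in_subspaceT => t; rewrite inE /= => /H /cG.
  rewrite /G scale0r addr0 subr0 mulrC => E.
  by exists t => //; exact: H.
have H (t : R) : t \in `[s, 0] -> `|t| <= `|s|.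
  by move=> /itvP ti; rewrite !ler0_norm ?lerN2 ?ti // ltW.
have [||t ti] := @MVT_segment _ G (fun t => 'D_v f (z + t *: v)) _ _ (ltW s0).
- by move=> t /subset_itv_oo_cc ti; exact/dG/H.
- by apply: continuous_in_subspaceT => t; rewrite inE /= => /H /cG.
rewrite /G scale0r addr0 sub0r mulrN mulrC => E.
by exists t; [exact: H | rewrite -[RHS]opprK -E opprB].
Qed.

(** Interpolates between 0 and [h], one coordinate at a time. *)
Let trunc d (h : 'rV[R]_d) (k : nat) : 'rV[R]_d :=
  \row_j (if (j < k)%N then h 0 j else 0).

Lemma norm_coord d (h : 'rV[R]_d) j : `|h 0 j| <= `|h|.
Proof.
rewrite [leRHS]/Num.Def.normr/= mx_normrE.
by apply: (le_trans _ (le_bigmax _ _ (ord0, j))).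
Qed.

Lemma norm_rV_le d (h : 'rV[R]_d) (c : R) : 0 <= c ->
  (forall j, `|h 0 j| <= c) -> `|h| <= c.
Proof.
move=> c0 hc; rewrite [leLHS]/Num.Def.normr/= mx_normrE.
by apply: bigmax_le => // -[i j] _ /=; rewrite ord1.
Qed.

(** The increment from [x] to [x + h] is split along the coordinate axes. The mean
    value theorem turns each piece into a partial derivative at a nearby point, and
    continuity of the partial derivatives makes the total error small compared to
    the norm of [h]. *)
Lemma C1_differentiable_scalar d (f : 'rV[R]_d -> R) (U : set 'rV[R]_d) x :
  open U -> U x -> (forall v z, U z -> derivable f z v) ->
  (forall v, {for x, continuous (fun z => 'D_v f z)}) -> differentiable f x.
Proof.
move=> oU Ux df cf.
pose e (j : 'I_d) : 'rV[R]_d := delta_mx 0 j.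
pose L (h : 'rV[R]_d) : R := \sum_j h 0 j * 'D_(e j) f x.
have Llin : linear_for *%R L.
  move=> a u w; rewrite /L mulr_sumr -big_split; apply: eq_bigr => j _.
  by rewrite !mxE mulrDl mulrA.
pose LM := GRing.isLinear.Build _ _ _ _ L Llin.
pose LL : {linear 'rV[R]_d -> R} := HB.pack L LM.
have Lc : continuous LL.
  move=> y; apply: continuous_at_sum => j; apply: continuousZr_tmp.
  exact: (@coord_continuous R 1 d ord0 j y).
apply: (differentiable_from_bound Lc) => _ /posnumP[eps].
(* d errors of size c * `|h| add up to at most eps * `|h| *)
pose c : R := eps%:num / d.+1%:R.
have c0 : 0 < c by rewrite divr_gt0.
have [r r0 rU] : exists2 r, 0 < r & forall y, `|y - x| < r ->
    U y /\ forall j, `|'D_(e j) f y - 'D_(e j) f x| <= c.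
  pose D := [set y | forall j, `|'D_(e j) f y - 'D_(e j) f x| <= c].
  have nD : nbhs x D.
    apply: (@filter_forall _ _ (fun j => [set y | `|'D_(e j) f y - 'D_(e j) f x| <= c]) (nbhs x) (nbhs_filter x)) => j.
    have /cvgrPdist_le/(_ _ c0) := cf (e j).
    by apply: filterS => y; rewrite distrC.
  have : nbhs x (U `&` D) by apply: filterI nD; exact: open_nbhs_nbhs.
  move=> /nbhs_ballP[r /= r0 rU]; exists r => // y xy; apply: rU.
  by rewrite -ball_normE /= distrC.
have hr0 : \forall h \near (0 : 'rV[R]_d), `|h| < r.
  by apply/nbhs_ballP; exists r => //= h; rewrite -ball_normE /= sub0r normrN.
apply: filterS hr0 => h hr.
have tr k : `|trunc h k| <= `|h|.
  apply: norm_rV_le => // j; rewrite mxE; case: ifP => _; first exact: norm_coord.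
  by rewrite normr0.
have tS (k : 'I_d) : trunc h k.+1 = trunc h k + h 0 k *: e k.
  apply/rowP => j; rewrite !mxE eqxx /= ltnS leq_eqVlt -val_eqE /=.
  case: eqP => [/val_inj -> | jk]; first by rewrite ltnn mulr1 add0r.
  by rewrite mulr0 addr0.
have td : trunc h d = h by apply/rowP => j; rewrite mxE ltn_ord.
have t0 : trunc h 0 = 0 by apply/rowP => j; rewrite !mxE.
have Up (k : 'I_d) (t : R) : `|t| <= `|h 0 k| ->
    `|(x + trunc h k + t *: e k) - x| < r.
  move=> ht; apply: le_lt_trans hr; rewrite addrC -addrA addKr.
  apply: norm_rV_le => // j; rewrite !mxE eqxx /=.
  have [->|jk] := eqVneq j k.
    by rewrite ltnn add0r mulr1 (le_trans ht) // norm_coord.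
  by rewrite mulr0 addr0; case: ifP => _; rewrite ?normr0 ?norm_coord.
have step (k : 'I_d) : `|f (x + trunc h k.+1) - f (x + trunc h k)
    - h 0 k * 'D_(e k) f x| <= `|h| * c.
  have [|t ht] := @line_MVT _ f (x + trunc h k) (e k) (h 0 k).
    by move=> t /Up /rU[Ut _]; exact: df.
  rewrite -addrA -tS => ->; rewrite -mulrBr normrM ler_pM ?norm_coord //.
  by have [_ ->] := rU _ (Up _ _ ht).
have -> : f (h + x) - f x - LL h =
    \sum_(k < d) (f (x + trunc h k.+1) - f (x + trunc h k) - h 0 k * 'D_(e k) f x).
  rewrite big_split /= sumrN -(big_mkord xpredT (fun k => f (x + trunc h k.+1) - f (x + trunc h k))).
  rewrite telescope_sumr // td t0 addr0.
  by rewrite [h + x]addrC.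
apply: (le_trans (ler_norm_sum _ _ _)).
apply: (le_trans (ler_sum _ (fun k _ => step k))).
rewrite sumr_const card_ord -mulr_natr -mulrA mulrC ler_wpM2r // /c.
by rewrite mulrAC ler_pdivrMr // ler_pM2l // ler_nat.
Qed.
End Differentiability.

(** * Closure properties of C^k maps *)

Section Coordinates.
Context (R : realType).

(** Stands for finite dimension together with the Euclidean topology: continuous
    linear coordinates reduce vector-valued calculus to scalar calculus. *)
Definition has_coordinates (W : normedModType R) : Prop :=
  exists (N : nat) (b : 'I_N -> W) (l : 'I_N -> W -> R),
    [/\ forall i, scalar (l i), forall i, continuous (l i)
      & forall w, w = \sum_i l i w *: b i].

Lemma scalar_coordinates : has_coordinates R.
Proof.
exists 1, (fun=> 1), (fun=> id); split=> // [_ x|w]; first exact: cvg_id.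
by rewrite big_ord1 [_ *: _]mulr1.
Qed.

Lemma matrix_coordinates (p q : nat) : has_coordinates ('M[R]_(p, q)).
Proof.
pose I : finType := ('I_p * 'I_q)%type.
exists #|I|, (fun i => delta_mx (enum_val i).1 (enum_val i).2),
  (fun i (w : 'M[R]_(p, q)) => w (enum_val i).1 (enum_val i).2); split.
- by move=> i a u v; rewrite !mxE.
- by move=> i; exact: coord_continuous.
move=> w; rewrite {1}[w]matrix_sum_delta pair_big /=.
rewrite (reindex (fun i : 'I_#|I| => enum_val i)) //=.
exact/onW_bij/enum_val_bij.
Qed.

Lemma prod_coordinates (W1 W2 : normedModType R) :
  has_coordinates W1 -> has_coordinates W2 ->
  has_coordinates (W1 * W2)%type.
Proof.
move=> [N1 [b1 [l1 [lin1 c1 e1]]]] [N2 [b2 [l2 [lin2 c2 e2]]]].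
exists (N1 + N2)%N,
  (fun i => match fintype.split i with inl j => (b1 j, 0) | inr j => (0, b2 j) end),
  (fun i w => match fintype.split i with inl j => l1 j w.1 | inr j => l2 j w.2 end).
split.
- by move=> i a u v; case: (fintype.split i) => j; rewrite /= ?lin1 ?lin2.
- move=> i x; case: (fintype.split i) => j.
    by apply: (@continuous_comp _ _ _ fst (l1 j)); [exact: cvg_fst | exact: c1].
  by apply: (@continuous_comp _ _ _ snd (l2 j)); [exact: cvg_snd | exact: c2].
move=> [w1 w2]; rewrite big_split_ord /=.
under eq_bigr => j _ do rewrite (unsplitK (inl j)) /=.
under [X in _ + X]eq_bigr => j _ do rewrite (unsplitK (inr j)) /=.
rewrite [in LHS](e1 w1) [in LHS](e2 w2).
apply: injective_projections.
  rewrite raddfD !raddf_sum /=.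
  by rewrite [X in _ + X]big1 ?addr0 // => j _; rewrite scaler0.
rewrite raddfD !raddf_sum /=.
by rewrite [X in X + _]big1 ?add0r // => j _; rewrite scaler0.
Qed.

Lemma linear_continuous_coordinates (W W' : normedModType R) (L : W -> W') :
  has_coordinates W -> linear L -> continuous L.
Proof.
move=> [N [b [l [_ cl e]]]] linL.
have LE : L = fun w => \sum_i l i w *: L (b i).
  apply/funext => w; rewrite {1}[w]e (lin_sum linL).
  by apply: eq_bigr => i _; exact: (linZ linL).
rewrite LE => w; apply: continuous_at_sum => i.
exact: (continuousZr_tmp (cl i w)).
Qed.

End Coordinates.

Section SmoothClosure.
Context (R : realType).
Implicit Types V W : normedModType R.

Lemma near_open (V W : normedModType R) (U : set V) (f g : V -> W) x :
  open U -> U x -> {in U, f =1 g} -> \forall y \near x, f y = g y.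
Proof.
move=> oU Ux fg; apply: filterS (open_nbhs_nbhs (conj oU Ux)) => y Uy.
by apply: fg; rewrite inE.
Qed.

Lemma Ck_ext (V W : normedModType R) k (U : set V) (f g : V -> W) :
  open U -> {in U, f =1 g} -> Ck k U f -> Ck k U g.
Proof.
move=> oU; have cg (f' g' : V -> W) : {in U, f' =1 g'} ->
    (forall x, U x -> {for x, continuous f'}) ->
    forall x, U x -> {for x, continuous g'}.
  move=> fg cf x Ux; have := cf x Ux.
  rewrite /prop_for /continuous_at (fg x) ?inE // => fx.
  apply: cvg_trans fx; apply: near_eq_cvg.
  by apply: filterS (near_open oU Ux fg) => y ->.
elim: k f g => [|k IH] f g fg [cf df]; split => //; try exact: cg cf.
move=> v; have [dfv Cf] := df v; split.
  by move=> x Ux; apply: (near_eq_derivable (near_open oU Ux fg)); exact: dfv.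
apply: IH Cf => x; rewrite inE => Ux.
exact: (near_eq_derive v (near_open oU Ux fg)).
Qed.

Lemma Ck_pred (V W : normedModType R) k (U : set V) (f : V -> W) :
  Ck k.+1 U f -> Ck k U f.
Proof.
elim: k f => [|k IH] f; first by case.
move=> [cf df]; split => // v; have [dfv Cf] := df v; split=> //; exact: IH.
Qed.

Lemma Ck_subset (V W : normedModType R) k (U U' : set V) (f : V -> W) :
  U' `<=` U -> Ck k U f -> Ck k U' f.
Proof.
move=> UU; elim: k f => [|k IH] f [cf df]; split => //.
  by move=> x /UU /cf.
  by move=> x /UU /cf.
move=> v; have [dfv Cf] := df v; split; last exact: IH.
by move=> x /UU /dfv.
Qed.

Lemma Ck_cst (V W : normedModType R) k (U : set V) (w : W) :
  Ck k U (cst w).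
Proof.
elim: k w => [|k IH] w; split=> //; try by move=> x _; exact: cvg_cst.
move=> v; split; first by move=> x _; exact: derivable_cst.
have -> : (fun x : V => 'D_v (cst w) x) = cst 0 by apply/funext => x; rewrite derive_cst.
exact: IH.
Qed.

Lemma Ck_add (V W : normedModType R) k (U : set V) (f g : V -> W) :
  open U -> Ck k U f -> Ck k U g -> Ck k U (fun x => f x + g x).
Proof.
move=> oU; elim: k f g => [|k IH] f g [cf df] [cg dg]; split => //;
  try by move=> x Ux; apply: continuousD; [exact: cf | exact: cg].
move=> v; have [dfv Cf] := df v; have [dgv Cg] := dg v; split.
  by move=> x Ux; apply: derivableD; [exact: dfv | exact: dgv].
apply: Ck_ext (IH _ _ Cf Cg) => // x; rewrite inE => Ux.
by rewrite (deriveD (dfv x Ux) (dgv x Ux)).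
Qed.

Lemma is_derive_linear (V W W' : normedModType R) (L : W -> W') (f : V -> W) x v :
  linear L -> continuous L -> derivable f x v ->
  is_derive x v (L \o f) (L ('D_v f x)).
Proof.
move=> linL cL dfx.
have E : (fun h : R => h^-1 *: (((L \o f) \o shift x) (h *: v) - (L \o f) x)) =
    L \o (fun h : R => h^-1 *: ((f \o shift x) (h *: v) - f x)).
  by apply/funext => h /=; rewrite (linZ linL) (linB linL).
have H : L \o (fun h : R => h^-1 *: ((f \o shift x) (h *: v) - f x)) @ 0^'
    --> L ('D_v f x).
  apply: continuous_cvg; [exact: cL | exact: dfx].
split; rewrite /derivable ?/derive E; first by apply/cvg_ex; exists (L ('D_v f x)).
exact: cvg_lim H.
Qed.

Lemma Ck_linear (V W W' : normedModType R) k (U : set V) (L : W -> W')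
    (f : V -> W) :
  open U -> linear L -> continuous L -> Ck k U f -> Ck k U (L \o f).
Proof.
move=> oU linL cL; elim: k f => [|k IH] f [cf df]; split => //;
  try by move=> x Ux; apply: continuous_comp; [exact: cf | exact: cL].
move=> v; have [dfv Cf] := df v; split.
  by move=> x Ux; have [] := is_derive_linear linL cL (dfv x Ux).
apply: Ck_ext (IH _ Cf) => // x; rewrite inE => Ux.
by have [_ ->] := is_derive_linear linL cL (dfv x Ux).
Qed.

Lemma Ck_scale (V W : normedModType R) k (U : set V) (a : R) (f : V -> W) :
  open U -> Ck k U f -> Ck k U (fun x => a *: f x).
Proof.
move=> oU; apply: (@Ck_linear _ _ _ k U ( *:%R a)) => //.
  by move=> b u v; rewrite scalerDr !scalerA mulrC.
exact: scaler_continuous.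
Qed.

Lemma Ck_scalel (V W : normedModType R) k (U : set V) (f : V -> R) (w : W) :
  open U -> Ck k U f -> Ck k U (fun x => f x *: w).
Proof.
move=> oU; apply: (@Ck_linear _ _ _ k U (fun a : R => a *: w)) => //.
  by move=> b u v; rewrite scalerDl scalerA.
exact: scalel_continuous.
Qed.

Lemma Ck_sum (V W : normedModType R) k (U : set V) (I : Type) (r : seq I)
    (f : I -> V -> W) :
  open U -> (forall i, Ck k U (f i)) -> Ck k U (fun x => \sum_(i <- r) f i x).
Proof.
move=> oU Cf; elim: r => [|i r IH].
  by under eq_fun do rewrite big_nil; exact: (@Ck_cst V W k U 0).
by under eq_fun do rewrite big_cons; apply: Ck_add.
Qed.

Lemma Ck_mul (V : normedModType R) k (U : set V) (f g : V -> R) :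
  open U -> Ck k U f -> Ck k U g -> Ck k U (fun x => f x * g x).
Proof.
move=> oU; elim: k f g => [|k IH] f g Cf Cg; have [cf df] := Cf; have [cg dg] := Cg;
  split => //; try by move=> x Ux; apply: continuousM; [exact: cf | exact: cg].
move=> v; have [dfv Cfv] := df v; have [dgv Cgv] := dg v; split.
  by move=> x Ux; apply: derivableM; [exact: dfv | exact: dgv].
apply: (@Ck_ext _ _ k U (fun x => f x * 'D_v g x + g x * 'D_v f x)) => //.
  move=> x; rewrite inE => Ux.
  by rewrite [RHS](deriveM (dfv x Ux) (dgv x Ux)).
apply: Ck_add => //; apply: IH => //; exact: Ck_pred.
Qed.

Lemma Ck_prod (V : normedModType R) k (U : set V) (I : Type) (r : seq I)
    (f : I -> V -> R) :
  open U -> (forall i, Ck k U (f i)) -> Ck k U (fun x => \prod_(i <- r) f i x).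
Proof.
move=> oU Cf; elim: r => [|i r IH].
  by under eq_fun do rewrite big_nil; exact: (@Ck_cst V R k U 1).
by under eq_fun do rewrite big_cons; apply: Ck_mul.
Qed.

Lemma Ck_inv (V : normedModType R) k (U : set V) (f : V -> R) :
  open U -> (forall x, U x -> f x != 0) -> Ck k U f ->
  Ck k U (fun x => (f x)^-1).
Proof.
move=> oU f0; elim: k f f0 => [|k IH] f f0 Cf; have [cf df] := Cf; split => //;
  try by move=> x Ux; apply: continuousV; [exact: f0 | exact: cf].
move=> v; have [dfv Cfv] := df v; split.
  by move=> x Ux; apply: derivableV; [exact: f0 | exact: dfv].
apply: (@Ck_ext _ _ k U (fun x => - 1 *: ((f x)^-1 * (f x)^-1 * 'D_v f x))) => //.
  move=> x; rewrite inE => Ux.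
  rewrite [RHS](deriveV (f0 x Ux) (dfv x Ux)) scaleN1r scaleNr.
  by rewrite -exprVn expr2.
apply: Ck_scale => //; apply: Ck_mul => //; apply: Ck_mul => //; apply: IH => //;
  exact: Ck_pred.
Qed.

Lemma Ck_det (V : normedModType R) k (U : set V) p (A : V -> 'M[R]_p) :
  open U -> (forall i j, Ck k U (fun x => A x i j)) -> Ck k U (fun x => \det (A x)).
Proof.
move=> oU CA; rewrite /determinant; apply: Ck_sum => // s.
apply: Ck_mul => //; last exact: Ck_prod.
exact: Ck_cst.
Qed.

(** By Cramer's rule, the entries of the inverse are cofactors divided by the
    determinant. *)
Lemma Ck_invmx (V : normedModType R) k (U : set V) p (A : V -> 'M[R]_p) :
  open U -> (forall x, U x -> A x \in unitmx) ->
  (forall i j, Ck k U (fun x => A x i j)) ->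
  forall i j, Ck k U (fun x => invmx (A x) i j).
Proof.
move=> oU uA CA i j.
apply: (@Ck_ext _ _ k U (fun x => (\det (A x))^-1 * cofactor (A x) j i)) => //.
  move=> x; rewrite inE => Ux.
  by rewrite /invmx uA // !mxE.
apply: Ck_mul => //.
  apply: Ck_inv => //; last exact: Ck_det.
  by move=> x /uA; rewrite unitmxE unitfE.
rewrite /cofactor.
apply: Ck_mul => //; first exact: Ck_cst.
apply: Ck_det => // i' j'.
by under eq_fun do rewrite !mxE; exact: CA.
Qed.

End SmoothClosure.

(** * Second derivatives and brackets of vector fields *)

Section SecondOrder.
Context (R : realType).

Lemma derive_lincomb (V W : normedModType R) (U : set V) (h1 h2 h3 : V -> W)
    (t : R) (y v : V) : open U -> U y -> derivable h1 y v -> derivable h2 y v ->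
  (forall z, U z -> h3 z = t *: h1 z + h2 z) ->
  'D_v h3 y = t *: 'D_v h1 y + 'D_v h2 y.
Proof.
move=> oU Uy e1 e2 h.
have S := is_deriveD (is_deriveZ t (derivableP e1)) (derivableP e2).
transitivity ('D_v (t *: h1 + h2) y); last exact: (@derive_val _ _ _ _ _ _ _ S).
by apply: near_eq_derive; apply: (near_open oU Uy) => z /set_mem; exact: h.
Qed.

Lemma is_derive_shift (V W : normedModType R) (f : V -> W) (c x v : V) :
  derivable f (x + c) v -> is_derive x v (fun z => f (z + c)) ('D_v f (x + c)).
Proof.
have E : (fun h : R => h^-1 *: (((fun z => f (z + c)) \o shift x) (h *: v) - f (x + c)))
  = (fun h => h^-1 *: ((f \o shift (x + c)) (h *: v) - f (x + c))).
  by apply/funext => h /=; rewrite addrA.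
by move=> dv; split; rewrite /derivable /derive E.
Qed.

(** The left side is symmetric in [v] and [w], which makes mixed derivatives
    commute. The mean value theorem is used along [v], then along [w]. *)
Lemma second_difference (V : normedModType R) (f : V -> R) (x v w : V) (s : R) :
  (forall a b : R, `|a| <= `|s| -> `|b| <= `|s| ->
     derivable f (x + a *: v + b *: w) v /\
     derivable (fun z => 'D_v f z) (x + a *: v + b *: w) w) ->
  exists a b, [/\ `|a| <= `|s|, `|b| <= `|s| &
    f (x + s *: v + s *: w) - f (x + s *: v) - f (x + s *: w) + f x =
    s * (s * 'D_w (fun z => 'D_v f z) (x + a *: v + b *: w))].
Proof.
move=> df.
have ss : `|s| <= `|s| by []. have s0 : `|0 : R| <= `|s| by rewrite normr0.
have dF (t : R) : `|t| <= `|s| -> is_derive (x + t *: v) v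
    (fun z => f (z + s *: w) - f z)
    ('D_v f (x + t *: v + s *: w) - 'D_v f (x + t *: v)).
  move=> ts; have [d1 _] := df t s ts ss; have [d2 _] := df t 0 ts s0.
  rewrite scale0r addr0 in d2.
  have d3 : is_derive (x + t *: v) v f ('D_v f (x + t *: v)) by [].
  exact: (is_deriveB (is_derive_shift d1) d3).
have [|a as_ Ea] := @line_MVT _ _ (fun z => f (z + s *: w) - f z) x v s.
  by move=> t /dF[].
have [|b bs Eb] := @line_MVT _ _ (fun z => 'D_v f z) (x + a *: v) w s.
  by move=> t ts; have [] := df a t as_ ts.
exists a, b; split => //.
have [_ da] := dF a as_.
rewrite da Eb in Ea; rewrite -Ea; ring.
Qed.

(** Both mixed derivatives at [x] are approximated by the same second
    difference. *)
Lemma derive_comm_scalar (V : normedModType R) (U : set V) (f : V -> R) x v w :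
  open U -> U x -> Ck 2 U f ->
  'D_v (fun z => 'D_w f z) x = 'D_w (fun z => 'D_v f z) x.
Proof.
move=> oU Ux [_ Cf].
have [dv [_ Cv]] := Cf v; have [dw [_ Cw]] := Cf w.
have [dvw [cvw _]] := Cv w; have [dwv [cwv _]] := Cw v.
apply/eqP; rewrite -subr_eq0 -normr_le0; apply/ler_addgt0Pr => e e0; rewrite add0r.
pose D := U `&` [set z | `|'D_w (fun z => 'D_v f z) x - 'D_w (fun z => 'D_v f z) z| <= e / 2]
  `&` [set z | `|'D_v (fun z => 'D_w f z) x - 'D_v (fun z => 'D_w f z) z| <= e / 2].
have e20 : 0 < e / 2 by rewrite divr_gt0.
have : nbhs x D.
  apply: filterI; last by have /cvgrPdist_le/(_ _ e20) := cwv x Ux.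
  apply: filterI; first exact: open_nbhs_nbhs.
  by have /cvgrPdist_le/(_ _ e20) := cvw x Ux.
move=> /nbhs_ballP[r /= r0 rD].
(* the parallelogram spanned by s *: v and s *: w stays in the ball *)
pose s := r / (`|v| + `|w| + 1).
have c0 : 0 < `|v| + `|w| + 1 by rewrite ltr_wpDl // addr_ge0.
have s0 : 0 < s by rewrite divr_gt0.
have inD a b : `|a| <= `|s| -> `|b| <= `|s| -> D (x + a *: v + b *: w).
  move=> ha hb; apply: rD; rewrite -ball_normE /= -addrA opprD addrA subrr add0r normrN.
  apply: (le_lt_trans (ler_normD _ _)); rewrite !normrZ.
  apply: (@le_lt_trans _ _ (`|s| * (`|v| + `|w|))).
    by rewrite mulrDr lerD // ler_wpM2r.
  rewrite gtr0_norm // /s mulrAC ltr_pdivrMr // ltr_pM2l // ltrDl //.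
have [|a [b [ha hb E1]]] := @second_difference _ f x v w s.
  by move=> a b ha hb; have [[Uz _] _] := inD a b ha hb; split; [exact: dv | exact: dvw].
have [|b' [a' [hb' ha' E2]]] := @second_difference _ f x w v s.
  move=> b' a' hb' ha'; rewrite addrAC.
  by have [[Uz _] _] := inD a' b' ha' hb'; split; [exact: dw | exact: dwv].
have E : 'D_w (fun z => 'D_v f z) (x + a *: v + b *: w) =
         'D_v (fun z => 'D_w f z) (x + a' *: v + b' *: w).
  apply: (mulfI (lt0r_neq0 s0)); apply: (mulfI (lt0r_neq0 s0)).
  have xs : x + s *: w + s *: v = x + s *: v + s *: w by rewrite addrAC.
  have xb : x + b' *: w + a' *: v = x + a' *: v + b' *: w by rewrite addrAC.
  rewrite xs xb in E2.
  by apply: etrans (etrans (esym E1) _) E2; congr (_ + _); rewrite addrAC.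
have [[_ /= h1] _] := inD a b ha hb; have [_ /= h2] := inD a' b' ha' hb'.
rewrite E in h1.
apply: (le_trans (ler_distD ('D_v (fun z => 'D_w f z) (x + a' *: v + b' *: w)) _ _)).
rewrite [leRHS]splitr.
by apply: lerD; [exact: h2 | rewrite distrC; exact: h1].
Qed.

Variables (d : nat) (W : normedModType R) (hW : has_coordinates W).
Implicit Types (U : set 'rV[R]_d) (f : 'rV[R]_d -> W).

Lemma C1_differentiable U f x : open U -> U x -> Ck 1 U f -> differentiable f x.
Proof.
move=> oU Ux Cf; have [N [b [l [lin cl e]]]] := hW.
have -> : f = \sum_i (fun z => l i (f z) *: b i).
  by apply/funext => z; rewrite fct_sumE -e.
apply: differentiable_sum => i; apply: differentiableZl.
have [_ dg] := Ck_linear oU (lin i) (cl i) Cf.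
by apply: (C1_differentiable_scalar oU Ux) => v; have [dv [cv _]] := dg v; auto.
Qed.

Lemma derive_linear U f x : open U -> U x -> Ck 1 U f ->
  linear (fun v => 'D_v f x).
Proof.
move=> oU Ux Cf a v w; have df := C1_differentiable oU Ux Cf.
by rewrite !deriveE // linearP.
Qed.

Lemma derive_comm U f x v w : open U -> U x -> Ck 2 U f ->
  'D_v (fun z => 'D_w f z) x = 'D_w (fun z => 'D_v f z) x.
Proof.
move=> oU Ux Cf; have [N [b [l [lin cl e]]]] := hW.
have [_ C1] := Cf.
have dl i u (g : 'rV[R]_d -> W) : Ck 1 U g -> forall z, U z ->
    l i ('D_u g z) = 'D_u (l i \o g) z.
  move=> [_ Cg] z Uz; have [dg _] := Cg u.
  by have [_ ->] := is_derive_linear (lin i) (cl i) (dg z Uz).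
have l_inj u1 u2 : (forall i, l i u1 = l i u2) -> u1 = u2.
  by move=> l12; rewrite (e u1) (e u2); apply: eq_bigr => i _; rewrite l12.
apply: l_inj => i.
have Cv := (C1 v).2; have Cw := (C1 w).2.
apply: (etrans (dl i v _ Cw x Ux)); apply: (etrans _ (esym (dl i w _ Cv x Ux))).
have E u1 u2 : 'D_u1 (l i \o (fun z => 'D_u2 f z)) x =
    'D_u1 (fun z => 'D_u2 (l i \o f) z) x.
  apply: near_eq_derive; apply: (near_open oU Ux) => z; rewrite inE => Uz.
  by rewrite /= dl //; exact: Ck_pred.
apply: (etrans (E v w)); apply: (etrans _ (esym (E w v))).
apply: (derive_comm_scalar v w oU Ux).
exact: (Ck_linear oU (lin i) (cl i) Cf).
Qed.

End SecondOrder.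

Section VectorFields.
Context (R : realType).

Lemma derive_chain (d d' : nat) (W : normedModType R) (U' : set 'rV[R]_d')
    (phi : 'rV[R]_d' -> 'rV[R]_d) (U : set 'rV[R]_d) (f : 'rV[R]_d -> W) y v :
  has_coordinates W ->
  open U' -> U' y -> Ck 1 U' phi -> open U -> U (phi y) -> Ck 1 U f ->
  'D_v (f \o phi) y = 'D_('D_v phi y) f (phi y).
Proof.
move=> hW oU' Uy Cphi oU Uphi Cf.
have df := C1_differentiable hW oU Uphi Cf.
have dphi := C1_differentiable (matrix_coordinates R 1 d) oU' Uy Cphi.
rewrite !deriveE //; last exact: differentiable_comp.
by rewrite diff_comp.
Qed.

Lemma is_derive_scale (V W : normedModType R) (g : V -> R) (F : V -> W) x v :
  derivable g x v -> derivable F x v ->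
  is_derive x v (fun y => g y *: F y) ('D_v g x *: F x + g x *: 'D_v F x).
Proof.
move=> dg dF.
have Fx : (fun h : R => F (h *: v + x)) @ 0^' --> F x.
  have dF0 : derivable F (x + 0 *: v) v by rewrite scale0r addr0.
  have [/derivable1_diffP/differentiable_continuous cF _] := is_derive_line dF0.
  have -> : (fun h : R => F (h *: v + x)) = (fun s => F (x + s *: v)).
    by apply/funext => h; rewrite addrC.
  by move: cF; rewrite /prop_for /continuous_at scale0r addr0; apply: cvg_within_filter.
have E : (fun h : R => h^-1 *: (((fun y => g y *: F y) \o shift x) (h *: v) - g x *: F x)) =
  (fun h : R => (h^-1 *: ((g \o shift x) (h *: v) - g x)) *: F (h *: v + x)
     + g x *: (h^-1 *: ((F \o shift x) (h *: v) - F x))).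
  apply/funext => h /=; rewrite -[h^-1 *: (g _ - g x)]/(h^-1 * (g _ - g x)) -scalerA.
  have -> u : g x *: (h^-1 *: u) = h^-1 *: (g x *: u) :> W by rewrite !scalerA mulrC.
  rewrite -scalerDr; congr (_ *: _).
  by rewrite scalerBl scalerBr addrA subrK.
have H : (fun h : R => h^-1 *: (((fun y => g y *: F y) \o shift x) (h *: v) - g x *: F x))
    @ 0^' --> 'D_v g x *: F x + g x *: 'D_v F x.
  rewrite E; apply: cvgD; first by apply: cvgZ => //; exact: dg.
  by apply: cvgZl_tmp; exact: dF.
split; last exact: cvg_lim H.
by apply/cvg_ex; exists ('D_v g x *: F x + g x *: 'D_v F x).
Qed.

Variable d : nat.
Local Notation E := 'rV[R]_d.
Implicit Types (U : set E) (a b c : E -> E) (W : normedModType R).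

Definition Dalong W (a : E -> E) (f : E -> W) : E -> W := fun y => 'D_(a y) f y.

(** The Lie bracket of vector fields, in coordinates. *)
Definition field_bracket (a b : E -> E) : E -> E :=
  fun y => Dalong a b y - Dalong b a y.

Lemma Ck_coord U k (a : E -> E) j : open U -> Ck k U a -> Ck k U (fun y => a y 0 j).
Proof.
move=> oU; apply: (@Ck_linear _ _ _ _ k U (fun w : E => w 0 j)) => //.
  by move=> t u v; rewrite !mxE.
exact: coord_continuous.
Qed.

Lemma Csmooth_derive U W (f : E -> W) v : Csmooth U f -> Csmooth U (fun y => 'D_v f y).
Proof. by move=> Cf k; have [_ /(_ v)[]] := Cf k.+1. Qed.

Lemma Dalong_coord U W (a : E -> E) (f : E -> W) y :
  has_coordinates W -> open U -> U y -> Ck 1 U f ->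
  Dalong a f y = \sum_j a y 0 j *: 'D_(delta_mx 0 j) f y.
Proof.
move=> hW oU Uy Cf; have linD := derive_linear hW oU Uy Cf.
rewrite /Dalong {1}[a y]row_sum_delta (lin_sum linD).
by apply: eq_bigr => j _; exact: (linZ linD).
Qed.

Lemma Csmooth_scale U W (g : E -> R) (F : E -> W) :
  has_coordinates W -> open U -> Csmooth U g -> Csmooth U F ->
  Csmooth U (fun y => g y *: F y).
Proof.
move=> [N [b [l [lin cl e]]]] oU Cg CF k.
apply: (@Ck_ext _ _ _ k U (fun y => \sum_i (g y * l i (F y)) *: b i)) => //.
  by move=> y _; rewrite [in RHS](e (F y)) scaler_sumr; apply: eq_bigr => i _; rewrite scalerA.
apply: Ck_sum => // i; apply: Ck_scalel => //; apply: Ck_mul => //.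
exact: (Ck_linear oU (lin i) (cl i) (CF k)).
Qed.

Lemma Csmooth_Dalong U W (a : E -> E) (f : E -> W) :
  has_coordinates W -> open U -> Csmooth U a -> Csmooth U f ->
  Csmooth U (Dalong a f).
Proof.
move=> hW oU Ca Cf k.
apply: (@Ck_ext _ _ _ k U (fun y => \sum_j a y 0 j *: 'D_(delta_mx 0 j) f y)) => //.
  by move=> y; rewrite inE => Uy; rewrite -(Dalong_coord _ hW oU Uy (Cf 1)).
apply: Ck_sum => // j; apply: (Csmooth_scale hW oU _ _ k).
  by move=> l; apply: Ck_coord.
exact: Csmooth_derive.
Qed.

Lemma Csmooth_sub U W (f g : E -> W) : open U ->
  Csmooth U f -> Csmooth U g -> Csmooth U (fun y => f y - g y).
Proof.
move=> oU Cf Cg k; apply: (@Ck_ext _ _ _ k U (fun y => f y + (-1) *: g y)) => //.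
  by move=> y _; rewrite scaleN1r.
by apply: Ck_add => //; apply: Ck_scale.
Qed.

Lemma Csmooth_bracket U a b : open U -> Csmooth U a -> Csmooth U b ->
  Csmooth U (field_bracket a b).
Proof.
by move=> oU Ca Cb; apply: Csmooth_sub => //; apply: (Csmooth_Dalong (matrix_coordinates _ _ _)).
Qed.

Lemma Csmooth_derivable U W (f : E -> W) y v : U y -> Csmooth U f -> derivable f y v.
Proof. by move=> Uy /(_ 1)[_ /(_ v)[df _]]; exact: df. Qed.

Lemma Dalong_sub U W a (f g : E -> W) y : U y -> Csmooth U f -> Csmooth U g ->
  Dalong a (fun z => f z - g z) y = Dalong a f y - Dalong a g y.
Proof.
move=> Uy Cf Cg; exact: (deriveB (Csmooth_derivable (v := a y) Uy Cf) (Csmooth_derivable (v := a y) Uy Cg)).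
Qed.

Lemma Dalong_ext U W a (f g : E -> W) y : open U -> U y -> {in U, f =1 g} ->
  Dalong a f y = Dalong a g y.
Proof. by move=> oU Uy fg; apply: near_eq_derive; exact: near_open fg. Qed.

Lemma Dalong_scale U W a (g : E -> R) (F : E -> W) y :
  U y -> Csmooth U g -> Csmooth U F ->
  Dalong a (fun z => g z *: F z) y = Dalong a g y *: F y + g y *: Dalong a F y.
Proof.
move=> Uy Cg CF.
by have [_] := is_derive_scale (Csmooth_derivable (v := a y) Uy Cg) (Csmooth_derivable (v := a y) Uy CF).
Qed.

Lemma Dalong_bigsum U W n a (f : 'I_n -> E -> W) y :
  U y -> (forall i, Csmooth U (f i)) ->
  Dalong a (fun z => \sum_i f i z) y = \sum_i Dalong a (f i) y.
Proof.
move=> Uy Cf; rewrite -[RHS]derive_sum; last by move=> i; exact: (Csmooth_derivable Uy (Cf _)).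
by congr (Dalong a _ y); apply/funext => z; rewrite fct_sumE.
Qed.

(** The second-order terms cancel by symmetry of the mixed derivatives. *)
Lemma Dalong_comm U W a b (f : E -> W) y :
  has_coordinates W -> open U -> U y ->
  Csmooth U a -> Csmooth U b -> Csmooth U f ->
  Dalong a (Dalong b f) y - Dalong b (Dalong a f) y = 'D_(field_bracket a b y) f y.
Proof.
move=> hW oU Uy Ca Cb Cf.
have Cc (e : E -> E) j : Csmooth U e -> Csmooth U (fun z : E => e z 0 j) by move=> Ce k; apply: Ck_coord.
have Cj j : Csmooth U (fun z => 'D_(delta_mx 0 j) f z) by exact: Csmooth_derive.
have E1 (e e' : E -> E) : Csmooth U e -> Csmooth U e' -> Dalong e (Dalong e' f) y =
    \sum_j Dalong e (fun z => e' z 0 j) y *: 'D_(delta_mx 0 j) f y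
  + \sum_j \sum_i (e' y 0 j * e y 0 i) *:
      'D_(delta_mx 0 i) (fun z => 'D_(delta_mx 0 j) f z) y.
  move=> Ce Ce'.
  rewrite (@Dalong_ext U _ _ _ (fun z => \sum_j e' z 0 j *: 'D_(delta_mx 0 j) f z)) //; last first.
    by move=> z; rewrite inE => Uz; apply: (Dalong_coord _ hW oU Uz (Cf 1)).
  rewrite (@Dalong_bigsum U) //; last first.
    by move=> j; apply: (Csmooth_scale hW oU) => //; exact: Cc.
  rewrite -big_split; apply: eq_bigr => j _ /=.
  rewrite (@Dalong_scale U) //; last exact: Cc.
  congr (_ + _); rewrite (Dalong_coord _ hW oU Uy (Cj j 1)) scaler_sumr.
  by apply: eq_bigr => i _; rewrite scalerA.
rewrite !E1 // opprD addrACA [X in _ + X](_ : _ = 0) ?addr0; last first.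
  apply/eqP; rewrite subr_eq0; apply/eqP; rewrite exchange_big.
  apply: eq_bigr => i _; apply: eq_bigr => j _.
  have H := derive_comm hW (delta_mx 0 i) (delta_mx 0 j) oU Uy (Cf 2).
  exact: (f_equal2 _ (mulrC _ _) H).
have L := Dalong_coord (field_bracket a b) hW oU Uy (Cf 1).
rewrite -[RHS]/(Dalong (field_bracket a b) f y) L -sumrB.
apply: eq_bigr => j _; rewrite -scalerBl; congr (_ *: _).
have dE (e e' : E -> E) : Csmooth U e' -> Dalong e (fun z => e' z 0 j) y = Dalong e e' y 0 j.
  move=> Ce'; have dx := Csmooth_derivable (v := e y) Uy Ce'.
  have [|_] := is_derive_linear (L := fun w : E => w 0 j) _ (@coord_continuous _ 1 d 0 j) dx => //.
  by move=> t u v; rewrite !mxE.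
by rewrite !dE // !mxE.
Qed.

(** [Dalong_comm] rewrites every double bracket in terms of iterated derivatives,
    which cancel. *)
Lemma field_bracket_Jacobi U a b c y : open U -> U y ->
  Csmooth U a -> Csmooth U b -> Csmooth U c ->
  field_bracket a (field_bracket b c) y =
  field_bracket (field_bracket a b) c y + field_bracket b (field_bracket a c) y.
Proof.
move=> oU Uy Ca Cb Cc; have hE := matrix_coordinates R 1 d.
have CD (e f : E -> E) : Csmooth U e -> Csmooth U f -> Csmooth U (Dalong e f) by exact: Csmooth_Dalong.
have B (e f g : E -> E) : Csmooth U e -> Csmooth U f -> Csmooth U g ->
    field_bracket e (field_bracket f g) y =
    Dalong e (Dalong f g) y - Dalong e (Dalong g f) y
    - (Dalong f (Dalong g e) y - Dalong g (Dalong f e) y).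
  move=> Ce Cf Cg; have H := esym (Dalong_comm hE oU Uy Cf Cg Ce).
  exact: (f_equal2 (fun p q => p - q) (Dalong_sub e Uy (CD _ _ Cf Cg) (CD _ _ Cg Cf)) H).
have anti (e f : E -> E) : field_bracket e f y = - field_bracket f e y by rewrite /field_bracket opprB.
rewrite [field_bracket (field_bracket a b) c y]anti !B //.
move: (Dalong a (Dalong b c) y) (Dalong a (Dalong c b) y) (Dalong b (Dalong c a) y)
  (Dalong c (Dalong b a) y) (Dalong c (Dalong a b) y) (Dalong b (Dalong a c) y) => p q r s t u.
apply/rowP => j; rewrite !mxE; ring.
Qed.

End VectorFields.

(** * Coframes with values in a Lie algebra *)

(** On an open subset [U] of a coordinate space, a Cartan connection is a coframe
    [Om] with values in a Lie algebra [g]; [X B] is the field on which [Om] takes the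
    constant value [B]. *)
Section FlatCartan.
Context (R : realType) (d : nat) (g : normedModType R) (hg : has_coordinates g).
Local Notation E := 'rV[R]_d.
Variables (U : set E) (oU : open U) (Om : E -> E -> g) (X : g -> E -> E).
Hypothesis Om_linear : forall y, U y -> linear (Om y).
Hypothesis OmK : forall y B, U y -> Om y (X B y) = B.
Hypothesis XK : forall y w, U y -> X (Om y w) y = w.
Hypothesis Om_smooth : forall w, Csmooth U (fun y => Om y w).

Let hE : has_coordinates E := matrix_coordinates R 1 d.

Lemma X_linear y : U y -> linear (X^~ y).
Proof.
move=> Uy a B C; rewrite -[B in LHS](OmK B Uy) -[C in LHS](OmK C Uy).
by rewrite -Om_linear // XK.
Qed.

Lemma frame_sum y (I : Type) (r : seq I) (c : I -> R) (B : I -> g) : U y ->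
  X (\sum_(i <- r) c i *: B i) y = \sum_(i <- r) c i *: X (B i) y.
Proof.
move=> Uy; rewrite (lin_sum (X_linear Uy)); apply: eq_bigr => i _.
exact: (linZ (X_linear Uy)).
Qed.

Lemma coframe_sum y (I : Type) (r : seq I) (c : I -> R) (v : I -> E) : U y ->
  Om y (\sum_(i <- r) c i *: v i) = \sum_(i <- r) c i *: Om y (v i).
Proof.
move=> Uy; rewrite (lin_sum (Om_linear Uy)); apply: eq_bigr => i _.
exact: (linZ (Om_linear Uy)).
Qed.

Lemma frame0 y : U y -> X 0 y = 0.
Proof. by move=> Uy; exact: (lin0 (X_linear Uy)). Qed.

Lemma frame_inj y B C : U y -> X B y = X C y -> B = C.
Proof. by move=> Uy e; rewrite -(OmK B Uy) e OmK. Qed.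

(** With [y0] fixed, [X B y] is the preimage of [X B y0] under the endomorphism
    [w |-> X (Om y w) y0], an invertible matrix [M y] that is smooth in [y]. *)
Lemma frame_smooth B : Csmooth U (X B).
Proof.
have [[y0 Uy0]|U0] := pselect (U !=set0); last first.
  move=> k; apply: (@Ck_subset _ _ _ k set0 U) => //.
    by move=> y Uy; case: U0; exists y.
  elim: k (X B) => [|k IH] f; split => // v; split => //.
pose T0 (C : g) : E := X C y0.
have T0c : continuous T0 := linear_continuous_coordinates hg (X_linear Uy0).
pose M (y : E) : 'M[R]_d := \matrix_(i, j) T0 (Om y (delta_mx 0 i)) 0 j.
have ME y w : U y -> w *m M y = T0 (Om y w).
  move=> Uy; rewrite {2}[w]row_sum_delta coframe_sum // /T0 frame_sum //.
  apply/rowP => j; rewrite !mxE summxE; apply: eq_bigr => i _.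
  by rewrite !mxE.
pose N (y : E) : 'M[R]_d := \matrix_(i, j) X (Om y0 (delta_mx 0 i)) y 0 j.
have NE y w : U y -> w *m N y = X (Om y0 w) y.
  move=> Uy; rewrite {2}[w]row_sum_delta coframe_sum // frame_sum //.
  apply/rowP => j; rewrite !mxE summxE; apply: eq_bigr => i _.
  by rewrite !mxE.
have MN y : U y -> M y *m N y = 1%:M.
  move=> Uy; apply/row_matrixP => i; rewrite row_mul row1 rowE.
  by rewrite ME // NE // /T0 OmK // XK.
have uM y : U y -> M y \in unitmx by move=> /MN /mulmx1_unit[].
have CM i j : Csmooth U (fun y => M y i j).
  move=> k; apply: (@Ck_ext _ _ _ k U (fun y => T0 (Om y (delta_mx 0 i)) 0 j)) => //.
    by move=> y _; rewrite mxE.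
  apply: Ck_coord => //.
  exact: (Ck_linear oU (X_linear Uy0) T0c (Om_smooth (delta_mx 0 i) k)).
move=> k.
apply: (@Ck_ext _ _ _ k U (fun y => \sum_j (\sum_i T0 B 0 i * invmx (M y) i j) *: delta_mx 0 j)) => //.
  move=> y; rewrite inE => Uy; rewrite [RHS]row_sum_delta; apply: eq_bigr => j _.
  congr (_ *: _).
  have -> : X B y = T0 B *m invmx (M y).
    by rewrite -{2}(OmK B Uy) -ME // mulmxK // uM.
  by rewrite mxE.
apply: Ck_sum => // j; apply: Ck_scalel => //; apply: Ck_sum => // i.
apply: Ck_mul => //; first exact: Ck_cst.
by apply: Ck_invmx => // i' j'; exact: CM.
Qed.

Lemma Csmooth_coframe v : Csmooth U v -> Csmooth U (fun z => Om z (v z)).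
Proof.
move=> Cv k.
apply: (@Ck_ext _ _ _ k U (fun z => \sum_j v z 0 j *: Om z (delta_mx 0 j))) => //.
  by move=> z; rewrite inE => Uz; rewrite -coframe_sum // -row_sum_delta.
apply: Ck_sum => // j; apply: (Csmooth_scale hg oU) => // l; exact: Ck_coord.
Qed.

(** Leibniz rule for a field with variable coefficients [h] in the frame. *)
Lemma Dalong_frame a h y : U y -> Csmooth U h ->
  Dalong a (fun z => X (h z) z) y = X (Dalong a h y) y + Dalong a (X (h y)) y.
Proof.
move=> Uy Ch; have [N [b [l [lin cl e]]]] := hg.
have key h' : Csmooth U h' -> Dalong a (fun z => X (h' z) z) y =
    \sum_i l i (Dalong a h' y) *: X (b i) y + \sum_i l i (h' y) *: Dalong a (X (b i)) y.
  move=> Ch'.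
  have Cl i : Csmooth U (l i \o h') by move=> k; exact: (Ck_linear oU (lin i) (cl i) (Ch' k)).
  rewrite (@Dalong_ext _ _ U _ _ _ (fun z => \sum_i l i (h' z) *: X (b i) z)) //; last first.
    by move=> z; rewrite inE => Uz; rewrite -frame_sum // -e.
  rewrite (@Dalong_bigsum _ _ U) //; last first.
    by move=> i; apply: (Csmooth_scale hE oU); [exact: Cl | exact: frame_smooth].
  rewrite -big_split; apply: eq_bigr => i _ /=.
  rewrite (@Dalong_scale _ _ U _ _ (l i \o h') (X (b i)) y Uy (Cl i) (frame_smooth _)).
  congr (_ *: _ + _).
  by have [_ D] := is_derive_linear (lin i) (cl i) (Csmooth_derivable (v := a y) Uy Ch').
rewrite key // -frame_sum // -e; congr (_ + _).
have Cc : Csmooth U (cst (h y)) by move=> k; exact: Ck_cst.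
have := key _ Cc; rewrite /Dalong derive_cst [X in X + _]big1 ?add0r; last first.
  move=> i _; have := lin i 1 0 0; rewrite scale1r addr0 -{1}[l i 0]addr0 mul1r.
  by move/addrI <-; rewrite scale0r.
by move=> ->.
Qed.

Lemma field_bracket_ext (a a' b b' : E -> E) y : U y -> {in U, a =1 a'} -> {in U, b =1 b'} ->
  field_bracket a b y = field_bracket a' b' y.
Proof.
move=> Uy aa bb; rewrite /field_bracket (Dalong_ext a oU Uy bb) (Dalong_ext b oU Uy aa).
by rewrite /Dalong aa ?bb ?inE.
Qed.

Lemma field_bracket_frame a h y : U y -> Csmooth U h ->
  field_bracket a (fun z => X (h z) z) y =
  X (Dalong a h y) y + field_bracket a (X (h y)) y.
Proof. by move=> Uy Ch; rewrite /field_bracket Dalong_frame // addrA. Qed.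

Lemma field_bracket0r (a : E -> E) y : field_bracket a (cst 0) y = 0.
Proof. by rewrite /field_bracket /Dalong derive_cst /cst derive0 subrr. Qed.

Lemma field_bracket0l (a : E -> E) y : field_bracket (cst 0) a y = 0.
Proof. by rewrite /field_bracket /Dalong derive_cst /cst derive0 subrr. Qed.

(** A field that commutes with the frame solves a linear first-order system. *)
Lemma symmetry_derive xi y v : Csmooth U xi -> U y ->
  (forall C, field_bracket xi (X C) y = 0) ->
  'D_v xi y = Dalong xi (X (Om y v)) y.
Proof.
move=> Cxi Uy comm; have /eqP := comm (Om y v); rewrite /field_bracket subr_eq0 => /eqP ->.
by rewrite /Dalong XK.
Qed.

(** By [symmetry_derive], the derivative of [xi] along [v] is bounded by
    [K * `|v| * `|xi|] near [y0]. On a short segment issued from [y0], the maximum of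
    the norm of [xi] is therefore at most half of itself. *)
Lemma symmetry_unique xi y0 : Csmooth U xi -> U y0 ->
  (forall C y, U y -> field_bracket xi (X C) y = 0) -> xi y0 = 0 ->
  \forall y \near y0, xi y = 0.
Proof.
move=> Cxi Uy0 comm xi0; have [N [b [l [lin cl e]]]] := hg.
pose ej (j : 'I_d) : E := delta_mx 0 j.
pose G j k y : E := \sum_i l i (Om y (ej j)) *: 'D_(ej k) (X (b i)) y.
pose H y : R := \sum_j \sum_k `|G j k y|.
have cH : {for y0, continuous H}.
  apply: continuous_at_sum => j; apply: continuous_at_sum => k.
  apply: continuous_comp; last exact: norm_continuous.
  apply: continuous_at_sum => i; apply: continuousZ.
    by have [cf _] := Ck_linear oU (lin i) (cl i) (Om_smooth (ej j) 0); exact: cf.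
  by have [cf _] := Csmooth_derive (ej k) (frame_smooth (b i)) 0%N; exact: cf.
have Dxi y v : U y -> `|'D_v xi y| <= `|v| * `|xi y| * H y.
  move=> Uy.
  have Dj j : 'D_(ej j) xi y = \sum_k xi y 0 k *: G j k y.
    rewrite symmetry_derive //; last by move=> C; exact: comm.
    rewrite (Dalong_coord xi hE oU Uy (frame_smooth _ 1)); apply: eq_bigr => k _.
    congr (_ *: _).
    have linD := derive_linear hE oU Uy (frame_smooth _ 1).
    have -> : 'D_(ej k) (X (Om y (ej j))) y =
        'D_(ej k) (fun z => \sum_i l i (Om y (ej j)) *: X (b i) z) y.
      apply: (@Dalong_ext _ _ U _ (cst (ej k))) => // z; rewrite inE => Uz.
      by rewrite -frame_sum // -e.
    pose F i z := l i (Om y (ej j)) *: X (b i) z.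
    have CF i : Csmooth U (F i) by move=> m; apply: Ck_scale => //; exact: frame_smooth.
    rewrite [LHS](@Dalong_bigsum _ _ U _ _ (cst (ej k)) F y Uy CF).
    apply: eq_bigr => i _.
    exact: (deriveZ _ (Csmooth_derivable (v := ej k) Uy (frame_smooth (b i)))).
  have -> : 'D_v xi y = \sum_j v 0 j *: 'D_(ej j) xi y.
    exact: (Dalong_coord (cst v) hE oU Uy (Cxi 1)).
  apply: (le_trans (ler_norm_sum _ _ _)); rewrite /H mulr_sumr; apply: ler_sum => j _.
  rewrite normrZ Dj -mulrA ler_pM ?norm_coord //.
  apply: (le_trans (ler_norm_sum _ _ _)); rewrite mulr_sumr; apply: ler_sum => k _.
  by rewrite normrZ ler_wpM2r // norm_coord.
pose K := H y0 + 1.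
have H0 y : 0 <= H y by apply: sumr_ge0 => j _; apply: sumr_ge0 => k _.
have K0 : 0 < K by rewrite ltr_pwDr.
have : nbhs y0 (U `&` [set y | H y <= K]).
  apply: filterI; first exact: open_nbhs_nbhs.
  have /cvgrPdist_le/(_ 1 ltr01) := cH; apply: filterS => y /=.
  by rewrite distrC => /ler_normlW; rewrite lerBlDr addrC.
move=> /nbhs_ballP[r /= r0 rU].
(* the factor 1/2 in the bound below is s * K *)
pose s := Num.min r (2^-1 / K).
have s0 : 0 < s by rewrite lt_min r0 divr_gt0.
apply/nbhs_ballP; exists s => //= y; rewrite -ball_normE /= => ys.
pose v := y - y0.
have vs : `|v| < s by rewrite distrC.
have inU (t : R) : `|t| <= 1 -> U (y0 + t *: v) /\ H (y0 + t *: v) <= K.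
  move=> t1; apply: rU; rewrite -ball_normE /= opprD addrA subrr add0r normrN normrZ.
  apply: (@le_lt_trans _ _ (1 * `|v|)); first by rewrite ler_wpM2r.
  by rewrite mul1r (lt_le_trans vs) // ge_min lexx.
have absP (t : R) : (t \in `[-1, 1]) = (`|t| <= 1) by rewrite in_itv /= ler_norml.
pose g1 (t : R) : R := `|xi (y0 + t *: v)|.
have g10 t : 0 <= g1 t by exact: normr_ge0.
have cg : {within `[-1, 1], continuous g1}.
  apply: continuous_in_subspaceT => t; rewrite inE /= => t1.
  have [Ut _] : U (y0 + t *: v) /\ H (y0 + t *: v) <= K by apply: inU; rewrite -absP.
  apply: continuous_comp; last exact: norm_continuous.
  have dxt := Csmooth_derivable (v := v) Ut Cxi.
  have [/derivable1_diffP/differentiable_continuous cF _] := is_derive_line dxt.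
  exact: cF.
have m11 : -1 <= 1 :> R by lra.
have [c c1 cmax] := EVT_max m11 cg.
have half : g1 c <= 2^-1 * g1 c.
  rewrite {1}/g1; apply: norm_rV_le => [|i]; first by rewrite mulr_ge0.
  pose f z : R := xi z 0 i.
  have Cf : Csmooth U f by move=> m; apply: Ck_coord.
  have [|t tc] := @line_MVT _ _ f y0 v c.
    move=> t tc; apply: (Csmooth_derivable _ Cf).
    by apply: (inU _ _).1; apply: (le_trans tc); rewrite -absP.
  have t1 : `|t| <= 1 by apply: (le_trans tc); rewrite -absP.
  have [Ut Ht] := inU t t1.
  rewrite [f y0]/f xi0 mxE subr0 -/(f _) => ->.
  have -> : 'D_v f (y0 + t *: v) = 'D_v xi (y0 + t *: v) 0 i.
    have [|_] := is_derive_linear (L := fun w : E => w 0 i) _ (@coord_continuous _ 1 d 0 i)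
       (Csmooth_derivable (v := v) Ut Cxi) => //.
    by move=> a u w; rewrite !mxE.
  rewrite normrM; apply: (@le_trans _ _ (1 * (s * g1 t * K))).
    rewrite ler_pM //; first by rewrite -absP.
    apply: (le_trans (norm_coord _ _)); apply: (le_trans (Dxi _ _ Ut)).
    by rewrite ler_pM ?mulr_ge0 // ler_pM //; exact: ltW.
  have s0' := ltW s0; have K0' := ltW K0.
  rewrite mul1r mulrAC ler_pM ?mulr_ge0 //; last by apply: cmax; rewrite absP.
  by rewrite -ler_pdivlMr // ge_min lexx orbT.
have c0 : g1 c <= 0.
  move: half; rewrite -subr_le0 -{1}[g1 c]mul1r -mulrBl.
  have -> : 1 - 2^-1 = 2^-1 :> R by field.
  by rewrite pmulr_rle0.
have : g1 1 <= 0 by apply: (le_trans (cmax _ _) c0); rewrite absP normr1.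
by rewrite /g1 scale1r /v addrC subrK normr_le0 => /eqP.
Qed.

Section Curvature.
Variable br : g -> g -> g.
Hypothesis br_linr : forall A, linear (br A).
Hypothesis br_Jacobi : forall A B C, br A (br B C) = br (br A B) C + br B (br A C).

(** The structure equation evaluated on the frame: since [Om] is constant on the
    fields of the frame, its exterior derivative only contributes their bracket. *)
Definition flat_curv (y : E) (A C : g) : g := br A C - Om y (field_bracket (X A) (X C) y).
Local Notation k := flat_curv.

Let brB A B C : br A (B - C) = br A B - br A C.
Proof. exact: (linB (br_linr A)). Qed.

Lemma frame_bracket A C y : U y ->
  field_bracket (X A) (X C) y = X (br A C - k y A C) y.
Proof. by move=> Uy; rewrite /flat_curv opprB addrC subrK XK. Qed.

Lemma flat_curv_smooth A C : Csmooth U (fun y => k y A C).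
Proof.
apply: Csmooth_sub => //; first by move=> l; exact: Ck_cst.
by apply: Csmooth_coframe; apply: Csmooth_bracket => //; exact: frame_smooth.
Qed.

Let h_smooth A C : Csmooth U (fun y => br A C - k y A C).
Proof.
apply: Csmooth_sub => //; first by move=> l; exact: Ck_cst.
exact: flat_curv_smooth.
Qed.

Let Dalong_h a A C y : U y ->
  Dalong a (fun z => br A C - k z A C) y = - Dalong a (fun z => k z A C) y.
Proof.
move=> Uy; rewrite (@Dalong_sub _ _ U _ _ (cst (br A C))) //.
- by rewrite /Dalong derive_cst sub0r.
- by move=> l; exact: Ck_cst.
exact: flat_curv_smooth.
Qed.

Let frame_bracket_fun A C : {in U, field_bracket (X A) (X C) =1 (fun z => X (br A C - k z A C) z)}.
Proof. by move=> z; rewrite inE; exact: frame_bracket. Qed.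

(** The Bianchi identity, which is the Jacobi identity for the frame. When the
    curvature kills [A], it says that the curvature is infinitesimally equivariant
    along [X A]. *)
Lemma flat_curv_vertical A B C y : U y ->
  (forall z D, U z -> k z A D = 0) ->
  Dalong (X A) (fun z => k z B C) y =
  - (br A (k y B C) - k y (br A B) C - k y B (br A C)).
Proof.
move=> Uy kA; have CX := frame_smooth.
have vert D : {in U, field_bracket (X A) (X D) =1 X (br A D)}.
  by move=> z zU; rewrite frame_bracket_fun // kA ?subr0 //; exact: set_mem.
have J := field_bracket_Jacobi oU Uy (CX A) (CX B) (CX C).
have rU (f : E -> E) : {in U, f =1 f} by [].
have eL := @field_bracket_ext (X A) (X A) _ _ y Uy (rU _) (frame_bracket_fun B C).
have e1 := @field_bracket_ext _ _ (X C) (X C) y Uy (vert B) (rU _).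
have e2 := @field_bracket_ext (X B) (X B) _ _ y Uy (rU _) (vert C).
have L1 := field_bracket_frame (X A) Uy (h_smooth B C).
have {}L1 := etrans L1 (f_equal2 +%R (f_equal (X^~ y) (Dalong_h (X A) B C Uy))
  (vert _ y (mem_set Uy))).
have {}J := etrans (esym (etrans eL L1)) (etrans J (f_equal2 +%R
  (etrans e1 (frame_bracket _ _ Uy)) (etrans e2 (frame_bracket _ _ Uy)))).
have XD P Q : X P y + X Q y = X (P + Q) y.
  by have := X_linear Uy 1 P Q; rewrite !scale1r.
rewrite !XD in J; have := frame_inj Uy J; rewrite brB br_Jacobi => {}J.
have {}J : Dalong (X A) (fun z => k z B C) y =
    br (br A B) C + br B (br A C) - br A (k y B C) -
    (br (br A B) C - k y (br A B) C + (br B (br A C) - k y B (br A C))).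
  by rewrite -J opprD opprK addrC subrK.
rewrite J; move: (br (br A B) C) (br B (br A C)) (br A (k y B C)) (k y (br A B) C)
  (k y B (br A C)) => p q r s t.
rewrite -{1}(subrK s p) -{1}(subrK t q) addrACA [_ + (s + t)]addrC.
rewrite addrAC addrK.
by rewrite !opprB addrCA addrA.
Qed.

Section Symmetry.
Variable xi : E -> E.
Hypothesis xi_smooth : Csmooth U xi.
Hypothesis xi_comm : forall C y, U y -> field_bracket xi (X C) y = 0.

(** The Jacobi identity for [xi], [X B] and [X C]. *)
Lemma flat_curv_symmetry B C y : U y -> Dalong xi (fun z => k z B C) y = 0.
Proof.
move=> Uy; have CX := frame_smooth.
have vert D : {in U, field_bracket xi (X D) =1 cst 0}.
  by move=> z; rewrite inE => Uz; rewrite xi_comm.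
have J := field_bracket_Jacobi oU Uy xi_smooth (CX B) (CX C).
have rU (f : E -> E) : {in U, f =1 f} by [].
have eL := @field_bracket_ext xi xi _ _ y Uy (rU _) (frame_bracket_fun B C).
have e1 := @field_bracket_ext _ _ (X C) (X C) y Uy (vert B) (rU _).
have e2 := @field_bracket_ext (X B) (X B) _ _ y Uy (rU _) (vert C).
have L1 := field_bracket_frame xi Uy (h_smooth B C).
have {}L1 := etrans L1 (f_equal2 +%R (f_equal (X^~ y) (Dalong_h xi B C Uy))
  (xi_comm _ Uy)).
have {}J := etrans (esym (etrans eL L1)) (etrans J (f_equal2 +%R
  (etrans e1 (field_bracket0l _ _)) (etrans e2 (field_bracket0r _ _)))).
rewrite !addr0 -(frame0 Uy) in J.
by apply/eqP; rewrite -oppr_eq0; apply/eqP; exact: frame_inj Uy J.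
Qed.

(** The curvature [k] is constant along [xi], so the commutator formula for [xi] and
    [X B] shows that its second derivative along [X B] and [xi] vanishes at [y], where
    [xi] is [X T]. Commuting the derivatives along [X T] and [X B] and using
    [flat_curv_vertical] for [T] and for [br T B] expresses the action of [br T B] on
    [k] as minus the action of [T] on the derivative [k'] of [k] along [X B]. *)
Lemma flat_curv_second_order T B C D y : U y -> xi y = X T y ->
  (forall z F, U z -> k z T F = 0) -> (forall z F, U z -> k z (br T B) F = 0) ->
  let k' F G := Dalong (X B) (fun z => k z F G) y in
  br (br T B) (k y C D) - k y (br (br T B) C) D - k y C (br (br T B) D) =
  - (br T (k' C D) - k' (br T C) D - k' C (br T D)).
Proof.
move=> Uy xiT kT kTB k'; have CX := frame_smooth; have Ck := flat_curv_smooth.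
have c1 := Dalong_comm hg oU Uy xi_smooth (CX B) (Ck C D).
rewrite xi_comm // derive0 in c1.
have z1 : Dalong (X B) (Dalong xi (fun z => k z C D)) y = 0.
  rewrite (@Dalong_ext _ _ U _ _ _ (cst 0)) //; first by rewrite /Dalong derive_cst.
  by move=> z; rewrite inE => Uz; rewrite flat_curv_symmetry.
rewrite z1 subr0 in c1.
have c2 := Dalong_comm hg oU Uy (CX T) (CX B) (Ck C D).
have z2 : Dalong (X T) (Dalong (X B) (fun z => k z C D)) y = 0.
  by rewrite -c1 /Dalong xiT.
rewrite z2 sub0r frame_bracket // kT // subr0 in c2.
have v := flat_curv_vertical C D Uy kTB.
have e := @Dalong_ext _ _ U _ (X B) _ _ y oU Uy (fun z zU =>
   flat_curv_vertical C D (set_mem zU) kT).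
have CbT : Csmooth U (fun z => br T (k z C D)).
  move=> l; have cbr := linear_continuous_coordinates hg (br_linr T).
  exact: (Ck_linear oU (br_linr T) cbr (Ck C D l)).
have dbT : Dalong (X B) (fun z => br T (k z C D)) y = br T (k' C D).
  have cbr := linear_continuous_coordinates hg (br_linr T).
  have dk := Csmooth_derivable (v := X B y) Uy (Ck C D).
  by have [_ D1] := is_derive_linear (br_linr T) cbr dk.
have S1 := Csmooth_sub oU CbT (Ck (br T C) D).
have eD := deriveN (Csmooth_derivable (v := X B y) Uy (Csmooth_sub oU S1 (Ck C (br T D)))).
have eS := Dalong_sub (X B) Uy S1 (Ck C (br T D)).
have eT := Dalong_sub (X B) Uy CbT (Ck (br T C) D).
have {}e := etrans e (etrans eD (f_equal -%R (etrans eS (f_equal2 (fun p q => p - q)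
  (etrans eT (f_equal2 (fun p q => p - q) dbT erefl)) erefl)))).
have {}c2 := etrans (esym (f_equal -%R e)) (etrans c2 v).
apply: oppr_inj; apply: etrans (esym c2) _; exact: erefl.
Qed.

End Symmetry.
End Curvature.
End FlatCartan.

(** * The Lie algebra g *)

Section LieStructure.
Context (R : realType) (n m : nat).
Local Notation galg := (galg R n m).
Local Notation br := (@br R n m).

(** The matrices of X, H and Y in the basis E_i of V_n. *)
Definition raising : 'M[R]_n.+1 := \matrix_(j, i) (j.+1 == i)%:R.
Definition weights : 'M[R]_n.+1 := \matrix_(j, i) ((n%:R - (2 * i)%:R) * (j == i)%:R).
Definition lowering : 'M[R]_n.+1 :=
  \matrix_(j, i) (((n - i) * i.+1)%:R * (j == i.+1 :> nat)%:R).

Lemma sl2_actE (a : sl2 R) :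
  sl2_act n a = a.1.1 *: raising + a.1.2 *: weights + a.2 *: lowering.
Proof. by case: a => [[x h] y]; apply/matrixP => j i; rewrite !mxE !mulrA. Qed.

Lemma sub_mxE p q (A B : 'M[R]_(p, q)) j i : (A - B) j i = A j i - B j i.
Proof. by rewrite !mxE. Qed.

Lemma mul_weights p (A : 'M[R]_(n.+1, p)) j i :
  (weights *m A) j i = (n%:R - (2 * j)%:R) * A j i.
Proof.
rewrite mxE (bigD1 j) //= big1 ?addr0 ?mxE ?eqxx ?mulr1 // => k kj.
by rewrite mxE eq_sym (negPf kj) mulr0 mul0r.
Qed.

Lemma weights_mul (A : 'M[R]_n.+1) j i :
  (A *m weights) j i = A j i * (n%:R - (2 * i)%:R).
Proof.
rewrite mxE (bigD1 i) //= big1 ?addr0 ?mxE ?eqxx ?mulr1 // => k kj.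
by rewrite mxE (negPf kj) !mulr0.
Qed.

Lemma comm_weights_raising : weights *m raising - raising *m weights = 2 *: raising.
Proof.
apply/matrixP => j i; rewrite sub_mxE mul_weights weights_mul !mxE.
case: eqP => [<-|_]; rewrite ?mulr0 ?mul0r ?subrr // !natrM -natr1; ring.
Qed.

Lemma comm_weights_lowering : weights *m lowering - lowering *m weights = - 2 *: lowering.
Proof.
apply/matrixP => j i; rewrite sub_mxE mul_weights weights_mul !mxE.
case: eqP => [->|_]; rewrite ?mulr0 ?mul0r ?subrr // !natrM -natr1; ring.
Qed.

Lemma comm_raising_lowering : raising *m lowering - lowering *m raising = weights.
Proof.
have RL j i : (raising *m lowering) j i = ((n - i) * i.+1)%:R * (j == i)%:R :> R.
  rewrite mxE; have [jn|jn] := ltnP j n.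
    rewrite (bigD1 (Ordinal (jn : j.+1 < n.+1)%N)) //= big1 ?addr0.
      by rewrite !mxE /= eqxx mul1r eqSS -val_eqE.
    move=> k; rewrite -val_eqE /= => kj; rewrite !mxE eq_sym (negPf kj) mul0r //.
  rewrite big1 => [|k _].
    case: eqP => [<-|]; rewrite ?mulr0 //.
    by rewrite (_ : n - j = 0)%N ?mul0n ?mul0r //; apply/eqP; rewrite subn_eq0.
  rewrite !mxE; case: eqP => [jk|_]; rewrite ?mul0r //.
  by have := ltn_ord k; rewrite -jk ltnS ltnNge jn.
have LR j i : (lowering *m raising) j i = ((n.+1 - i) * i)%:R * (j == i)%:R :> R.
  rewrite mxE; case: j => [[|j] jn].
    rewrite big1 => [|k _]; last by rewrite !mxE /= mulr0 mul0r.
    by case: eqP => [<-|_]; rewrite ?muln0 ?mul0r ?mulr0.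
  have jn' : (j < n.+1)%N by exact: ltnW.
  rewrite (bigD1 (Ordinal jn')) //= big1 ?addr0.
    rewrite !mxE /= eqxx mulr1 -val_eqE /=.
    by case: eqP => [<-|_]; rewrite ?mulr0 // !mulr1 subSS.
  move=> k; rewrite -val_eqE /= => kj; rewrite !mxE /= eqSS eq_sym (negPf kj) mulr0 mul0r //.
apply/matrixP => j i; rewrite sub_mxE RL LR !mxE.
case: eqP => _; rewrite ?mulr0 ?subrr // !mulr1.
have ile : (i <= n)%N by rewrite -ltnS.
rewrite !natrM -natr1 subSn // -natr1 natrB //; ring.
Qed.

Definition sl2_br (a b : sl2 R) : sl2 R :=
  (2 * (a.1.2 * b.1.1 - a.1.1 * b.1.2), a.1.1 * b.2 - a.2 * b.1.1,
   2 * (a.2 * b.1.2 - a.1.2 * b.2)).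

Lemma br_sl2E (a b : sl2 R) :
  mx_sl2 (sl2_mx a *m sl2_mx b - sl2_mx b *m sl2_mx a) = sl2_br a b.
Proof.
case: a b => [[x h] y] [[x' h'] y'].
rewrite /mx_sl2 /sl2_br /= !mxE !big_ord_recl !big_ord0 !mxE /=.
by congr (_, _, _); ring.
Qed.

(** By bilinearity, the three brackets of X, H and Y suffice. *)
Lemma sl2_act_br a b :
  sl2_act n (sl2_br a b) = sl2_act n a *m sl2_act n b - sl2_act n b *m sl2_act n a.
Proof.
case: a b => [[x h] y] [[x' h'] y']; rewrite !sl2_actE /sl2_br /=.
pose com (A B : 'M[R]_n.+1) := A *m B - B *m A.
have comDl A B C : com (A + B) C = com A C + com B C.
  by rewrite /com mulmxDl mulmxDr opprD addrACA.
have comDr A B C : com A (B + C) = com A B + com A C.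
  by rewrite /com mulmxDl mulmxDr opprD addrACA.
have comZl t A B : com (t *: A) B = t *: com A B.
  by rewrite /com -scalemxAl -scalemxAr scalerBr.
have comZr t A B : com A (t *: B) = t *: com A B.
  by rewrite /com -scalemxAl -scalemxAr scalerBr.
have com0 A : com A A = 0 by rewrite /com subrr.
have comN A B : com A B = - com B A by rewrite /com opprB.
rewrite -[RHS]/(com _ _) !comDl !comDr !comZl !comZr !com0.
rewrite [com raising weights]comN [com lowering weights]comN [com lowering raising]comN.
have -> : com weights raising = 2 *: raising by exact: comm_weights_raising.
have -> : com weights lowering = - 2 *: lowering by exact: comm_weights_lowering.
have -> : com raising lowering = weights by exact: comm_raising_lowering.
apply/matrixP => j i; rewrite !(mxE, scaler0); ring.
Qed.

Lemma galg_ext (A B : galg) : A.1.1 = B.1.1 -> A.1.2 = B.1.2 -> A.2 = B.2 -> A = B.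
Proof. by case: A B => [[a b] v] [[a' b'] v'] /= -> -> ->. Qed.

Lemma sl2_ext (a b : sl2 R) : a.1.1 = b.1.1 -> a.1.2 = b.1.2 -> a.2 = b.2 -> a = b.
Proof. by case: a b => [[x h] y] [[x' h'] y'] /= -> -> ->. Qed.

Lemma sl2_act_linear : linear (@sl2_act R n).
Proof.
move=> t a b; rewrite !sl2_actE /=; apply/matrixP => j i; rewrite !mxE.
rewrite -![t *: _]/(t * _); ring.
Qed.

Lemma gact_linearr A : linear (@gact R n m A).
Proof.
move=> t u v; rewrite /gact mulmxDl mulmxDr -scalemxAl -scalemxAr scalerDr.
by rewrite addrACA.
Qed.

Lemma gact_linearl v : linear ((@gact R n m)^~ v).
Proof.
move=> t A B; rewrite /gact.
have -> : sl2_act n (t *: A + B).1.1 = t *: sl2_act n A.1.1 + sl2_act n B.1.1.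
  exact: sl2_act_linear.
have -> : (t *: A + B).1.2^T = t *: A.1.2^T + B.1.2^T by exact: linearP.
rewrite mulmxDl mulmxDr.
by rewrite -scalemxAl -scalemxAr scalerDr addrACA.
Qed.

Lemma brE A B : br A B = (sl2_br A.1.1 B.1.1, A.1.2 *m B.1.2 - B.1.2 *m A.1.2,
  gact A B.2 - gact B A.2).
Proof. by rewrite /br br_sl2E. Qed.

Lemma br_linearr A : linear (br A).
Proof.
move=> t B C; rewrite !brE; apply: galg_ext => /=.
- apply: sl2_ext => /=; rewrite -![t *: _]/(t * _); ring.
- rewrite mulmxDr mulmxDl -scalemxAr -scalemxAl scalerBr opprD addrACA //.
- by rewrite gact_linearr gact_linearl scalerBr opprD addrACA.
Qed.

Lemma br_anti A B : br A B = - br B A.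
Proof.
rewrite !brE; apply: galg_ext => /=; rewrite ?opprB //.
apply: sl2_ext => /=; ring.
Qed.

Lemma br_linearl B : linear (br^~ B).
Proof.
move=> t A C; rewrite br_anti (br_anti A B) (br_anti C B) br_linearr.
by rewrite scalerN opprD.
Qed.

Lemma brAA A : br A A = 0.
Proof.
rewrite brE; apply: galg_ext => /=; rewrite ?subrr //.
apply: sl2_ext => /=; ring.
Qed.

Lemma gact_br A B v : gact (br A B) v = gact A (gact B v) - gact B (gact A v).
Proof.
have -> : gact (br A B) v =
    sl2_act n (sl2_br A.1.1 B.1.1) *m v + v *m (A.1.2 *m B.1.2 - B.1.2 *m A.1.2)^T.
  by rewrite brE.
rewrite /gact sl2_act_br linearB /= !trmx_mul mulmxBl mulmxBr !mulmxDl !mulmxDr !mulmxA.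
move: (sl2_act n A.1.1 *m sl2_act n B.1.1 *m v) (sl2_act n B.1.1 *m sl2_act n A.1.1 *m v)
 (v *m B.1.2^T *m A.1.2^T) (v *m A.1.2^T *m B.1.2^T) (sl2_act n A.1.1 *m v *m B.1.2^T)
 (sl2_act n B.1.1 *m v *m A.1.2^T) => p q r s t u.
apply/matrixP => i j; rewrite !mxE; ring.
Qed.

Lemma br_Jacobi A B C : br A (br B C) = br (br A B) C + br B (br A C).
Proof.
apply: galg_ext.
- rewrite !brE /=; apply: sl2_ext => /=; ring.
- rewrite !brE /= mulmxBl !mulmxBr !mulmxBl !mulmxA.
  apply/matrixP => i j; rewrite !mxE; ring.
rewrite [br A (br B C)]brE [br (br A B) C]brE [br B (br A C)]brE /= !gact_br.
have gB (P : galg) u w : gact P u - gact P w = gact P (u - w).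
  by rewrite (linB (gact_linearr P)).
rewrite -!gB; apply/matrixP => i j; rewrite !mxE; ring.
Qed.

End LieStructure.

(** * The grading of g *)

Section Grading.
Context (R : realType) (n m : nat).
Local Notation galg := (galg R n m).
Local Notation br := (@br R n m).
Local Notation gpr := (@gpr R n m).
Local Notation gZ := (gZ R n m).
Implicit Types A B C : galg.

Lemma gprE k A : gpr k A =
  ((if k == -1 then A.1.1.1.1 else 0, if k == 0 then A.1.1.1.2 else 0,
    if k == 1 then A.1.1.2 else 0),
   if k == 0 then A.1.2 else 0,
   \matrix_(i, j) if k == i%:Z - n.+1%:Z then A.2 i j else 0).
Proof. by case: A => [[[[x h] y] b] v]. Qed.

Lemma gpr_linear k : linear (gpr k).
Proof.
move=> t A B; rewrite !gprE; apply: galg_ext => /=.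
- apply: sl2_ext => /=; case: ifP => _ //; by rewrite scaler0 addr0.
- by case: ifP => _ //; rewrite scaler0 addr0.
- by apply/matrixP => i j; rewrite !mxE; case: ifP => _ //; rewrite mulr0 addr0.
Qed.

Lemma gpr_gpr k l A : gpr k (gpr l A) = if k == l then gpr k A else 0.
Proof.
case: eqP => [<-|/eqP kl]; rewrite !gprE; apply: galg_ext => /=.
- by apply: sl2_ext => /=; case: eqP.
- by case: eqP.
- by apply/matrixP => i j; rewrite !mxE; case: eqP.
- apply: sl2_ext => /=; case: eqP => // e; rewrite e eq_sym in kl; by rewrite (negPf kl).
- by case: eqP => // e; rewrite e eq_sym in kl; rewrite (negPf kl).
- apply/matrixP => i j; rewrite !mxE; case: eqP => // e; rewrite e eq_sym in kl.
  by rewrite (negPf kl).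
Qed.

Lemma grade_gpr k A : grade k (gpr k A).
Proof. by rewrite /grade /= gpr_gpr eqxx. Qed.

(** Enumerates the degrees -n-1, ..., 1; in all other degrees [gpr] is zero. *)
Definition degree (i : 'I_n.+3) : int := i%:Z - n.+1%:Z.

Lemma degree_inj : injective degree.
Proof. by move=> i j /addIr [] /val_inj. Qed.

Lemma gpr_sum A : A = \sum_i gpr (degree i) A.
Proof.
have pick k (i : 'I_n.+3) : degree i = k ->
    forall V : zmodType, forall F : V, \sum_j (if degree j == k then F else 0) = F.
  move=> ik V F; rewrite (bigD1 i) //= ik eqxx big1 ?addr0 // => j ji.
  by case: eqP => // jk; move: ji; rewrite (degree_inj (etrans jk (esym ik))) eqxx.
have iX : (n < n.+3)%N by lia.
have iH : (n.+1 < n.+3)%N by lia.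
have iY : (n.+2 < n.+3)%N by lia.
have dX : degree (Ordinal iX) = -1 by rewrite /degree /=; lia.
have dH : degree (Ordinal iH) = 0 by rewrite /degree /=; lia.
have dY : degree (Ordinal iY) = 1 by rewrite /degree /=; lia.
under eq_bigr => i _ do rewrite gprE.
apply: galg_ext.
- apply: sl2_ext; rewrite !raddf_sum /=.
  + by rewrite (pick _ _ dX).
  + by rewrite (pick _ _ dH).
  + exact: (esym (pick _ _ dY _ _)).
- by rewrite !raddf_sum /= (pick _ _ dH).
- rewrite raddf_sum /=; apply/matrixP => i j; rewrite summxE.
  have il : (i < n.+3)%N by have := ltn_ord i; lia.
  under eq_bigr => k _ do rewrite mxE.
  by rewrite (pick (i%:Z - n.+1%:Z) (Ordinal il)).
Qed.

Lemma br_gZE A : br gZ A =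
  ((- A.1.1.1.1, 0, A.1.1.2), 0, \matrix_(i, j) ((i%:Z - n.+1%:Z)%:~R * A.2 i j)).
Proof.
have gZE : gZ = ((0, - 2^-1, 0), (- 2^-1 * (n + 2)%:R)%:M, 0).
  rewrite /gZ; apply: galg_ext => /=.
  - apply: sl2_ext => /=; rewrite -![_ *: _]/(_ * _); ring.
  - by rewrite add0r scalerA scalemx1.
  - by rewrite scaler0 addr0 scaler0.
rewrite gZE brE /=; apply: galg_ext => /=.
- by apply: sl2_ext => /=; field.
- by rewrite mul_scalar_mx mul_mx_scalar subrr.
- rewrite /gact mulmx0 mul0mx addr0 subr0 sl2_actE /= !scale0r add0r addr0.
  rewrite tr_scalar_mx -scalemxAl mul_mx_scalar; apply/matrixP => i j.
  have E (P Q : 'M[R]_(n.+1, m)) c d : (c *: P + d *: Q) i j = c * P i j + d * Q i j.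
    by rewrite !mxE.
  rewrite E mul_weights.
  rewrite mxE intrB natrM natrD -[n.+1%:~R]/(n.+1%:R : R) -[(Posz i)%:~R]/((nat_of_ord i)%:R : R).
  by rewrite -natr1; field.
Qed.

Lemma gpr_br_gZ k A : gpr k (br gZ A) = k%:~R *: gpr k A.
Proof.
rewrite br_gZE !gprE /=; apply: galg_ext => /=.
- apply: sl2_ext => /=; case: eqP => [->|_]; rewrite ?scaler0 //.
  + by rewrite scaleN1r.
  + by rewrite scale0r.
  + by rewrite scale1r.
- by case: eqP => [->|_]; rewrite ?scaler0 ?scale0r.
- by apply/matrixP => i j; rewrite !mxE; case: eqP => [->|_]; rewrite ?mulr0.
Qed.

Lemma br_gZ_gpr k A : br gZ (gpr k A) = k%:~R *: gpr k A.
Proof.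
rewrite br_gZE !gprE /=; apply: galg_ext => /=.
- apply: sl2_ext => /=; case: eqP => [->|_]; rewrite ?scaler0 ?oppr0 //.
  + by rewrite scaleN1r.
  + by rewrite scale0r.
  + by rewrite scale1r.
- by case: eqP => [->|_]; rewrite ?scaler0 ?scale0r.
- by apply/matrixP => i j; rewrite !mxE; case: eqP => [->|_]; rewrite ?mulr0.
Qed.

(** As the graded pieces are the eigenspaces of ad Z, the compatibility of the
    bracket with the grading is a consequence of the Jacobi identity. *)
Lemma gradeP k A : grade k A <-> br gZ A = k%:~R *: A.
Proof.
split=> [<-|e]; first by rewrite br_gZ_gpr.
rewrite /grade /=; have other l : l != k -> gpr l A = 0.
  move=> lk; apply/eqP; have := gpr_br_gZ l A; rewrite e (linZ (gpr_linear l)) => /eqP.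
  rewrite -subr_eq0 -scalerBl scaler_eq0 subr_eq0 eqr_int eq_sym.
  by rewrite (negPf lk).
rewrite {2}[A]gpr_sum {1}[A]gpr_sum (lin_sum (gpr_linear k)); apply: eq_bigr => i _.
rewrite gpr_gpr; case: eqP => [-> //|/eqP]; rewrite eq_sym => /other ->.
by [].
Qed.

End Grading.

(** * The splitting of g and the inner product *)

Section Parts.
Context (R : realType) (n m : nat).
Local Notation galg := (galg R n m).
Local Notation br := (@br R n m).
Local Notation gpr := (@gpr R n m).
Local Notation gZ := (gZ R n m).
Local Notation gX := (gX R n m).
Local Notation gY := (gY R n m).
Implicit Types A B C : galg.

Lemma grade_br i j A B : grade i A -> grade j B -> grade (i + j) (br A B).
Proof.
move=> /gradeP iA /gradeP jB; apply/gradeP.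
rewrite br_Jacobi iA jB (linZ (br_linearl B)) (linZ (br_linearr A)).
by rewrite -scalerDl intrD.
Qed.

Lemma gpr_grade k l A : grade k A -> gpr l A = if l == k then A else 0.
Proof. by move=> kA; rewrite -{1}kA gpr_gpr; case: eqP => // ->; rewrite kA. Qed.

Lemma gpr_br i j A B : grade i A -> gpr (i + j) (br A B) = br A (gpr j B).
Proof.
move=> iA; rewrite {1}[B]gpr_sum {2}[B]gpr_sum !lin_sum;
  try exact: gpr_linear; try exact: br_linearr.
apply: eq_bigr => l _; rewrite (gpr_grade _ (grade_br iA (grade_gpr _ _))) gpr_gpr.
rewrite (inj_eq (addrI i)); case: eqP => [->//|_].
by rewrite (lin0 (br_linearr A)).
Qed.

(** The projection onto g_- along p. *)
Definition negpart A : galg := ((A.1.1.1.1, 0, 0), 0, A.2).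

Lemma negpart_linear : linear negpart.
Proof.
move=> t A B; apply: galg_ext => //=.
  by apply: sl2_ext => //=; rewrite scaler0 addr0.
by rewrite scaler0 addr0.
Qed.

Lemma negpart_id A : negpart (negpart A) = negpart A. Proof. by []. Qed.

Lemma gnegP A : gneg A <-> negpart A = A.
Proof.
split=> [negA | <- j j0].
  have := negA 0 (lexx _); rewrite gprE => /= -[h b _].
  have := negA 1 ler01; rewrite gprE => /= -[y _].
  by apply: galg_ext => //=; apply: sl2_ext.
rewrite gprE /=; have jm1 : (j == -1) = false by apply/eqP; lia.
apply: galg_ext => /=; first by apply: sl2_ext => /=; rewrite ?jm1 //; case: ifP.
  by case: ifP.
apply/matrixP => i l; rewrite !mxE; case: eqP => // e.
by have := ltn_ord i; lia.
Qed.

Lemma gneg_negpart A : gneg (negpart A).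
Proof. exact/gnegP. Qed.

Lemma gpP A : gp A <-> negpart A = 0.
Proof.
split=> [pA | nA j j0].
  apply: galg_ext => //=.
    apply: sl2_ext => //=; have := pA (-1) (ltrN10 _); by rewrite gprE => /= -[].
  apply/matrixP => i l; rewrite mxE.
  have i0 : i%:Z - n.+1%:Z < 0 by have := ltn_ord i; lia.
  have := pA _ i0; rewrite gprE => -[_ _ _ _ /matrixP/(_ i l)].
  by rewrite !mxE eqxx.
have x0 : A.1.1.1.1 = 0 by rewrite -[LHS]/((negpart A).1.1.1.1) nA.
have v0 : A.2 = 0 by rewrite -[LHS]/((negpart A).2) nA.
have j0' : (j == 0) = false by apply/eqP; lia.
have j1' : (j == 1) = false by apply/eqP; lia.
rewrite gprE x0 v0 j0' j1'; apply: galg_ext => //=.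
  by apply: sl2_ext => //=; case: ifP.
by apply/matrixP => i l; rewrite !mxE; case: ifP.
Qed.

Lemma gp_sub_negpart A : gp (A - negpart A).
Proof. by apply/gpP; rewrite (linB negpart_linear) negpart_id subrr. Qed.

Lemma gp_br A B : gp A -> gp B -> gp (br A B).
Proof.
have E C : negpart C = 0 -> C.1.1.1.1 = 0 /\ C.2 = 0.
  move=> C0; split; first by rewrite -[LHS]/((negpart C).1.1.1.1) C0.
  by rewrite -[LHS]/((negpart C).2) C0.
move=> /gpP/E[xA vA] /gpP/E[xB vB]; apply/gpP; rewrite brE; apply: galg_ext => //=.
  by apply: sl2_ext => //=; rewrite xA xB; ring.
by rewrite vA vB !(lin0 (@gact_linearr _ _ _ _)) subrr.
Qed.

Lemma gneg_br A B : gneg A -> gneg B -> gneg (br A B).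
Proof.
move=> /gnegP <- /gnegP <-; apply/gnegP; rewrite brE; apply: galg_ext => //=.
  by apply: sl2_ext => //=; ring.
by rewrite mul0mx subrr.
Qed.

Lemma grade0E A : grade 0 A -> [/\ A.1.1.1.1 = 0, A.1.1.2 = 0 & A.2 = 0].
Proof.
rewrite /grade /= gprE => A0; split; try by rewrite -A0.
rewrite -A0 /=; apply/matrixP => i j; rewrite !mxE; case: eqP => // e.
by have := ltn_ord i; lia.
Qed.

Lemma grade0_gneg A B : grade 0 A -> gneg B -> gneg (br A B).
Proof.
move=> /grade0E[xA yA vA] /gnegP <-; apply/gnegP; rewrite brE; apply: galg_ext => //=.
  by apply: sl2_ext => //=; rewrite ?xA ?yA; ring.
by rewrite mulmx0 mul0mx subrr.
Qed.

Lemma grade0_gp A : grade 0 A -> gp A.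
Proof. by move=> /grade0E[xA yA vA]; apply/gpP; rewrite /negpart xA vA. Qed.

Lemma gY_gp : gp gY. Proof. exact/gpP. Qed.
Lemma gX_gneg : gneg gX. Proof. exact/gnegP. Qed.

Lemma gtr_grade0 A : grade 0 A -> grade 0 (gtr A).
Proof.
move=> /grade0E; case: A => [[[[x h] y] b] v] /= [-> -> ->].
rewrite /grade /= gprE; apply: galg_ext => //=.
by apply/matrixP => i j; rewrite !mxE; case: ifP.
Qed.

Lemma gZ_grade0 : grade 0 gZ.
Proof. by apply/gradeP; rewrite brAA scale0r. Qed.

Lemma galg_coordinates : has_coordinates galg.
Proof.
apply: prod_coordinates; last exact: matrix_coordinates.
apply: prod_coordinates; last exact: matrix_coordinates.
by apply: prod_coordinates; [apply: prod_coordinates|]; exact: scalar_coordinates.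
Qed.

End Parts.

Section InnerProduct.
Context (R : realType) (n m : nat) (ip : galg R n m -> galg R n m -> R).
Hypothesis hip : suitable ip.
Local Notation galg := (galg R n m).
Local Notation br := (@br R n m).
Local Notation gpr := (@gpr R n m).
Implicit Types A B C : galg.

Lemma ip_linr A : linear (ip A : galg -> R^o).
Proof. exact: (ip_linear hip). Qed.

Lemma ip_linl B : linear (ip^~ B : galg -> R^o).
Proof. by move=> t A C; rewrite !(ip_sym hip _ B) ip_linr. Qed.

Lemma ip_eq0 A : ip A A = 0 -> A = 0.
Proof.
by move=> A0; apply/eqP; case: (eqVneq A 0) => // /(ip_pos hip); rewrite A0 ltxx.
Qed.

Lemma ip_ge0 A : 0 <= ip A A.
Proof.
case: (eqVneq A 0) => [->|/(ip_pos hip)/ltW //].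
by rewrite (lin0 (ip_linr 0)).
Qed.

(** The graded pieces are orthogonal, so the projections are self-adjoint. *)
Lemma ip_gpr k A B : ip (gpr k A) B = ip A (gpr k B).
Proof.
have key A' B' : ip (gpr k A') B' = ip (gpr k A') (gpr k B').
  transitivity (\sum_i ip (gpr k A') (gpr (@degree n i) B')).
    by rewrite {1}[B']gpr_sum (lin_sum (ip_linr _)).
  transitivity (\sum_i ip (gpr k A') (gpr k (gpr (@degree n i) B'))); last first.
    have -> : gpr k B' = \sum_i gpr k (gpr (@degree n i) B').
      by rewrite {1}[B']gpr_sum (lin_sum (@gpr_linear R n m k)).
    by rewrite (lin_sum (ip_linr _)).
  apply: eq_bigr => i _; rewrite gpr_gpr; case: eqP => [-> //|/eqP ki].
  rewrite (lin0 (ip_linr _)); exact: (ip_grade hip ki (grade_gpr _ _) (grade_gpr _ _)).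
by rewrite key [RHS](ip_sym hip) [RHS]key (ip_sym hip).
Qed.

Lemma ip_gneg_gp A B : gneg A -> gp B -> ip A B = 0.
Proof.
move=> nA pB; rewrite [A]gpr_sum (lin_sum (ip_linl B)) big1 // => i _.
rewrite ip_gpr; have [d0|d0] := ltP (degree i) 0; first by rewrite pB // (lin0 (ip_linr _)).
by rewrite -ip_gpr nA // (lin0 (ip_linl B)).
Qed.

Lemma ip_negpart A B : ip (negpart A) B = ip A (negpart B).
Proof.
have key A' B' : ip (negpart A') B' = ip (negpart A') (negpart B').
  apply/eqP; rewrite -subr_eq0 -(linB (ip_linr _)).
  by rewrite ip_gneg_gp //; [exact: gneg_negpart | exact: gp_sub_negpart].
by rewrite key [RHS](ip_sym hip) [RHS]key (ip_sym hip).
Qed.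

Definition orthonormal N (e : 'I_N -> galg) : Prop :=
  forall i j, ip (e i) (e j) = (i == j)%:R.

Lemma orthonormal_coef N (e : 'I_N -> galg) (c : 'I_N -> R) j : orthonormal e ->
  ip (\sum_i c i *: e i) (e j) = c j.
Proof.
move=> oe; rewrite (lin_sum (ip_linl _)) (bigD1 j) //= big1 ?addr0.
  by rewrite (linZ (ip_linl _)) oe eqxx; rewrite -[LHS]/(_ * _) mulr1.
move=> i ij; rewrite (linZ (ip_linl _)) oe (negPf ij); by rewrite -[LHS]/(_ * _) mulr0.
Qed.

(** Gram-Schmidt; a vector in the span of the previous ones is skipped. *)
Lemma orthonormal_extension (s : seq galg) : exists N (e : 'I_N -> galg),
  orthonormal e /\ forall A, A \in s -> A = \sum_i ip A (e i) *: e i.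
Proof.
elim: s => [|a s [N [e [oe se]]]].
  by exists 0, (fun=> 0); split => // -[].
pose p := \sum_i ip a (e i) *: e i; pose r := a - p.
have re j : ip r (e j) = 0 by rewrite /r (linB (ip_linl _)) orthonormal_coef // subrr.
have [r0|r0] := eqVneq r 0.
  exists N, e; split=> // A; rewrite inE => /orP[/eqP->|/se //].
  by apply/eqP; rewrite -subr_eq0 -/p -/r r0.
pose c := (Num.sqrt (ip r r))^-1.
have rr : 0 < ip r r by exact: (ip_pos hip).
have cc : c * c * ip r r = 1.
  rewrite /c -invfM -expr2 sqr_sqrtr ?ltW // mulVf // lt0r_neq0 //.
pose e' (i : 'I_N.+1) := if unlift ord0 i is Some j then e j else c *: r.
have e'0 : e' ord0 = c *: r by rewrite /e' unlift_none.
have e'S j : e' (lift ord0 j) = e j by rewrite /e' liftK.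
have se' A : A = \sum_i ip A (e i) *: e i -> A = \sum_i ip A (e' i) *: e' i.
  move=> Ae; rewrite big_ord_recl e'0 (linZ (ip_linr _)).
  have -> : ip A r = 0.
    rewrite Ae (lin_sum (ip_linl _)) big1 // => i _.
    by rewrite (linZ (ip_linl _)) (ip_sym hip (e i)) re -[LHS]/(_ * _) mulr0.
  rewrite scaler0 scale0r add0r {1}Ae.
  by apply: eq_bigr => i _; rewrite e'S.
exists N.+1, e'; split.
  move=> i j; case: (unliftP ord0 i) => [i'|] ->; case: (unliftP ord0 j) => [j'|] ->.
  - by rewrite !e'S oe (inj_eq lift_inj).
  - by rewrite e'S e'0 (linZ (ip_linr _)) (ip_sym hip) re scaler0.
  - by rewrite e'S e'0 (linZ (ip_linl _)) re scaler0.
  - rewrite e'0 (linZ (ip_linl _)) (linZ (ip_linr _)) eqxx -cc.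
    by rewrite -![_ *: _]/(_ * _) mulrA.
move=> A; rewrite inE => /orP[/eqP->|/se]; last exact: se'.
rewrite big_ord_recl e'0 (linZ (ip_linr _)).
under eq_bigr => i _ do rewrite e'S.
rewrite -/p; have -> : ip a r = ip r r.
  rewrite {2}/r (linB (ip_linl _)) (lin_sum (ip_linl _)) big1 ?subr0 // => i _.
  by rewrite (linZ (ip_linl _)) (ip_sym hip (e i)) re -[LHS]/(_ * _) mulr0.
rewrite scalerA -[c *: _]/(c * _) mulrAC cc scale1r /r subrK //.
Qed.

Lemma orthonormal_basis_exists : exists N (e : 'I_N -> galg), orthonormal_basis ip e.
Proof.
have [K [b [l [_ _ lb]]]] := galg_coordinates R n m.
have [N [e [oe se]]] := orthonormal_extension [seq b i | i <- enum 'I_K].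
exists N, e; split=> // A.
have bE i : b i = \sum_j ip (b i) (e j) *: e j by apply/se/map_f; rewrite mem_enum.
rewrite {1}[A]lb; under eq_bigr => i _ do rewrite bE scaler_sumr.
rewrite exchange_big; apply: eq_bigr => j _ /=.
under eq_bigr => i _ do rewrite scalerA.
rewrite -scaler_suml; congr (_ *: _).
rewrite [in RHS](lb A) (lin_sum (ip_linl _)); apply: eq_bigr => i _.
by rewrite (linZ (ip_linl _)).
Qed.

Section Trace.
Variables (N : nat) (e : 'I_N -> galg).
Hypothesis he : orthonormal_basis ip e.

Lemma basis_sum A : A = \sum_i ip A (e i) *: e i.
Proof. exact: he.2. Qed.

Lemma linear_eq_basis (V : lmodType R) (f f' : galg -> V) :
  linear f -> linear f' -> (forall i, f (e i) = f' (e i)) -> f =1 f'.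
Proof.
move=> lf lf' ff A; rewrite [A]basis_sum !lin_sum //.
by apply: eq_bigr => i _; rewrite !linZ // ff.
Qed.

(** With identical endomorphisms this is the independence of a trace from the
    orthonormal basis; in general it also moves [T] to its adjoint. *)
Lemma trace_transport N' (e' : 'I_N' -> galg) (T T' : galg -> galg)
    (b : galg -> galg -> R) :
  orthonormal_basis ip e' ->
  (forall A, linear (b A : galg -> R^o)) -> (forall B, linear (b^~ B : galg -> R^o)) ->
  (forall A B, ip (T A) B = ip A (T' B)) ->
  \sum_i b (T (e i)) (e i) = \sum_i b (e' i) (T' (e' i)).
Proof.
move=> he' br bl TT.
under eq_bigr => i _.
  rewrite [T _](he'.2) (lin_sum (bl _)).
  under eq_bigr => k _ do rewrite (linZ (bl _)) TT.
over.
rewrite exchange_big; apply: eq_bigr => k _ /=.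
rewrite [T' _ in RHS]basis_sum (lin_sum (br _)); apply: eq_bigr => i _.
by rewrite (linZ (br _)) (ip_sym hip).
Qed.

End Trace.
End InnerProduct.

(** * Cochains *)

(** The codifferentials are defined with sums over increasing indices. The full
    sums do not refer to an order on the basis, hence behave well under a change of
    basis and under adjoints. *)
Section OrderedSums.
Context (R : realType) (N : nat).

Lemma ordered_sum2 (F : 'I_N -> 'I_N -> R) :
  (forall i j, F i j = F j i) -> (forall i, F i i = 0) ->
  \sum_i \sum_j F i j = 2 * \sum_(i < N) \sum_(j < N | (i < j)%N) F i j.
Proof.
move=> sF F0.
transitivity (\sum_(i < N) \sum_(j < N | (i < j)%N) F i j +
              \sum_(i < N) \sum_(j < N | (j < i)%N) F i j).
  rewrite -big_split; apply: eq_bigr => i _ /=.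
  rewrite [X in _ = X + _]big_mkcond [X in _ = _ + X]big_mkcond -big_split; apply: eq_bigr => j _ /=.
  case: ltngtP => [_|_|/val_inj <-]; rewrite ?addr0 ?add0r ?F0 ?addr0 //.
have -> : \sum_(i < N) \sum_(j < N | (j < i)%N) F i j =
          \sum_(i < N) \sum_(j < N | (i < j)%N) F i j.
  rewrite (exchange_big_dep xpredT) //=; apply: eq_bigr => i _; apply: eq_bigr => j _.
  exact: sF.
ring.
Qed.

Lemma ordered_sum3 (F : 'I_N -> 'I_N -> 'I_N -> R) :
  (forall i j k, F i j k = F j i k) -> (forall i j k, F i j k = F i k j) ->
  (forall i j, F i i j = 0) ->
  \sum_i \sum_j \sum_k F i j k =
  6 * \sum_(i < N) \sum_(j < N | (i < j)%N) \sum_(k < N | (j < k)%N) F i j k.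
Proof.
move=> s12 s23 F0.
have F0' i j : F i j j = 0 by rewrite s12 s23 F0.
(* the terms of G with permuted indices tile the set of triples i, j, k with j < k *)
pose G (i j k : 'I_N) : R := if (i < j)%N && (j < k)%N then F i j k else 0.
set S := (X in _ = 6 * X).
have SG : S = \sum_i \sum_j \sum_k G i j k.
  apply: eq_bigr => i _; rewrite big_mkcond; apply: eq_bigr => j _ /=.
  rewrite /G; case: ifP => ij /=; last by rewrite big1.
  by rewrite big_mkcond.
transitivity (\sum_i (2 * \sum_(j < N) \sum_(k < N | (j < k)%N) F i j k)).
  by apply: eq_bigr => i _; apply: ordered_sum2.
rewrite -mulr_sumr.
suff -> : \sum_(i < N) \sum_(j < N) \sum_(k < N | (j < k)%N) F i j k = 3 * S by ring.
transitivity (\sum_i \sum_j \sum_k (G i j k + G j i k + G j k i)).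
  apply: eq_bigr => i _; apply: eq_bigr => j _.
  rewrite [LHS]big_mkcond; apply: eq_bigr => k _ /=.
  rewrite /G; case: (ltnP j k) => jk /=; last first.
    rewrite !andbF /= add0r addr0; case: ifP => [/andP[ji ik]|//].
    by move: (leq_ltn_trans jk (ltn_trans ji ik)); rewrite ltnn.
  rewrite ?andbT; case: (ltngtP i j) => [ij|ij|/val_inj ->].
  - by rewrite (leq_gtF (ltnW (ltn_trans ij jk))) /= !addr0.
  - case: (ltngtP i k) => [ik|ik|/val_inj ->]; rewrite /= !(add0r, addr0).
    + exact: s12.
    + by rewrite s12 s23.
    + by rewrite s12 F0'.
  - by rewrite F0 (leq_gtF (ltnW jk)) /= !addr0 ?if_same.
have -> : 3 * S = S + S + S by ring.
under eq_bigr => i _ do under eq_bigr => j _ do rewrite !big_split /=.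
under eq_bigr => i _ do rewrite !big_split /=.
rewrite !big_split /= -SG; congr (_ + _ + _).
  by rewrite exchange_big /= -SG.
rewrite exchange_big /=; rewrite SG.
by apply: eq_bigr => j _; rewrite exchange_big.
Qed.

End OrderedSums.

(** Vector space identities in g are checked in coordinates, once the brackets and
    the values of cochains that they involve are turned into variables. *)
Ltac galg_abel := apply: galg_ext; [apply: sl2_ext => /=; rewrite -?[_ *: _]/(_ * _); ring
  | apply/matrixP => ? ?; rewrite !mxE; ring | apply/matrixP => ? ?; rewrite !mxE; ring].
Ltac galg_gen := repeat match goal with |- context [@br ?R ?n ?m ?a ?b] =>
  generalize (@br R n m a b); intro end.

Section Cochains.
Context (R : realType) (n m : nat).
Local Notation galg := (galg R n m).
Local Notation br := (@br R n m).
Local Notation cochain1 := (cochain1 R n m).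
Local Notation cochain2 := (cochain2 R n m).
Implicit Types (A B C D : galg) (f g : cochain2).

#[local] Opaque Defs.br.
Let brr A : linear (br A) := @br_linearr R n m A.

Lemma brD A B C : br A (B + C) = br A B + br A C. Proof. exact: linD (brr A) _ _. Qed.
Lemma brN A B : br A (- B) = - br A B. Proof. exact: linN (brr A) _. Qed.

Definition bilin f := (forall A, linear (f A)) /\ (forall B, linear (f^~ B)).

Lemma cochain2_bilin f : is_cochain2 f -> bilin f.
Proof. by case. Qed.

Lemma cochain2_anti f A B : is_cochain2 f -> f A B = - f B A.
Proof.
case=> lr ll alt; have := alt (A + B).
rewrite (linD (lr _)) !(linD (ll _)) !alt add0r addr0 => /eqP.
by rewrite addr_eq0 => /eqP->; rewrite opprK.
Qed.

Lemma hor2_negpart f A B : hor2 f -> f A B = f (negpart A) (negpart B).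
Proof.
move=> [cf hf]; have [lr ll alt] := cf.
have h1 A' B' : f A' B' = f (negpart A') B'.
  apply/eqP; rewrite -subr_eq0 -(linB (ll B')) hf //; exact: gp_sub_negpart.
by rewrite h1 (cochain2_anti _ _ cf) h1 -(cochain2_anti _ _ cf).
Qed.

Lemma hor2P f : is_cochain2 f ->
  (forall A B, f A B = f (negpart A) (negpart B)) -> hor2 f.
Proof.
move=> cf fn; split=> // A B /gpP A0; rewrite fn A0.
by have [_ ll _] := cf; rewrite (lin0 (ll _)).
Qed.

(** The horizontal cochain with the same values on g_-. *)
Definition restrict2 f : cochain2 := fun A B => f (negpart A) (negpart B).

Lemma restrict2_hor f : is_cochain2 f -> hor2 (restrict2 f).
Proof.
move=> [lr ll alt]; apply: hor2P => //; split.
- by move=> A t B C; rewrite /restrict2 negpart_linear lr.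
- by move=> B t A C; rewrite /restrict2 negpart_linear ll.
- by move=> A; exact: alt.
Qed.

Lemma hor2_0 : hor2 (0 : cochain2).
Proof.
by do !split => //; move=> ? t ? ?; rewrite -[RHS]/(t *: (0 : galg) + 0) scaler0 addr0.
Qed.

Lemma hor2_linear t f g : hor2 f -> hor2 g -> hor2 (t *: f + g).
Proof.
move=> [[fr fl fa] hf] [[gr gl ga] hg].
have E A B : (t *: f + g) A B = t *: f A B + g A B by [].
split; first split.
- by move=> A s B C; rewrite !E fr gr !scalerDr !scalerA mulrC addrACA.
- by move=> B s A C; rewrite !E fl gl !scalerDr !scalerA mulrC addrACA.
- by move=> A; rewrite E fa ga scaler0 addr0.
- by move=> A B pA; rewrite E hf // hg // scaler0 addr0.
Qed.

Lemma d1_cochain2 (g : cochain1) : is_cochain1 g -> is_cochain2 (d1 g).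
Proof.
move=> lg; split.
- move=> A t B C; rewrite /d1 lg !br_linearr br_linearl lg.
  move: (br A (g B)) (br A (g C)) (br B (g A)) (br C (g A)) (g (br A B)) (g (br A C)).
  by move=> p q r s u v; galg_abel.
- move=> B t A C; rewrite /d1 lg !br_linearl br_linearr lg.
  move: (br A (g B)) (br C (g B)) (br B (g A)) (br B (g C)) (g (br A B)) (g (br C B)).
  by move=> p q r s u v; galg_abel.
- by move=> A; rewrite /d1 subrr brAA (lin0 lg) subr0.
Qed.

Lemma d2_alt12 f A C : is_cochain2 f -> d2 f A A C = 0.
Proof.
move=> [lr ll alt]; rewrite /d2 alt brAA (lin0 (ll _)) (lin0 (brr _)).
move: (br A (f A C)) (f (br A C) A) => p q; galg_abel.
Qed.

Lemma d2_alt23 f A B : is_cochain2 f -> d2 f A B B = 0.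
Proof.
move=> [lr ll alt]; rewrite /d2 alt brAA (lin0 (ll _)) (lin0 (brr _)).
move: (br B (f A B)) (f (br A B) B) => p q; galg_abel.
Qed.

Lemma d2_lin1 f B C : bilin f -> linear (fun A => d2 f A B C).
Proof.
move=> [lr ll] t A A'; rewrite /d2 !(lr, ll, br_linearl, br_linearr) ?lr ?ll.
move: (br A (f B C)) (br A' (f B C)) (br B (f A C)) (br B (f A' C)) (br C (f A B))
 (br C (f A' B)) (f (br A B) C) (f (br A' B) C) (f (br A C) B) (f (br A' C) B)
 (f (br B C) A) (f (br B C) A').
by move=> *; galg_abel.
Qed.

Lemma d2_lin2 f A C : bilin f -> linear (fun B => d2 f A B C).
Proof.
move=> [lr ll] t B B'; rewrite /d2 !(lr, ll, br_linearl, br_linearr) ?lr ?ll.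
move: (br A (f B C)) (br A (f B' C)) (br B (f A C)) (br B' (f A C)) (br C (f A B))
 (br C (f A B')) (f (br A B) C) (f (br A B') C) (f (br A C) B) (f (br A C) B')
 (f (br B C) A) (f (br B' C) A).
by move=> *; galg_abel.
Qed.

Lemma d2_lin3 f A B : bilin f -> linear (fun C => d2 f A B C).
Proof.
move=> [lr ll] t C C'; rewrite /d2 !(lr, ll, br_linearl, br_linearr) ?lr ?ll.
move: (br A (f B C)) (br A (f B C')) (br B (f A C)) (br B (f A C')) (br C (f A B))
 (br C' (f A B)) (f (br A B) C) (f (br A B) C') (f (br A C) B) (f (br A C') B)
 (f (br B C) A) (f (br B C') A).
by move=> *; galg_abel.
Qed.

Lemma d2_linear t f g A B C : d2 (t *: f + g) A B C = t *: d2 f A B C + d2 g A B C.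
Proof.
have E A' B' : (t *: f + g) A' B' = t *: f A' B' + g A' B' by [].
rewrite /d2 !E !(brr _).
move: (br A (f B C)) (br B (f A C)) (br C (f A B)) (br A (g B C)) (br B (g A C)) (br C (g A B)).
move: (f (br A B) C) (f (br A C) B) (f (br B C) A) (g (br A B) C) (g (br A C) B) (g (br B C) A).
by move=> *; galg_abel.
Qed.

Lemma d2_d1 (g : cochain1) A B C : is_cochain1 g -> d2 (d1 g) A B C = 0.
Proof.
move=> lg; rewrite /d2 /d1 !(brD, brN).
rewrite (br_Jacobi A B (g C)) (br_Jacobi A C (g B)) (br_Jacobi B C (g A)).
rewrite (_ : g (br (br A B) C) = g (br A (br B C)) - g (br B (br A C))); last first.
  by rewrite (br_Jacobi A B C) -(linB lg) addrK.
rewrite (br_anti (br A C) B) (br_anti (br B C) A) !(linN lg).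
move: (br (br A B) (g C)) (br B (br A (g C))) (br (br A C) (g B)) (br C (br A (g B)))
  (br A (g (br B C))) (br (br B C) (g A)) (br C (br B (g A))) (br B (g (br A C)))
  (br C (g (br A B))) (g (br A (br B C))) (g (br B (br A C))).
by move=> *; galg_abel.
Qed.

(** Cartan's formula: the Lie derivative along [A] is d i_A + i_A d. *)
Lemma Cartan_homotopy f A B C : is_cochain2 f ->
  lie_act A f B C - d1 (f A) B C = d2 f A B C.
Proof.
move=> cf; rewrite /lie_act /d1 /d2.
rewrite (cochain2_anti (br A C) B cf) (cochain2_anti (br B C) A cf).
move: (f (br A B) C) (f B (br A C)) (f A (br B C)).
galg_gen; move=> *; galg_abel.
Qed.

Lemma d2_lie_act f A B C D : bilin f ->
  d2 (lie_act A f) B C D = br A (d2 f B C D) - d2 f (br A B) C D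
    - d2 f B (br A C) D - d2 f B C (br A D).
Proof.
move=> [lr ll]; rewrite /d2 /lie_act.
have fD A1 A2 B1 : f (A1 + A2) B1 = f A1 B1 + f A2 B1 by exact: (linD (ll B1)).
rewrite (br_Jacobi A B C) (br_Jacobi A B D) (br_Jacobi A C D) !fD !(brD, brN).
rewrite (br_Jacobi A B (f C D)) (br_Jacobi A C (f B D)) (br_Jacobi A D (f B C)).
move: (f (br (br A B) C) D) (f (br (br A B) D) C) (f (br (br A C) D) B).
move: (f (br B (br A C)) D) (f (br B (br A D)) C) (f (br C (br A D)) B).
move: (f (br B C) (br A D)) (f (br B D) (br A C)) (f (br C D) (br A B)).
galg_gen; move=> *.
galg_abel.
Qed.

End Cochains.

(** * Inner products of cochains *)

Section Solve.
Context (F : fieldType).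

(** The Fredholm alternative. It produces preimages under the codifferential and
    orthogonal projections. *)
Lemma row_solve (p q : nat) (B : 'M[F]_(p, q)) (v : 'rV[F]_q) :
  (forall w : 'cV[F]_q, B *m w = 0 -> v *m w = 0) -> exists x, v = x *m B.
Proof.
move=> kv; have : (v <= B)%MS.
  rewrite submxE; apply/eqP/matrixP => i j.
  have H : B *m (cokermx B *m delta_mx j (0 : 'I_1)) = 0.
    by rewrite mulmxA mulmx_coker mul0mx.
  by have /matrixP/(_ i 0) := kv _ H; rewrite mulmxA -colE !mxE.
by move=> /submxP[x ->]; exists x.
Qed.
End Solve.

Section Forms.
Context (R : realType) (n m : nat) (ip : galg R n m -> galg R n m -> R).
Hypothesis hip : suitable ip.
Local Notation galg := (galg R n m).
Local Notation br := (@br R n m).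
Local Notation cochain2 := (cochain2 R n m).
Local Notation cochain3 := (cochain3 R n m).
Implicit Types (A B C D : galg) (f g : cochain2).
#[local] Opaque Defs.br.

Let ipr A : linear (ip A : galg -> R^o) := ip_linr hip A.
Let ipl B : linear (ip^~ B : galg -> R^o) := ip_linl hip B.

Definition bilform (b : galg -> galg -> R) : Prop :=
  (forall A, linear (b A : galg -> R^o)) /\ (forall B, linear (b^~ B : galg -> R^o)).

Definition tr N (e : 'I_N -> galg) (b : galg -> galg -> R) : R := \sum_i b (e i) (e i).

Lemma tr_transport N N' (e : 'I_N -> galg) (e' : 'I_N' -> galg) T T' b :
  orthonormal_basis ip e -> orthonormal_basis ip e' -> bilform b ->
  (forall A B, ip (T A) B = ip A (T' B)) ->
  tr e (fun A B => b (T A) B) = tr e' (fun A B => b A (T' B)).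
Proof. by move=> he he' [b1 b2] TT; exact: (trace_transport hip he he' b1 b2 TT). Qed.

Lemma tr_basis N N' (e : 'I_N -> galg) (e' : 'I_N' -> galg) b :
  orthonormal_basis ip e -> orthonormal_basis ip e' -> bilform b -> tr e b = tr e' b.
Proof. by move=> he he' hb; exact: (@tr_transport _ _ e e' id id b he he' hb). Qed.

Lemma bilform_tr N (e : 'I_N -> galg) (c : galg -> galg -> galg -> galg -> R) :
  (forall C D, bilform (fun A B => c A B C D)) ->
  bilform (fun A B => tr e (c A B)).
Proof.
move=> bc; split=> [A t B B'|B t A A']; rewrite /tr scaler_sumr -big_split;
  apply: eq_bigr => i _; [exact: (bc _ _).1 | exact: (bc _ _).2].
Qed.

Lemma bilform_ip (f g : galg -> galg) : linear f -> linear g ->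
  bilform (fun A B => ip (f A) (g B)).
Proof.
move=> lf lg; split=> [A t B B'|B t A A']; first by rewrite lg ipr.
by rewrite lf ipl.
Qed.

Section Basis.
Variables (N : nat) (e : 'I_N -> galg).
Hypothesis he : orthonormal_basis ip e.

(** On alternating cochains, these are two and six times the inner products for which
    the codifferentials are adjoint to the differentials. *)
Definition inner2 f g : R := tr e (fun A B => tr e (fun C D => ip (f A C) (g B D))).
Definition inner3 (f g : cochain3) : R := tr e (fun A B => inner2 (f A) (g B)).

Lemma inner2_sum f g : inner2 f g = \sum_i \sum_j ip (f (e i) (e j)) (g (e i) (e j)).
Proof. by []. Qed.

Lemma inner3_sum (f g : cochain3) : inner3 f g =
  \sum_i \sum_j \sum_k ip (f (e i) (e j) (e k)) (g (e i) (e j) (e k)).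
Proof. by []. Qed.

Lemma inner2_linearl g : linear (inner2^~ g : cochain2 -> R^o).
Proof.
move=> t f f'; rewrite /inner2 /tr scaler_sumr -big_split; apply: eq_bigr => i _ /=.
rewrite scaler_sumr -big_split; apply: eq_bigr => j _; exact: ipl.
Qed.

Lemma inner2C f g : inner2 f g = inner2 g f.
Proof. by apply: eq_bigr => i _; apply: eq_bigr => j _; rewrite (ip_sym hip). Qed.

Lemma inner2_linearr f : linear (inner2 f : cochain2 -> R^o).
Proof. by move=> t g g'; rewrite !(inner2C f); apply: inner2_linearl. Qed.

Lemma inner3C (f g : cochain3) : inner3 f g = inner3 g f.
Proof. by apply: eq_bigr => i _; exact: inner2C. Qed.

Lemma bilin_eq_basis f g : bilin f -> bilin g ->
  (forall i j, f (e i) (e j) = g (e i) (e j)) -> f = g.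
Proof.
move=> [fr fl] [gr gl] fg; apply/funext => A; apply/funext => B.
apply: (linear_eq_basis he (fr A) (gr A)) => j.
by apply: (linear_eq_basis he (fl (e j)) (gl (e j))) => i.
Qed.

Lemma inner2_eq0 f : bilin f -> inner2 f f = 0 -> f = 0.
Proof.
move=> bf /eqP; rewrite inner2_sum psumr_eq0; last first.
  by move=> i _; apply: sumr_ge0 => j _; exact: (ip_ge0 hip).
move=> /allP f0.
have b0 : bilin (0 : cochain2) by split=> ? t ? ?; rewrite -[RHS]/(t *: (0 : galg) + 0) scaler0 addr0.
apply: (bilin_eq_basis bf b0) => i j; apply: (ip_eq0 hip).
have := f0 i (mem_index_enum _); rewrite /= psumr_eq0; last by move=> k _; exact: (ip_ge0 hip).
by move=> /allP/(_ j (mem_index_enum _))/eqP.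
Qed.

Lemma inner3_eq0 (f : cochain3) : inner3 f f = 0 ->
  forall i j k, f (e i) (e j) (e k) = 0.
Proof.
move=> /eqP; rewrite inner3_sum psumr_eq0; last first.
  by move=> i _; do 2!apply: sumr_ge0 => ? _; exact: (ip_ge0 hip).
move=> /allP f0 i j k; apply: (ip_eq0 hip).
have := f0 i (mem_index_enum _); rewrite /= psumr_eq0; last first.
  by move=> ? _; apply: sumr_ge0 => ? _; exact: (ip_ge0 hip).
move=> /allP/(_ j (mem_index_enum _)); rewrite /= psumr_eq0; last first.
  by move=> ? _; exact: (ip_ge0 hip).
by move=> /allP/(_ k (mem_index_enum _))/eqP.
Qed.

Lemma inner2_transportl f g T T' : bilin f -> bilin g -> linear T' ->
  (forall A B, ip (T A) B = ip A (T' B)) ->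
  inner2 (fun A C => f (T A) C) g = inner2 f (fun A C => g (T' A) C).
Proof.
move=> [fr fl] [gr gl] lT TT; rewrite /inner2.
apply: (tr_transport (b := fun A B => tr e (fun C D => ip (f A C) (g B D))) he he _ TT).
by apply: (@bilform_tr _ _ (fun A B C D => ip (f A C) (g B D))) => C D; exact: bilform_ip.
Qed.

Lemma inner2_transportr f g T T' : bilin f -> bilin g ->
  (forall A B, ip (T A) B = ip A (T' B)) ->
  inner2 (fun A C => f A (T C)) g = inner2 f (fun A C => g A (T' C)).
Proof.
move=> [fr fl] [gr gl] TT; apply: eq_bigr => i _.
apply: (tr_transport (b := fun C D => ip (f (e i) C) (g (e i) D)) he he _ TT).
exact: bilform_ip.
Qed.

End Basis.

Lemma inner2_basis N N' (e : 'I_N -> galg) (e' : 'I_N' -> galg) f g :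
  orthonormal_basis ip e -> orthonormal_basis ip e' -> bilin f -> bilin g ->
  inner2 e f g = inner2 e' f g.
Proof.
move=> he he' [fr fl] [gr gl].
transitivity (tr e' (fun A B => tr e (fun C D => ip (f A C) (g B D)))).
  apply: (tr_basis he he').
  by apply: (@bilform_tr _ _ (fun A B C D => ip (f A C) (g B D))) => C D; exact: bilform_ip.
apply: eq_bigr => i _.
by apply: (tr_basis he he'); exact: bilform_ip.
Qed.

Definition trilin (f : cochain3) :=
  (forall A, bilin (f A)) /\ forall B C, linear (fun A => f A B C).

Lemma inner3_basis N N' (e : 'I_N -> galg) (e' : 'I_N' -> galg) (f g : cochain3) :
  orthonormal_basis ip e -> orthonormal_basis ip e' -> trilin f -> trilin g ->
  inner3 e f g = inner3 e' f g.
Proof.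
move=> he he' [fb f1] [gb g1].
transitivity (tr e' (fun A B => inner2 e (f A) (g B))).
  apply: (tr_basis he he').
  apply: (@bilform_tr _ _ (fun A B C D => tr e (fun C' D' => ip (f A C C') (g B D D')))) => C D.
  by apply: (@bilform_tr _ _ (fun A B C' D' => ip (f A C C') (g B D D'))) => C' D'; exact: bilform_ip.
by apply: eq_bigr => i _; exact: inner2_basis.
Qed.

End Forms.

(** * The image and the kernel of the codifferential *)

Section FormSolve.
Context (R : realType) (V : lmodType R).

Definition comb K (b : 'I_K -> V) (w : 'rV[R]_K) : V := \sum_i w 0 i *: b i.

Lemma comb_linear K (b : 'I_K -> V) : linear (comb b).
Proof.
move=> t u v; rewrite /comb scaler_sumr -big_split; apply: eq_bigr => i _ /=.
by rewrite !mxE scalerDl scalerA.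
Qed.

Lemma comb_delta K (b : 'I_K -> V) i : comb b (delta_mx 0 i) = b i.
Proof.
rewrite /comb (bigD1 i) //= mxE !eqxx scale1r big1 ?addr0 // => j ji.
by rewrite mxE eqxx (negPf ji) scale0r.
Qed.

Lemma comb_comb K K' (b : 'I_K -> V) (z : 'I_K' -> 'rV[R]_K) (u : 'rV[R]_K') :
  comb b (\sum_l u 0 l *: z l) = comb (fun l => comb b (z l)) u.
Proof.
rewrite (lin_sum (comb_linear b)); apply: eq_bigr => l _.
exact: (linZ (comb_linear b)).
Qed.

Lemma subspace_comb (S : set V) K (b : 'I_K -> V) w : S 0 ->
  (forall t u v, S u -> S v -> S (t *: u + v)) -> (forall i, S (b i)) -> S (comb b w).
Proof.
move=> S0 SL Sb; rewrite /comb; elim/big_rec: _ => // i v _; exact: SL.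
Qed.

Section Family.
Variables (K : nat) (b : 'I_K -> V) (beta : V -> V -> R).
Hypothesis beta_linr : forall u, linear (beta u : V -> R^o).
Hypothesis beta_linl : forall v, linear (beta^~ v : V -> R^o).

Let B := \matrix_(i, j) beta (b i) (b j).

Lemma beta_comb u w : beta (comb b u) (comb b w) = (u *m B *m w^T) 0 0.
Proof.
rewrite (lin_sum (beta_linr _)) mxE; apply: eq_bigr => j _.
rewrite (linZ (beta_linr _)) (lin_sum (beta_linl _)) !mxE -[LHS]/(_ * _) mulrC.
by congr (_ * _); apply: eq_bigr => i _; rewrite (linZ (beta_linl _)) !mxE.
Qed.

(** The condition asks that [phi] vanishes on isotropic vectors, in particular on the
    radical of [beta]; for the semidefinite forms considered below, both coincide. *)
Lemma form_solve (phi : V -> R) : linear (phi : V -> R^o) ->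
  (forall w, beta (comb b w) (comb b w) = 0 -> phi (comb b w) = 0) ->
  exists x, forall w, phi (comb b w) = beta (comb b x) (comb b w).
Proof.
move=> lphi phi0.
have phiE w : phi (comb b w) = ((\row_j phi (b j)) *m w^T) 0 0.
  rewrite (lin_sum lphi) mxE; apply: eq_bigr => j _.
  by rewrite (linZ lphi) !mxE -[LHS]/(_ * _) mulrC.
have [|x xE] := @row_solve _ _ _ B (\row_j phi (b j)).
  move=> w Bw; apply/matrixP => i j; rewrite !ord1 -{1}[w]trmxK -phiE mxE.
  by apply: phi0; rewrite beta_comb trmxK -mulmxA Bw mulmx0 mxE.
by exists x => w; rewrite phiE beta_comb xE.
Qed.

(** The radical is again finitely spanned; for the form (d f, d g) it consists of the
    cocycles. *)
Lemma kernel_family : exists K' (z : 'I_K' -> 'rV[R]_K),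
  (forall l w, beta (comb b (z l)) (comb b w) = 0) /\
  forall w, (forall i, beta (comb b w) (b i) = 0) -> exists u : 'rV[R]_K', w = \sum_l u 0 l *: z l.
Proof.
exists K, (fun l => row l (kermx B)); split=> [l w|w w0].
  by rewrite beta_comb -row_mul mulmx_ker row0 mul0mx mxE.
have : (w <= kermx B)%MS.
  apply/sub_kermxP/rowP => i; have := w0 i.
  by rewrite -{1}(comb_delta b i) beta_comb trmx_delta -colE mxE => ->; rewrite mxE.
by move=> /submxP[u ->]; exists u; rewrite mulmx_sum_row.
Qed.

End Family.
End FormSolve.

Section Codifferential.
Context (R : realType) (n m : nat) (ip : galg R n m -> galg R n m -> R).
Hypothesis hip : suitable ip.
Local Notation galg := (galg R n m).
Local Notation br := (@br R n m).
Local Notation cochain2 := (cochain2 R n m).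
Local Notation cochain3 := (cochain3 R n m).
Local Notation negpart := (@negpart R n m).
Implicit Types (A B C D : galg) (f g : cochain2).
#[local] Opaque Defs.br.

Let npl : linear negpart := @negpart_linear R n m.

Lemma d2_trilin f : bilin f -> trilin (d2 f).
Proof.
move=> bf; split=> [A|B C]; last exact: d2_lin1.
by split=> [B|C]; [exact: d2_lin3 | exact: d2_lin2].
Qed.

Lemma cochain3_trilin (c : cochain3) : is_cochain3 c -> trilin c.
Proof. by case=> c2 c1 _; split=> // A; apply: cochain2_bilin. Qed.

Lemma d2_cochain3 f : is_cochain2 f -> is_cochain3 (d2 f).
Proof.
move=> cf; have bf := cochain2_bilin cf; split.
- move=> A; split=> [B|C|B]; [exact: d2_lin3 | exact: d2_lin2 | exact: d2_alt23].
- by move=> B C; exact: d2_lin1.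
- by move=> A C; exact: d2_alt12.
Qed.

Lemma cochain3_anti12 (c : cochain3) A B C : is_cochain3 c -> c A B C = - c B A C.
Proof.
move=> [c2 c1 alt]; apply: (@cochain2_anti _ _ _ (fun A B => c A B C)).
by split=> [A'|B'|A']; [have [_ /(_ C)] := c2 A' | exact: c1 | exact: alt].
Qed.

Lemma cochain3_anti23 (c : cochain3) A B C : is_cochain3 c -> c A B C = - c A C B.
Proof. by move=> [c2 _ _]; exact: cochain2_anti. Qed.

Definition restrict3 (c : cochain3) : cochain3 :=
  fun A B C => c (negpart A) (negpart B) (negpart C).

Lemma hor3_restrict (c : cochain3) : hor3 c -> c = restrict3 c.
Proof.
move=> [cc hc]; have [c2 c1 alt] := cc.
have h1 A B C : c A B C = c (negpart A) B C.
  apply/eqP; rewrite -subr_eq0 -(linB (c1 B C)) hc //; exact: gp_sub_negpart.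
have h2 A B C : c A B C = c A (negpart B) C.
  by rewrite (cochain3_anti12 A B C cc) h1 -(cochain3_anti12 A _ C cc).
have h3 A B C : c A B C = c A B (negpart C).
  by rewrite (cochain3_anti23 A B C cc) h2 -(cochain3_anti23 A B _ cc).
by apply/funext => A; apply/funext => B; apply/funext => C; rewrite h1 h2 h3.
Qed.

Lemma restrict3_hor3 (c : cochain3) : is_cochain3 c -> hor3 (restrict3 c).
Proof.
move=> [c2 c1 alt]; split; first split.
- move=> A; have [cr cl ca] := c2 (negpart A).
  split=> [B t C C'|C t B B'|B]; rewrite /restrict3 ?npl ?cr ?cl //.
- by move=> B C t A A'; rewrite /restrict3 npl c1.
- by move=> A B; exact: alt.
by move=> A B C /gpP A0; rewrite /restrict3 A0 (lin0 (c1 _ _)).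
Qed.

(** The differential of cochains of g_- with values in g, such cochains being
    extended by zero along p. *)
Definition dneg f : cochain3 := restrict3 (d2 f).

Lemma dneg_linear : linear dneg.
Proof.
move=> t f g; apply/funext => A; apply/funext => B; apply/funext => C.
exact: d2_linear.
Qed.

(** As g_- is a subalgebra, [d2 f] on g_- only depends on the values of [f] on
    g_-. *)
Lemma dneg_restrict2 f : dneg (restrict2 f) = dneg f.
Proof.
apply/funext => A; apply/funext => B; apply/funext => C.
have nb A' B' : negpart (br (negpart A') (negpart B')) = br (negpart A') (negpart B').
  by apply/gnegP/gneg_br; exact: gneg_negpart.
by rewrite /dneg /restrict3 /d2 /restrict2 !negpart_id !nb.
Qed.

Lemma Z2P f : Z2 f <-> hor2 f /\ dneg f = 0.
Proof.
split=> [[hf f0]|[hf f0]]; split=> //.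
  apply/funext => A; apply/funext => B; apply/funext => C.
  by rewrite /dneg /restrict3 f0 //; exact: gneg_negpart.
move=> A B C /gnegP nA /gnegP nB /gnegP nC.
by rewrite -nA -nB -nC -[LHS]/(dneg f A B C) f0.
Qed.

Lemma Z2_linear t f g : Z2 f -> Z2 g -> Z2 (t *: f + g).
Proof.
move=> /Z2P[hf f0] /Z2P[hg g0]; apply/Z2P; split; first exact: hor2_linear.
apply/funext => A; apply/funext => B; apply/funext => C.
have E := d2_linear t f g (negpart A) (negpart B) (negpart C).
rewrite /dneg /restrict3 E -[d2 f _ _ _]/(dneg f A B C) f0 -[d2 g _ _ _]/(dneg g A B C) g0.
by rewrite scaler0 addr0.
Qed.

Lemma hor2_bilin f : hor2 f -> bilin f.
Proof. by case=> cf _; exact: cochain2_bilin. Qed.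

Lemma hor2_comb K (b : 'I_K -> cochain2) w : (forall i, hor2 (b i)) -> hor2 (comb b w).
Proof.
by move=> hb; apply: (subspace_comb (S := @hor2 R n m) _ _ _ hb); [exact: hor2_0 | exact: hor2_linear].
Qed.

Section Basis.
Variables (N : nat) (e : 'I_N -> galg).
Hypothesis he : orthonormal_basis ip e.
Local Notation inner2 := (inner2 ip e).
Local Notation inner3 := (inner3 ip e).

(** Horizontal cochains only see g_-, because the projection onto g_- is
    self-adjoint. *)
Lemma inner2_restrict f g : hor2 f -> bilin g -> inner2 f g = inner2 f (restrict2 g).
Proof.
move=> hf bg; have bf := hor2_bilin hf; have [gr gl] := bg.
have fE : f = fun A B => f (negpart A) (negpart B).
  by apply/funext => A; apply/funext => B; exact: hor2_negpart.
have adj A B : ip (negpart A) B = ip A (negpart B) by exact: ip_negpart.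
rewrite {1}fE.
transitivity (inner2 (fun A B => f A (negpart B)) (fun A B => g (negpart A) B)).
  apply: (inner2_transportl hip he _ bg npl adj (f := fun A B => f A (negpart B))).
  by have [fr fl] := bf; split=> [A t B C|B t A C]; rewrite ?npl ?fr ?fl.
apply: (inner2_transportr hip he bf _ adj (g := fun A B => g (negpart A) B)).
by split=> [A t B C|B t A C]; rewrite ?npl ?gr ?gl.
Qed.

Lemma inner3_restrict (c T : cochain3) : hor3 c -> trilin T ->
  inner3 c T = inner3 c (restrict3 T).
Proof.
move=> hc [Tb T1]; have [cc _] := hc; have [cb c1] := cochain3_trilin cc.
have cE := hor3_restrict hc.
have adj A B : ip (negpart A) B = ip A (negpart B) by exact: ip_negpart.
transitivity (tr e (fun A B => inner2 (c (negpart A)) (T B))).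
  apply: eq_bigr => i _; congr (inner2 _ _).
  by apply/funext => B; apply/funext => C; rewrite [in LHS]cE [in RHS]cE.
transitivity (tr e (fun A B => inner2 (c A) (T (negpart B)))).
  apply: (tr_transport hip he he (b := fun A B => inner2 (c A) (T B)) _ adj).
  apply: (@bilform_tr _ _ _ _ _ (fun A B C D => tr e (fun C' D' => ip (c A C C') (T B D D')))) => C D.
  by apply: (@bilform_tr _ _ _ _ _ (fun A B C' D' => ip (c A C C') (T B D D'))) => C' D'; exact: bilform_ip.
apply: eq_bigr => i _; rewrite inner2_restrict //.
split; first by have [c2 _ _] := cc.
move=> A B pA; rewrite (cochain3_anti12 _ _ _ cc); have [_ ->] := hc => //.
by rewrite oppr0.
Qed.

End Basis.
End Codifferential.

Section Hodge.
Context (R : realType) (n m : nat) (ip : galg R n m -> galg R n m -> R).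
Hypothesis hip : suitable ip.
Local Notation galg := (galg R n m).
Local Notation br := (@br R n m).
Local Notation cochain1 := (cochain1 R n m).
Local Notation cochain2 := (cochain2 R n m).
Local Notation cochain3 := (cochain3 R n m).
Local Notation negpart := (@negpart R n m).
Implicit Types (A B C D : galg) (f g : cochain2).
#[local] Opaque Defs.br.

Let npl : linear negpart := @negpart_linear R n m.
Let ipr A : linear (ip A : galg -> R^o) := ip_linr hip A.
Let ipl B : linear (ip^~ B : galg -> R^o) := ip_linl hip B.

Lemma inner2_ordered N (e : 'I_N -> galg) f g : is_cochain2 f -> is_cochain2 g ->
  inner2 ip e f g = 2 * \sum_(i < N) \sum_(j < N | (i < j)%N) ip (f (e i) (e j)) (g (e i) (e j)).
Proof.
move=> cf cg; rewrite inner2_sum.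
apply: (ordered_sum2 (F := fun i j => ip (f (e i) (e j)) (g (e i) (e j)))) => [i j|i].
  by rewrite (cochain2_anti (e i) _ cf) (cochain2_anti (e i) _ cg) (linN (ipr _)) (linN (ipl _)) opprK.
by have [_ _ ->] := cf; rewrite (lin0 (ipl _)).
Qed.

Lemma inner3_ordered N (e : 'I_N -> galg) (f g : cochain3) : is_cochain3 f -> is_cochain3 g ->
  inner3 ip e f g = 6 * \sum_(i < N) \sum_(j < N | (i < j)%N) \sum_(k < N | (j < k)%N)
    ip (f (e i) (e j) (e k)) (g (e i) (e j) (e k)).
Proof.
move=> cf cg; rewrite inner3_sum.
apply: (ordered_sum3 (F := fun i j k => ip (f (e i) (e j) (e k)) (g (e i) (e j) (e k)))) => [i j k|i j k|i j].
- rewrite (cochain3_anti12 (e i) _ _ cf) (cochain3_anti12 (e i) _ _ cg).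
  by rewrite (linN (ipr _)) (linN (ipl _)) opprK.
- rewrite (cochain3_anti23 (e i) (e j) _ cf) (cochain3_anti23 (e i) (e j) _ cg).
  by rewrite (linN (ipr _)) (linN (ipl _)) opprK.
- by have [_ _ ->] := cf; rewrite (lin0 (ipl _)).
Qed.

Section Basis.
Variables (N : nat) (e : 'I_N -> galg).
Hypothesis he : orthonormal_basis ip e.
Local Notation inner2 := (inner2 ip e).
Local Notation inner3 := (inner3 ip e).

Let in2l g : linear (inner2^~ g : cochain2 -> R^o) := inner2_linearl hip e g.
Let in2r f : linear (inner2 f : cochain2 -> R^o) := inner2_linearr hip e f.

Lemma inner3_linearl (g : cochain3) : linear (inner3^~ g : cochain3 -> R^o).
Proof.
move=> t f f'; rewrite /inner3 /tr scaler_sumr -big_split; apply: eq_bigr => i _ /=.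
exact: (inner2_linearl hip e (g (e i)) t (f (e i)) (f' (e i))).
Qed.

Lemma inner3_linearr (f : cochain3) : linear (inner3 f : cochain3 -> R^o).
Proof. by move=> t g g'; rewrite !(inner3C hip e f); exact: inner3_linearl. Qed.

(** The alternating 2-forms of the dual basis, restricted to g_-, with values in the
    basis; they span the horizontal cochains. *)
Definition elementary (i j k : 'I_N) : cochain2 := fun A B =>
  (ip (negpart A) (e i) * ip (negpart B) (e j)
   - ip (negpart A) (e j) * ip (negpart B) (e i)) *: e k.

Lemma elementary_hor i j k : hor2 (elementary i j k).
Proof.
have L t A A' l : ip (negpart (t *: A + A')) (e l) = t * ip (negpart A) (e l) + ip (negpart A') (e l).
  by rewrite npl ipl.
apply: hor2P => [|A B]; last by rewrite /elementary !negpart_id.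
split=> [A t B B'|B t A A'|A]; rewrite /elementary ?L.
- rewrite scalerA -scalerDl; congr (_ *: _); ring.
- rewrite scalerA -scalerDl; congr (_ *: _); ring.
- by rewrite mulrC subrr scale0r.
Qed.

Let I : finType := ('I_N * 'I_N * 'I_N)%type.
Definition elem_family (a : 'I_#|I|) : cochain2 :=
  elementary (enum_val a).1.1 (enum_val a).1.2 (enum_val a).2.
Local Notation b := elem_family.

Lemma hor2_spanned f : hor2 f -> exists w, f = comb b w.
Proof.
move=> hf; have [[fr fl _] _] := hf; have [cf _] := hf.
(* the half makes up for the pairs i, j and j, i giving opposite forms *)
exists (\row_a (2^-1 * ip (f (e (enum_val a).1.1) (e (enum_val a).1.2)) (e (enum_val a).2))).
apply/funext => A; apply/funext => B.
pose c i j := ip (negpart A) (e i) * ip (negpart B) (e j).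
have fE : f A B = \sum_i \sum_j c i j *: f (e i) (e j).
  rewrite (hor2_negpart _ _ hf) {1}(basis_sum he (negpart A)) (lin_sum (fl _)).
  apply: eq_bigr => i _; rewrite (linZ (fl _)) {1}(basis_sum he (negpart B)) (lin_sum (fr _)).
  by rewrite scaler_sumr; apply: eq_bigr => j _; rewrite (linZ (fr _)) scalerA.
have -> : comb b (\row_a (2^-1 * ip (f (e (enum_val a).1.1) (e (enum_val a).1.2)) (e (enum_val a).2))) A B
    = \sum_i \sum_j \sum_k (2^-1 * ip (f (e i) (e j)) (e k)) *: elementary i j k A B.
  rewrite pair_big pair_big /= (reindex (fun a : 'I_#|I| => enum_val a)) /=; last first.
    exact/onW_bij/enum_val_bij.
  rewrite /comb !fct_sumE; apply: eq_bigr => a _; by rewrite !mxE.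
have -> : \sum_i \sum_j \sum_k (2^-1 * ip (f (e i) (e j)) (e k)) *: elementary i j k A B
    = \sum_i \sum_j (2^-1 * (c i j - c j i)) *: f (e i) (e j).
  apply: eq_bigr => i _; apply: eq_bigr => j _.
  rewrite [f (e i) (e j) in RHS](basis_sum he) scaler_sumr; apply: eq_bigr => k _.
  rewrite /elementary !scalerA; congr (_ *: _); rewrite /c; ring.
rewrite fE; under [RHS]eq_bigr => i _ do under eq_bigr => j _ do rewrite mulrBr scalerBl.
under [RHS]eq_bigr => i _ do rewrite sumrB.
rewrite sumrB [X in _ = _ - X]exchange_big /= -sumrB; apply: eq_bigr => i _.
rewrite -sumrB; apply: eq_bigr => j _.
rewrite (cochain2_anti (e j) (e i) cf) scalerN opprK -scalerDl; congr (_ *: _).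
by field.
Qed.

(** The codifferential is adjoint to the differential, and [inner2_basis] makes the
    condition independent of the orthonormal basis. *)
Lemma ker_codiffP f : ker_codiff ip f <->
  hor2 f /\ forall g : cochain1, is_cochain1 g -> inner2 f (d1 g) = 0.
Proof.
have sum0 N' (e' : 'I_N' -> galg) (g : cochain1) : \sum_i ip (0 : galg) (g (e' i)) = 0.
  by rewrite big1 // => i _; rewrite (lin0 (ipl _)).
split=> [[hf _ H]|[hf H]]; split=> //.
- move=> g lg; have [cf _] := hf; rewrite inner2_ordered //; last exact: d1_cochain2.
  by rewrite -(H N e he g lg) sum0 mulr0.
- by split=> // t A B; rewrite scaler0 addr0.
move=> N' e' he' g lg; rewrite sum0; have [cf _] := hf.
have cg := d1_cochain2 lg; have := H g lg.
rewrite (inner2_basis hip he he' (cochain2_bilin cf) (cochain2_bilin cg)) inner2_ordered //.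
by move=> /eqP; rewrite mulf_eq0 pnatr_eq0 /= => /eqP->.
Qed.

Let beta f g : R := inner3 (dneg f) (dneg g).
Let betar f : linear (beta f : cochain2 -> R^o).
Proof. by move=> t g g'; rewrite /beta dneg_linear inner3_linearr. Qed.
Let betal g : linear (beta^~ g : cochain2 -> R^o).
Proof. by move=> t f f'; rewrite /beta dneg_linear inner3_linearl. Qed.

Lemma dneg_eq0 f : is_cochain2 f -> beta f f = 0 -> dneg f = 0.
Proof.
move=> cf /(inner3_eq0 hip) f0.
have [bd1 bd2] := cochain3_trilin (restrict3_hor3 (d2_cochain3 cf)).1.
apply/funext => A; apply/funext => B; apply/funext => C.
have L0 : linear (fun _ : galg => 0 : galg) by move=> t ? ?; rewrite scaler0 addr0.
apply: (linear_eq_basis he (bd2 B C) L0) => i.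
apply: (linear_eq_basis he ((bd1 (e i)).2 C) L0) => j.
by apply: (linear_eq_basis he ((bd1 (e i)).1 (e j)) L0) => k; exact: f0.
Qed.

Lemma Z2_beta f : hor2 f -> beta f f = 0 -> Z2 f.
Proof. by move=> hf f0; apply/Z2P; split=> //; apply: dneg_eq0 => //; case: hf. Qed.

Let b_hor a : hor2 (b a). Proof. exact: elementary_hor. Qed.

(** The image of the codifferential is the orthogonal complement of the
    cocycles: the equation d* (d q) = f is solvable as soon as f kills the
    kernel of the form (d q, d g), and d* c is automatically horizontal because
    d g on g_- only depends on the values of g on g_-. *)
Lemma im_codiffP f : im_codiff ip f <-> hor2 f /\ forall z, Z2 z -> inner2 f z = 0.
Proof.
split=> [[c [hc hf H]]|[hf H]].
  split=> // z /Z2P[hz z0]; have [cc _] := hc; have [cz _] := hz; have [cf _] := hf.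
  rewrite inner2_ordered // (H N e he z cz).
  have := inner3_ordered e cc (d2_cochain3 cz).
  rewrite (inner3_restrict hip he hc (d2_trilin (cochain2_bilin cz))) -/(dneg z) z0.
  have -> : inner3 c 0 = 0 by rewrite inner3_sum; do 3!rewrite big1 // => ? _; exact: (lin0 (ipr _)).
  move=> /eqP; rewrite eq_sym mulf_eq0 pnatr_eq0 /= => /eqP->.
  by rewrite mulr0.
(* 3 is the ratio of the normalizations of inner3 and inner2 *)
have [|x xE] := form_solve (b := b) betar betal (phi := inner2 (3 *: f)) (in2r (3 *: f)).
  move=> w /(Z2_beta (hor2_comb w b_hor)) Zw.
  by rewrite (linZ (in2l _)) H //; exact: scaler0.
have hx : hor2 (comb b x) := hor2_comb x b_hor.
have hd : hor3 (dneg (comb b x)).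
  by apply: restrict3_hor3; apply: d2_cochain3; case: hx.
exists (dneg (comb b x)); split=> // N' e' he' g cg.
have [cf _] := hf; have [cc _] := hd.
have E : inner3 (dneg (comb b x)) (d2 g) = 3 * inner2 f g.
  rewrite (inner3_restrict hip he hd (d2_trilin (cochain2_bilin cg))) -/(dneg g).
  have [w gw] := hor2_spanned (restrict2_hor cg).
  rewrite -(dneg_restrict2 g) gw -[LHS]/(beta _ _) -xE -gw (linZ (in2l _)).
  by rewrite -inner2_restrict //; exact: cochain2_bilin.
have e2 := inner2_ordered e' cf cg.
rewrite -(inner2_basis hip he he' (cochain2_bilin cf) (cochain2_bilin cg)) in e2.
have e3 := inner3_ordered e' cc (d2_cochain3 cg).
rewrite -(inner3_basis hip he he' (cochain3_trilin cc) (d2_trilin (cochain2_bilin cg))) in e3.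
rewrite E e2 mulrA in e3.
have six : 3 * 2 = 6 :> R by ring.
by rewrite six in e3; apply: (mulfI _ e3); rewrite pnatr_eq0.
Qed.

End Basis.
End Hodge.

(** * Harmonic representatives *)

Section Harmonic.
Context (R : realType) (n m : nat) (ip : galg R n m -> galg R n m -> R).
Hypothesis hip : suitable ip.
Local Notation galg := (galg R n m).
Local Notation br := (@br R n m).
Local Notation gX := (gX R n m).
Local Notation gY := (gY R n m).
Local Notation cochain1 := (cochain1 R n m).
Local Notation cochain2 := (cochain2 R n m).
Local Notation negpart := (@negpart R n m).
Implicit Types (A B C D : galg) (f g : cochain2).
#[local] Opaque Defs.br.

Let ipr A : linear (ip A : galg -> R^o) := ip_linr hip A.
Let ipl B : linear (ip^~ B : galg -> R^o) := ip_linl hip B.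
Let brr A : linear (br A) := @br_linearr R n m A.
Let brl B : linear (br^~ B) := @br_linearl R n m B.

Lemma ker_hor2 f : ker_codiff ip f -> hor2 f. Proof. by case. Qed.

Lemma Z2_hor2 f : Z2 f -> hor2 f. Proof. by case. Qed.

Lemma Z2_0 : Z2 (0 : cochain2).
Proof.
split=> [|A B C _ _ _]; first exact: hor2_0.
have z A' : br A' 0 = 0 by exact: (lin0 (brr A')).
have E A' B' : (0 : cochain2) A' B' = 0 by [].
by rewrite /d2 !E !z !(subr0, addr0).
Qed.

Lemma B2_0 : B2 (0 : cochain2).
Proof.
split; first exact: hor2_0.
exists (fun=> 0) => [|B C _ _]; first by split => // t B C; rewrite scaler0 addr0.
by rewrite /d1 !(lin0 (brr _)) !subr0.
Qed.

Section Basis.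
Variables (N : nat) (e : 'I_N -> galg).
Hypothesis he : orthonormal_basis ip e.
Local Notation inner2 := (inner2 ip e).

Let in2l g : linear (inner2^~ g : cochain2 -> R^o) := inner2_linearl hip e g.
Let in2r f : linear (inner2 f : cochain2 -> R^o) := inner2_linearr hip e f.

Lemma im_codiff_linear t f g : im_codiff ip f -> im_codiff ip g -> im_codiff ip (t *: f + g).
Proof.
move=> /(im_codiffP hip he)[hf f0] /(im_codiffP hip he)[hg g0].
apply/(im_codiffP hip he); split; first exact: hor2_linear.
by move=> z Zz; rewrite in2l f0 // g0 // scaler0 addr0.
Qed.

Lemma im_codiff0 : im_codiff ip (0 : cochain2).
Proof.
apply/(im_codiffP hip he); split; first exact: hor2_0.
move=> z _; rewrite inner2_sum; do 2!rewrite big1 // => ? _; exact: (lin0 (ipl _)).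
Qed.

(** Such a cochain is orthogonal to itself. *)
Lemma im_Z2_eq0 f : im_codiff ip f -> Z2 f -> f = 0.
Proof.
move=> /(im_codiffP hip he)[hf f0] Zf; apply: (inner2_eq0 hip he); last exact: f0.
exact: hor2_bilin.
Qed.

Lemma d1_restrict_Z2 (g : cochain1) : is_cochain1 g -> Z2 (restrict2 (d1 g)).
Proof.
move=> lg; apply/Z2P; split; first exact/restrict2_hor/d1_cochain2.
rewrite dneg_restrict2; apply/funext => A; apply/funext => B; apply/funext => C.
exact: d2_d1.
Qed.

Lemma im_ker f : im_codiff ip f -> ker_codiff ip f.
Proof.
move=> /(im_codiffP hip he)[hf f0]; apply/(ker_codiffP hip he); split=> // g lg.
rewrite (inner2_restrict hip he hf (cochain2_bilin (d1_cochain2 lg))).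
exact/f0/d1_restrict_Z2.
Qed.

Lemma ker_linear t f g : ker_codiff ip f -> ker_codiff ip g -> ker_codiff ip (t *: f + g).
Proof.
move=> /(ker_codiffP hip he)[hf f0] /(ker_codiffP hip he)[hg g0].
apply/(ker_codiffP hip he); split; first exact: hor2_linear.
by move=> c lc; rewrite in2l f0 // g0 // scaler0 addr0.
Qed.

Lemma Z2_spanned : exists K (z : 'I_K -> cochain2), (forall l, Z2 (z l)) /\
  forall f, Z2 f -> exists u, f = comb z u.
Proof.
pose beta f g : R := inner3 ip e (dneg f) (dneg g).
have betar f : linear (beta f : cochain2 -> R^o).
  by move=> t g g'; rewrite /beta dneg_linear (inner3_linearr hip).
have betal g : linear (beta^~ g : cochain2 -> R^o).
  by move=> t f f'; rewrite /beta dneg_linear (inner3_linearl hip).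
pose b := @elem_family R n m ip N e.
have b_hor a : hor2 (b a) by exact: elementary_hor.
have [K [z [z0 zs]]] := kernel_family b betar betal.
exists K, (fun l => comb b (z l)); split.
  by move=> l; apply: (Z2_beta hip he (hor2_comb _ b_hor)); exact: z0.
move=> f /Z2P[hf f0]; have [w fw] := hor2_spanned he hf.
have [|u wu] := zs w.
  move=> i; rewrite -fw /beta f0 inner3_sum.
  by do 3!rewrite big1 // => ? _; exact: (lin0 (ipl _)).
by exists u; rewrite fw wu comb_comb.
Qed.

(** The representative [h] is the orthogonal projection of [f] onto the cocycles:
    then [f - h] is orthogonal to the cocycles, that is, in the image of the
    codifferential. *)
Lemma harmonic_rep_exists f : ker_codiff ip f -> exists h, harmonic_rep ip f h.
Proof.
move=> kf; have hf := ker_hor2 kf; have [K [z [zZ zs]]] := Z2_spanned.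
have Zc w : Z2 (comb z w).
  by apply: (subspace_comb (S := @Z2 R n m) _ _ _ zZ); [exact: Z2_0 | exact: Z2_linear].
have [|x xE] := form_solve (b := z) in2r in2l (phi := inner2 f) (in2r f).
  move=> w w0; have := inner2_eq0 hip he (hor2_bilin (Z2_hor2 (Zc w))) w0 => ->.
  by rewrite inner2_sum; do 2!rewrite big1 // => ? _; exact: (lin0 (ipr _)).
exists (comb z x).
have imd : im_codiff ip (f - comb z x).
  apply/(im_codiffP hip he); split.
    rewrite addrC -scaleN1r; exact: (hor2_linear (-1) (Z2_hor2 (Zc x)) hf).
  by move=> c /zs[u ->]; rewrite (linB (in2l _)) xE subrr.
split=> //.
have -> : comb z x = (-1) *: (f - comb z x) + f by rewrite scaleN1r opprB subrK.
exact: (ker_linear _ (im_ker imd) kf).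
Qed.

(** On g_- such a cochain is a coboundary, and it is orthogonal to coboundaries. *)
Lemma harmonic_B2 f : ker_codiff ip f -> B2 f -> f = 0.
Proof.
move=> /(ker_codiffP hip he)[hf f0] [_ [g [lg _] fg]].
apply: (inner2_eq0 hip he); first exact: hor2_bilin.
rewrite (inner2_restrict hip he hf (hor2_bilin hf)).
have -> : restrict2 f = restrict2 (d1 g).
  apply/funext => A; apply/funext => B; apply: fg; exact: gneg_negpart.
rewrite -(inner2_restrict hip he hf (cochain2_bilin (d1_cochain2 lg))); exact: f0.
Qed.

Lemma lie_act_cochain2 A f : is_cochain2 f -> is_cochain2 (lie_act A f).
Proof.
move=> cf; have [fr fl fa] := cf; split.
- move=> B t C C'; rewrite /lie_act !fr !brr !fr.
  move: (br A (f B C)) (br A (f B C')) (f (br A B) C) (f (br A B) C') (f B (br A C)) (f B (br A C')).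
  by move=> *; galg_abel.
- move=> C t B B'; rewrite /lie_act !fl !brr !fl.
  move: (br A (f B C)) (br A (f B' C)) (f (br A B) C) (f (br A B') C) (f B (br A C)) (f B' (br A C)).
  by move=> *; galg_abel.
- by move=> B; rewrite /lie_act fa (lin0 (brr A)) (cochain2_anti _ B cf) sub0r opprK subrr.
Qed.

Lemma lie_act_hor2 A f : gp A -> hor2 f -> hor2 (lie_act A f).
Proof.
move=> pA [cf hf]; split; first exact: lie_act_cochain2.
move=> B C pB; rewrite /lie_act !hf //; last exact: gp_br.
by rewrite (lin0 (brr A)) !subr0.
Qed.

Lemma lie_act_linear A t f g : lie_act A (t *: f + g) = t *: lie_act A f + lie_act A g.
Proof.
apply/funext => B; apply/funext => C.
have E B' C' : (t *: f + g) B' C' = t *: f B' C' + g B' C' by [].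
rewrite -[RHS]/(t *: lie_act A f B C + lie_act A g B C) /lie_act !E brr.
move: (br A (f B C)) (br A (g B C)) (f (br A B) C) (g (br A B) C) (f B (br A C)) (g B (br A C)).
by move=> *; galg_abel.
Qed.

Lemma lie_act_linear_l t A A' f : bilin f ->
  lie_act (t *: A + A') f = t *: lie_act A f + lie_act A' f.
Proof.
move=> [fr fl]; apply/funext => B; apply/funext => C.
rewrite -[RHS]/(t *: lie_act A f B C + lie_act A' f B C) /lie_act !brl fr fl.
move: (br A (f B C)) (br A' (f B C)) (f (br A B) C) (f (br A' B) C) (f B (br A C)) (f B (br A' C)).
by move=> *; galg_abel.
Qed.

Lemma lie_act_adjoint A f g : A.2 = 0 -> bilin f -> bilin g ->
  inner2 (lie_act A f) g = inner2 f (lie_act (gtr A) g).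
Proof.
move=> A0 bf bg.
have adj B C : ip (br A B) C = ip B (br (gtr A) C) by exact: (ip_ad hip).
have e1 : inner2 (fun B C => f (br A B) C) g = inner2 f (fun B C => g (br (gtr A) B) C).
  by apply: (inner2_transportl hip he bf bg (brr (gtr A))).
have e2 : inner2 (fun B C => f B (br A C)) g = inner2 f (fun B C => g B (br (gtr A) C)).
  by apply: (inner2_transportr hip he bf bg).
have e3 : inner2 (fun B C => br A (f B C)) g = inner2 f (fun B C => br (gtr A) (g B C)).
  by rewrite !inner2_sum; apply: eq_bigr => i _; apply: eq_bigr => j _; rewrite adj.
have -> : lie_act A f = (fun B C => br A (f B C)) - (fun B C => f (br A B) C) - (fun B C => f B (br A C)).
  by [].
have -> : lie_act (gtr A) g = (fun B C => br (gtr A) (g B C)) - (fun B C => g (br (gtr A) B) C)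
    - (fun B C => g B (br (gtr A) C)).
  by [].
by rewrite !(linB (in2l _)) !(linB (in2r _)) e1 e2 e3.
Qed.

Lemma lie_act_Z2 A f : grade 0 A -> Z2 f -> Z2 (lie_act A f).
Proof.
move=> A0 [hf f0]; split; first exact: lie_act_hor2 (grade0_gp A0) hf.
move=> B C D nB nC nD; rewrite d2_lie_act; last exact: hor2_bilin.
have nA E : gneg E -> gneg (br A E) by exact: grade0_gneg.
rewrite !f0 //; try exact: nA.
by rewrite (lin0 (brr A)) !subr0.
Qed.

(** The image is the orthogonal complement of the cocycles, which the transpose of
    [A], again in g_0, preserves. *)
Lemma lie_act_im A f : grade 0 A -> im_codiff ip f -> im_codiff ip (lie_act A f).
Proof.
move=> A0 /(im_codiffP hip he)[hf f0]; apply/(im_codiffP hip he).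
split; first exact: lie_act_hor2 (grade0_gp A0) hf.
move=> z Zz; have [_ _ v0] := grade0E A0.
rewrite lie_act_adjoint //; try exact: hor2_bilin; last exact: hor2_bilin (Z2_hor2 Zz).
by apply/f0/lie_act_Z2 => //; exact: gtr_grade0.
Qed.

(** The adjoint of the action of Y is the action of X. The latter maps cocycles to
    coboundaries on g_- by Cartan's formula, and the kernel of the codifferential is
    orthogonal to coboundaries. *)
Lemma lie_act_gY f : ker_codiff ip f -> im_codiff ip (lie_act gY f).
Proof.
move=> /(ker_codiffP hip he)[hf f0]; apply/(im_codiffP hip he).
split; first exact: lie_act_hor2 (@gY_gp R n m) hf.
move=> z [hz z0]; have cz := hz.1; have bz := hor2_bilin hz.
rewrite lie_act_adjoint //; last exact: hor2_bilin.
have -> : gtr gY = gX by apply: galg_ext => //=; rewrite trmx0.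
have c1 : is_cochain1 (z gX) := bz.1 gX.
have bX : bilin (lie_act gX z) by exact/cochain2_bilin/lie_act_cochain2.
rewrite (inner2_restrict hip he hf bX).
have -> : restrict2 (lie_act gX z) = restrict2 (d1 (z gX)).
  apply/funext => B; apply/funext => C; apply/eqP; rewrite -subr_eq0.
  rewrite /restrict2 (Cartan_homotopy _ _ _ cz) z0 //; try exact: gneg_negpart.
  exact: gX_gneg.
rewrite -(inner2_restrict hip he hf (cochain2_bilin (d1_cochain2 c1))); exact: f0.
Qed.

(** If [A] kills the class of [f] modulo the image of the codifferential, then
    [lie_act A h] is both in this image and a cocycle, hence zero. *)
Lemma harmonic_tanaka f h : harmonic_rep ip f h ->
  tanaka (im_codiff ip) f `<=` tanaka (@B2 R n m) h.
Proof.
move=> [kf kh Zh imd].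
have key A : ann (im_codiff ip) f A -> ann (@B2 R n m) h A.
  move=> [A0 imA]; split=> //.
  have -> : lie_act A h = 0.
    apply: im_Z2_eq0; last exact: lie_act_Z2.
    have -> : h = (-1) *: (f - h) + f by rewrite scaleN1r opprB subrK.
    by rewrite lie_act_linear; apply: im_codiff_linear => //; exact: lie_act_im.
  exact: B2_0.
by move=> A [A0 A1]; split; [exact: key | move=> B /A1/key].
Qed.

End Basis.
End Harmonic.

(** * Positive eigenvalues of Z *)

Section EigenSum.
Context (R : realType) (V : lmodType R) (S : V -> Prop) (T : V -> V).
Hypothesis S0 : S 0.
Hypothesis SL : forall t u v, S u -> S v -> S (t *: u + v).
Hypothesis lT : linear T.
Hypothesis ST : forall v, S v -> S (T v).

Let SD u v : S u -> S v -> S (u + v).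
Proof. by move=> Su Sv; rewrite -[u]scale1r; exact: SL. Qed.
Let SZ t u : S u -> S (t *: u).
Proof. by move=> Su; rewrite -[_ *: _]addr0; exact: SL. Qed.
Let SB u v : S u -> S v -> S (u - v).
Proof. by move=> Su Sv; rewrite addrC -scaleN1r; exact: SL. Qed.

Let regroup (a1 a2 b1 b2 p q w : V) :
  a1 + (a2 + p) - (b1 + (b2 + w)) - (q - w) = a1 - b1 + (a2 - b2) + (p - q).
Proof.
rewrite (opprD b1) (addrACA a1) (opprD b2) (addrACA a2) -!addrA.
by do 5!congr (_ + _); rewrite opprB addKr.
Qed.

(** Modulo S, the operator T - l kills the eigenvectors for l and multiplies a
    vector killed by T by - l; so it shortens the sum. *)
Lemma eigen_sum (r : nat) (c : 'I_r -> V) (lam : 'I_r -> R) (v : V) :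
  (forall i, lam i != 0 /\ S (T (c i) - lam i *: c i)) ->
  S (v - \sum_i c i) -> S (T v) -> S v.
Proof.
elim: r c lam v => [|r IH] c lam v cS; first by rewrite big_ord0 subr0.
rewrite big_ord_recl => vS TvS.
have [l0 c0S] := cS ord0.
set l := lam ord0 in l0 c0S; pose c' (i : 'I_r) := c (lift ord0 i).
pose l' (i : 'I_r) := lam (lift ord0 i).
suff Sv' : S (T v - l *: v).
  have : S (l *: v) by rewrite -[l *: v](subKr (T v)); exact: SB.
  by move=> /(SZ l^-1); rewrite scalerA mulVf // scale1r.
apply: (IH (fun i => (l' i - l) *: c' i) l').
- move=> i; have [li ci] := cS (lift ord0 i); split=> //.
  by rewrite (linZ lT) scalerA mulrC -scalerA -scalerBr; exact: SZ.
- set s := v - _ in vS.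
  have vE : v = s + (c ord0 + \sum_i c' i) by rewrite /s subrK.
  have -> : T v - l *: v - \sum_i (l' i - l) *: c' i =
      (T s - l *: s) + (T (c ord0) - l *: c ord0) + \sum_i (T (c' i) - l' i *: c' i).
    rewrite {1 2}vE !(linD lT) (lin_sum lT) !scalerDr scaler_sumr !sumrB.
    under [X in _ - X]eq_bigr => i _ do rewrite scalerBl.
    rewrite sumrB; move: (\sum_i T (c' i)) (\sum_i l' i *: c' i) (\sum_i l *: c' i) => p q w.
    exact: regroup.
  apply: SD; first by apply: SD => //; apply: SB; [exact: ST | exact: SZ].
  elim/big_ind: _ => // i _; exact: (cS _).2.
- by rewrite (linB lT) (linZ lT); apply: SB; [exact: ST | exact: SZ].
Qed.

(** The condition defining [H2plus] among the cocycles [Z], where [S] consists of the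
    coboundaries and [T] is the action of Z. *)
Definition positive_eigen_span (Z : V -> Prop) (v : V) : Prop :=
  exists (r : nat) (c : 'I_r -> V) (lam : 'I_r -> R),
    (forall i, [/\ 0 < lam i, Z (c i) & S (T (c i) - lam i *: c i)])
    /\ S (v - \sum_i c i).

(** Eigenvectors need not be grouped by eigenvalue, so the families are
    concatenated. *)
Lemma positive_eigen_span_linear (Z : V -> Prop) (t : R) (u v : V) :
  (forall w, Z w -> Z (t *: w)) ->
  positive_eigen_span Z u -> positive_eigen_span Z v -> positive_eigen_span Z (t *: u + v).
Proof.
move=> tZ [r [c [lam [cS uS]]]] [s [d [mu [dS vS]]]].
exists (r + s)%N.
exists (fun i => match fintype.split i with inl j => t *: c j | inr j => d j end).
exists (fun i => match fintype.split i with inl j => lam j | inr j => mu j end).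
split.
  move=> i; case: (fintype.split i) => j; last exact: dS.
  have [l0 Zc cB] := cS j; split=> //; first exact: tZ.
  by rewrite (linZ lT) scalerA mulrC -scalerA -scalerBr; exact: SZ.
rewrite big_split_ord /=.
rewrite (eq_bigr (fun i => t *: c i)); last first.
  by move=> i _; rewrite (unsplitK (inl i)).
rewrite [X in _ - (_ + X)](eq_bigr d); last first.
  by move=> i _; rewrite (unsplitK (inr i)).
by rewrite -scaler_sumr opprD addrACA -scalerBr; exact: SL.
Qed.
End EigenSum.

Section Homogeneous.
Context (R : realType) (n m : nat).
Local Notation galg := (galg R n m).
Local Notation br := (@br R n m).
Local Notation gpr := (@gpr R n m).
Local Notation gZ := (gZ R n m).
Local Notation cochain2 := (cochain2 R n m).
Local Notation degree := (@degree n).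
Implicit Types (A B C D : galg) (f g : cochain2).
#[local] Opaque Defs.br.

Let brr A : linear (br A) := @br_linearr R n m A.
Let gprl k : linear (gpr k) := @gpr_linear R n m k.

(** The component of degree [k] of a cochain, on which Z acts as the scalar [k]. *)
Definition hom_part (k : int) f : cochain2 := fun A B =>
  \sum_i \sum_j gpr (degree i + degree j + k) (f (gpr (degree i) A) (gpr (degree j) B)).

Lemma hom_part_homogeneous k f a b A B : bilin f -> grade a A -> grade b B ->
  hom_part k f A B = gpr (a + b + k) (f A B).
Proof.
move=> [fr fl] gA gB.
rewrite [in RHS](gpr_sum A) (lin_sum (fl B)) (lin_sum (gprl _)); apply: eq_bigr => i _.
rewrite [in RHS](gpr_sum B) (lin_sum (fr _)) (lin_sum (gprl _)); apply: eq_bigr => j _.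
rewrite (gpr_grade _ gA) (gpr_grade _ gB).
case: eqP => [->|_]; last by rewrite !(lin0 (fl _)) !(lin0 (gprl _)).
by case: eqP => [->|_] //; rewrite !(lin0 (fr _)) !(lin0 (gprl _)).
Qed.

Lemma hom_part_cochain2 k f : is_cochain2 f -> is_cochain2 (hom_part k f).
Proof.
move=> cf; have [fr fl _] := cf; split.
- move=> A t B C; rewrite /hom_part scaler_sumr -big_split; apply: eq_bigr => i _ /=.
  rewrite scaler_sumr -big_split; apply: eq_bigr => j _ /=.
  by rewrite gprl fr gprl.
- move=> B t A C; rewrite /hom_part scaler_sumr -big_split; apply: eq_bigr => i _ /=.
  rewrite scaler_sumr -big_split; apply: eq_bigr => j _ /=.
  by rewrite gprl fl gprl.
move=> A; have : hom_part k f A A = - hom_part k f A A.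
  rewrite {1}/hom_part exchange_big /hom_part -sumrN; apply: eq_bigr => i _ /=.
  rewrite -sumrN; apply: eq_bigr => j _ /=.
  by rewrite (cochain2_anti _ _ cf) (linN (gprl _)) [degree j + degree i]addrC.
move=> /eqP; rewrite -addr_eq0 -mulr2n -scaler_nat scaler_eq0 pnatr_eq0 /=.
by move/eqP.
Qed.

Lemma gp_gpr k A : gp A -> gp (gpr k A).
Proof.
by move=> pA j j0; rewrite gpr_gpr; case: eqP => // _; exact: pA.
Qed.

Lemma gneg_gpr k A : gneg A -> gneg (gpr k A).
Proof.
by move=> nA j j0; rewrite gpr_gpr; case: eqP => // _; exact: nA.
Qed.

Lemma hom_part_hor2 k f : hor2 f -> hor2 (hom_part k f).
Proof.
move=> [cf hf]; split; first exact: hom_part_cochain2.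
move=> A B pA; rewrite /hom_part; do 2!rewrite big1 // => ? _.
by rewrite hf ?(lin0 (gprl _)) //; exact: gp_gpr.
Qed.

Lemma lie_act_hom_part k f A B : bilin f ->
  lie_act gZ (hom_part k f) A B = k%:~R *: hom_part k f A B.
Proof.
move=> [fr fl]; rewrite /lie_act /hom_part (lin_sum (brr _)) scaler_sumr -!sumrB.
apply: eq_bigr => i _; rewrite (lin_sum (brr _)) scaler_sumr -!sumrB; apply: eq_bigr => j _.
rewrite br_gZ_gpr !gpr_br_gZ (linZ (fl _)) (linZ (fr _)) !(linZ (gprl _)).
by rewrite -!scalerBl !intrD; congr (_ *: _); ring.
Qed.

Lemma d2_hom_part k f a b c A B C : is_cochain2 f -> grade a A -> grade b B -> grade c C ->
  d2 (hom_part k f) A B C = gpr (a + b + c + k) (d2 f A B C).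
Proof.
move=> cf gA gB gC; have bf := cochain2_bilin cf.
have H := hom_part_homogeneous k bf.
rewrite /d2 (H _ _ _ _ gB gC) (H _ _ _ _ gA gC) (H _ _ _ _ gA gB).
rewrite (H _ _ _ _ (grade_br gA gB) gC) (H _ _ _ _ (grade_br gA gC) gB).
rewrite (H _ _ _ _ (grade_br gB gC) gA).
rewrite -(gpr_br _ _ gA) -(gpr_br _ _ gB) -(gpr_br _ _ gC).
have e1 : a + (b + c + k) = a + b + c + k by ring.
have e2 : b + (a + c + k) = a + b + c + k by ring.
have e3 : c + (a + b + k) = a + b + c + k by ring.
have e4 : a + c + b + k = a + b + c + k by ring.
have e5 : b + c + a + k = a + b + c + k by ring.
by rewrite e1 e2 e3 e4 e5 !(linB (gprl _), linD (gprl _)).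
Qed.

Lemma hom_part_Z2 k f : Z2 f -> Z2 (hom_part k f).
Proof.
move=> [hf f0]; split; first exact: hom_part_hor2.
have [cf _] := hf; have bh := cochain2_bilin (hom_part_cochain2 k cf).
move=> A B C nA nB nC.
rewrite (gpr_sum A) (lin_sum (d2_lin1 B C bh)) big1 // => i _.
rewrite (gpr_sum B) (lin_sum (d2_lin2 _ C bh)) big1 // => j _.
rewrite (gpr_sum C) (lin_sum (d2_lin3 _ _ bh)) big1 // => l _.
rewrite (d2_hom_part k cf (grade_gpr _ _) (grade_gpr _ _) (grade_gpr _ _)).
by rewrite f0 ?(lin0 (gprl _)) //; exact: gneg_gpr.
Qed.

(** [gpr_sum] over a longer interval of degrees. *)
Lemma gpr_sum_shift (c : int) (M : nat) A :
  c <= - (n.+1)%:Z -> 1 < c + M%:Z -> A = \sum_(t < M) gpr (c + t%:Z) A.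
Proof.
move=> c1 c2; rewrite {1}[A]gpr_sum.
under [RHS]eq_bigr => t _ do rewrite {1}[A]gpr_sum (lin_sum (gprl _)).
rewrite exchange_big; apply: eq_bigr => l _ /=.
have lM : (`|degree l - c|%N < M)%N by have := ltn_ord l; rewrite /degree; lia.
rewrite (bigD1 (Ordinal lM)) //= big1 ?addr0.
  have e : c + (`|degree l - c|%N)%:Z = degree l.
    by have := ltn_ord l; rewrite /degree; lia.
  by rewrite gpr_gpr /= e eqxx.
move=> t tl; rewrite gpr_gpr ifF //; apply/eqP => e; case/eqP: tl.
by apply: val_inj => /=; move: e; have := ltn_ord l; rewrite /degree; lia.
Qed.

(** A component has degree c - a - b for degrees a, b, c between -n-1 and 1, hence
    between -n-3 and 2n+3. *)
Definition hom_degree (t : 'I_(3 * n + 7)) : int := t%:Z - (n + 3)%:Z.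

Lemma hom_part_sum f A B : bilin f -> f A B = \sum_t hom_part (hom_degree t) f A B.
Proof.
move=> [fr fl].
rewrite {1}[A]gpr_sum (lin_sum (fl B)) exchange_big; apply: eq_bigr => i _ /=.
rewrite {1}[B]gpr_sum (lin_sum (fr _)) exchange_big; apply: eq_bigr => j _ /=.
rewrite [LHS](@gpr_sum_shift (degree i + degree j - (n + 3)%:Z) (3 * n + 7)).
- by apply: eq_bigr => t _; congr (gpr _ _); rewrite /hom_degree; ring.
- by have := ltn_ord i; have := ltn_ord j; rewrite /degree; lia.
- by have := ltn_ord i; have := ltn_ord j; rewrite /degree; lia.
Qed.

Lemma grade_filt k A : grade k A -> filt k A.
Proof. by move=> gA j jk; rewrite (gpr_grade _ gA) lt_eqF. Qed.

Lemma hom_part_regular k f : k <= 0 -> bilin f ->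
  (forall (i j : int) A C, filt i A -> filt j C -> filt (i + j + 1) (f A C)) ->
  hom_part k f = 0.
Proof.
move=> k0 bf rf; apply/funext => A; apply/funext => B; rewrite /hom_part.
do 2!rewrite big1 // => ? _; apply: rf; try exact/grade_filt/grade_gpr.
lia.
Qed.

Section Adjoint.
Variable ip : galg -> galg -> R.
Hypothesis hip : suitable ip.
Variables (N : nat) (e : 'I_N -> galg).
Hypothesis he : orthonormal_basis ip e.

Lemma inner2_suml K (F : 'I_K -> cochain2) g :
  inner2 ip e (fun A B => \sum_i F i A B) g = \sum_i inner2 ip e (F i) g.
Proof.
rewrite inner2_sum; under eq_bigr => a _ do under eq_bigr => b _ do
  rewrite (lin_sum (ip_linl hip _)).
under eq_bigr => a _ do rewrite exchange_big.
by rewrite exchange_big.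
Qed.

Lemma hom_part_adjoint k f g : bilin f -> bilin g ->
  inner2 ip e (hom_part k f) g = inner2 ip e f (hom_part k g).
Proof.
move=> bf bg; have [fr fl] := bf; have [gr gl] := bg.
rewrite (inner2C hip e f) /hom_part !inner2_suml; apply: eq_bigr => i _.
rewrite !inner2_suml; apply: eq_bigr => j _; rewrite (inner2C hip e _ f).
set c := _ + k.
have adj l A B : ip (gpr l A) B = ip A (gpr l B) by exact: ip_gpr.
transitivity (inner2 ip e (fun A B => f (gpr (degree i) A) (gpr (degree j) B))
   (fun A B => gpr c (g A B))).
  by rewrite !inner2_sum; apply: eq_bigr => a _; apply: eq_bigr => b _; exact: adj.
transitivity (inner2 ip e (fun A B => f A (gpr (degree j) B))
   (fun A B => gpr c (g (gpr (degree i) A) B))).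
  apply: (inner2_transportl hip he (f := fun A B => f A (gpr (degree j) B))
    (g := fun A B => gpr c (g A B)) _ _ (gprl (degree i)) (adj (degree i))).
    by split=> [A t B C|B t A C]; rewrite ?gprl ?fr ?fl.
  by split=> [A t B C|B t A C]; rewrite ?gr ?gl gprl.
apply: (inner2_transportr hip he (f := f)
    (g := fun A B => gpr c (g (gpr (degree i) A) B)) bf _ (adj (degree j))).
by split=> [A t B C|B t A C]; rewrite ?gprl ?gr ?gl gprl.
Qed.

Lemma hom_part_im k f : im_codiff ip f -> im_codiff ip (hom_part k f).
Proof.
move=> /(im_codiffP hip he)[hf f0]; apply/(im_codiffP hip he).
split; first exact: hom_part_hor2.
move=> z Zz; rewrite hom_part_adjoint; first exact/f0/hom_part_Z2.
  exact: hor2_bilin.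
exact: hor2_bilin (Z2_hor2 Zz).
Qed.

Lemma hom_part_sub k f g A B :
  hom_part k (f - g) A B = hom_part k f A B - hom_part k g A B.
Proof.
rewrite /hom_part -sumrB; apply: eq_bigr => i _; rewrite -sumrB.
by apply: eq_bigr => j _; rewrite -(linB (gprl _)).
Qed.

(** Regularity kills the components of [f] in degrees [k <= 0]. In these degrees, the
    component of [h] is then a cocycle in the image of the codifferential, hence
    zero; the other components are the required eigenvectors. *)
Lemma harmonic_H2plus f h : harmonic_rep ip f h ->
  (forall (i j : int) A C, filt i A -> filt j C -> filt (i + j + 1) (f A C)) ->
  H2plus h.
Proof.
move=> [kf kh Zh imd] rf; split=> //.
have bf := hor2_bilin (ker_hor2 kf); have bh := hor2_bilin (ker_hor2 kh).
have h0 k : k <= 0 -> hom_part k h = 0.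
  move=> k0; apply: (im_Z2_eq0 hip he); last exact: hom_part_Z2.
  have -> : hom_part k h = (-1) *: hom_part k (f - h) + 0.
    apply/funext => A; apply/funext => B.
    rewrite -[RHS]/(-1 *: hom_part k (f - h) A B + 0) hom_part_sub // (hom_part_regular k0 bf rf).
    by rewrite -[(0 : cochain2) A B]/(0 : galg) sub0r scaleN1r opprK addr0.
  by apply: (im_codiff_linear hip he); [exact: hom_part_im | exact: (im_codiff0 hip he)].
pose c (t : 'I_(3 * n + 7)) : cochain2 :=
  if 0 < hom_degree t then hom_part (hom_degree t) h else 0.
pose lam (t : 'I_(3 * n + 7)) : R := if 0 < hom_degree t then (hom_degree t)%:~R else 1.
exists (3 * n + 7)%N, c, lam; split.
  move=> t; rewrite /c /lam; case: ifP => t0; split.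
  - by rewrite ltr0z.
  - exact: hom_part_Z2.
  - have -> : lie_act gZ (hom_part (hom_degree t) h) - (hom_degree t)%:~R *: hom_part (hom_degree t) h = 0.
      by apply/funext => A; apply/funext => B; rewrite -[LHS]/(_ - _) lie_act_hom_part // subrr.
    exact: B2_0.
  - exact: ltr01.
  - exact: Z2_0.
  - have -> : lie_act gZ (0 : cochain2) - 1 *: (0 : cochain2) = 0.
      apply/funext => A; apply/funext => B.
      rewrite -[LHS]/(lie_act gZ (0 : cochain2) A B - 1 *: (0 : galg)) /lie_act.
      by rewrite -![(0 : cochain2) _ _]/(0 : galg) (lin0 (brr _)) scaler0 !subr0.
    exact: B2_0.
have -> : h - \sum_t c t = 0; last exact: B2_0.
apply/funext => A; apply/funext => B.
rewrite -[LHS]/(h A B - (\sum_t c t) A B) !fct_sumE {1}(hom_part_sum A B bh) -sumrB big1 // => t _.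
rewrite /c; case: ltP => [_|t0]; first by rewrite subrr.
by rewrite h0 // subrr.
Qed.

End Adjoint.
End Homogeneous.

(** * Automorphisms acting on cohomology *)

Section Levi.
Context (R : realType) (n m : nat).
Local Notation galg := (galg R n m).
Local Notation br := (@br R n m).
Local Notation gZ := (gZ R n m).
Local Notation cochain1 := (cochain1 R n m).
Local Notation cochain2 := (cochain2 R n m).
Local Notation negpart := (@negpart R n m).
Implicit Types (A B C D : galg) (f g : cochain2).

Let brr A : linear (br A) := @br_linearr R n m A.

Lemma B2_linear t f f' : B2 f -> B2 f' -> B2 (t *: f + f').
Proof.
move=> [hf [g [lg g0] fg]] [hf' [g' [lg' g0'] fg']]; split; first exact: hor2_linear.
have E A : (t *: g + g') A = t *: g A + g' A by [].
exists (t *: g + g').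
  split=> [s A B|A pA]; last by rewrite E g0 // g0' // scaler0 addr0.
  by rewrite !E lg lg' !scalerDr !scalerA mulrC addrACA.
move=> A B nA nB; rewrite -[LHS]/(t *: f A B + f' A B) fg // fg' // /d1 !E !brr.
move: (br A (g B)) (br A (g' B)) (br B (g A)) (br B (g' A)) (g (br A B)) (g' (br A B)).
by move=> *; galg_abel.
Qed.

Lemma lie_act_d1 A (g : cochain1) B C : is_cochain1 g ->
  lie_act A (d1 g) B C = d1 (fun D => br A (g D) - g (br A D)) B C.
Proof.
move=> lg; rewrite /lie_act /d1 !(brD, brN).
rewrite (br_Jacobi A B (g C)) (br_Jacobi A C (g B)) (br_Jacobi A B C) (linD lg).
move: (br (br A B) (g C)) (br B (br A (g C))) (br (br A C) (g B)) (br C (br A (g B)))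
  (br A (g (br B C))) (br B (g (br A C))) (br C (g (br A B))) (g (br (br A B) C)) (g (br B (br A C))).
by move=> *; galg_abel.
Qed.

Lemma lie_act_B2 A f : grade 0 A -> B2 f -> B2 (lie_act A f).
Proof.
move=> A0 [hf [g [lg g0] fg]]; have pA := grade0_gp A0.
split; first exact: lie_act_hor2.
have nA E : gneg E -> gneg (br A E) by exact: grade0_gneg.
exists (fun D => br A (g D) - g (br A D)).
  split=> [s B C|B pB]; last by rewrite !g0 //; [rewrite (lin0 (brr _)) subrr | exact: gp_br].
  by rewrite lg !brr lg; move: (br A (g B)) (br A (g C)) (g (br A B)) (g (br A C)) => *; galg_abel.
by move=> B C nB nC; rewrite -lie_act_d1 // /lie_act !fg //; exact: nA.
Qed.

(** Positivity of the eigenvalues of Z leaves no nonzero class killed by Z. *)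
Lemma H2plus_gZ f : H2plus f -> B2 (lie_act gZ f) -> B2 f.
Proof.
move=> [Zf [r [c [lam [cS fS]]]]] Tf.
have lT : linear (lie_act gZ : cochain2 -> cochain2).
  by move=> t u v; rewrite lie_act_linear.
apply: (eigen_sum (S := @B2 R n m) (T := lie_act gZ) _ _ lT _ (c := c) (lam := lam) _ _ Tf).
- exact: B2_0.
- move=> t u v; exact: (@B2_linear t u v).
- by move=> v; apply: lie_act_B2; exact: gZ_grade0.
- by move=> i; have [l0 _ cB] := cS i; split; [exact: lt0r_neq0 | refine cB].
- refine fS.
Qed.

(** An automorphism of g that fixes Z and preserves the splitting into g_- and p acts
    on the cochains and preserves every subspace of them considered here. *)
Section Automorphism.
Variables phi psi : galg -> galg.
Hypothesis lphi : linear phi.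
Hypothesis lpsi : linear psi.
Hypothesis phi_psi : forall A, phi (psi A) = A.
Hypothesis psi_phi : forall A, psi (phi A) = A.
Hypothesis phi_br : forall A B, phi (br A B) = br (phi A) (phi B).
Hypothesis phi_Z : phi gZ = gZ.
Hypothesis psi_neg : forall A, negpart (psi A) = psi (negpart A).

Definition transport f : cochain2 := fun B C => phi (f (psi B) (psi C)).

Let psi_br A B : psi (br A B) = br (psi A) (psi B).
Proof. by rewrite -[LHS]/(psi (br A B)) -{1}(phi_psi A) -{1}(phi_psi B) -phi_br psi_phi. Qed.

Let psi_gneg A : gneg A -> gneg (psi A).
Proof. by move=> /gnegP nA; apply/gnegP; rewrite psi_neg nA. Qed.
Let psi_gp A : gp A -> gp (psi A).
Proof. by move=> /gpP pA; apply/gpP; rewrite psi_neg pA (lin0 lpsi). Qed.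

Let br_phi A B : br A (phi B) = phi (br (psi A) B).
Proof. by rewrite phi_br phi_psi. Qed.

Lemma transport_hor2 f : hor2 f -> hor2 (transport f).
Proof.
move=> [[fr fl fa] hf]; split; first split.
- by move=> A t B C; rewrite /transport lpsi fr lphi.
- by move=> B t A C; rewrite /transport lpsi fl lphi.
- by move=> A; rewrite /transport fa (lin0 lphi).
- by move=> A B pA; rewrite /transport hf ?(lin0 lphi) //; exact: psi_gp.
Qed.

Lemma transport_Z2 f : Z2 f -> Z2 (transport f).
Proof.
move=> [hf f0]; split; first exact: transport_hor2.
move=> A B C nA nB nC.
have -> : d2 (transport f) A B C = phi (d2 f (psi A) (psi B) (psi C)).
  by rewrite /d2 /transport !br_phi !psi_br !(linD lphi, linN lphi).
by rewrite f0 ?(lin0 lphi) //; exact: psi_gneg.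
Qed.

Lemma transport_B2 f : B2 f -> B2 (transport f).
Proof.
move=> [hf [g [lg g0] fg]]; split; first exact: transport_hor2.
exists (fun A => phi (g (psi A))).
  split=> [s A B|A pA]; first by rewrite lpsi lg lphi.
  by rewrite g0 ?(lin0 lphi) //; exact: psi_gp.
move=> A B nA nB; rewrite /transport fg; try exact: psi_gneg.
by rewrite /d1 !br_phi psi_br !(linD lphi, linN lphi).
Qed.

Lemma transport_gZ f : lie_act gZ (transport f) = transport (lie_act gZ f).
Proof.
have psi_Z : psi gZ = gZ by rewrite -{1}phi_Z psi_phi.
apply/funext => A; apply/funext => B.
by rewrite /lie_act /transport !br_phi !psi_br psi_Z !(linD lphi, linN lphi).
Qed.

Lemma transport_H2plus f : H2plus f -> H2plus (transport f).
Proof.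
move=> [Zf [r [c [lam [cS fS]]]]]; split; first exact: transport_Z2.
exists r, (fun i => transport (c i)), lam; split.
  move=> i; have [l0 Zc cB] := cS i; split=> //; first exact: transport_Z2.
  rewrite transport_gZ.
  have -> : transport (lie_act gZ (c i)) - lam i *: transport (c i) =
            transport (lie_act gZ (c i) - lam i *: c i).
    apply/funext => A; apply/funext => B.
    rewrite -[LHS]/(phi (lie_act gZ (c i) (psi A) (psi B)) - lam i *: phi (c i (psi A) (psi B))).
    by rewrite -(linZ lphi) -(linB lphi).
  exact: transport_B2.
have -> : transport f - \sum_i transport (c i) = transport (f - \sum_i c i).
  apply/funext => A; apply/funext => B.
  rewrite -[LHS]/(transport f A B - (\sum_i transport (c i)) A B).
  rewrite -[RHS]/(phi (f (psi A) (psi B) - (\sum_i c i) (psi A) (psi B))).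
  by rewrite !fct_sumE (linB lphi) (lin_sum lphi).
exact: transport_B2.
Qed.

End Automorphism.

End Levi.

(** * The group G_0 *)

Section LeviGroup.
Context (R : realType) (n m : nat).
Local Notation galg := (galg R n m).
Local Notation br := (@br R n m).
Local Notation gZ := (gZ R n m).
Local Notation gH := (gH R n m).
Local Notation negpart := (@negpart R n m).
Local Notation pmx := (pmx R m).
Implicit Types (A B C D : galg).

Lemma mulmx2E p q (A : 'M[R]_(p, 2)) (B : 'M[R]_(2, q)) i j :
  (A *m B) i j = A i 0 * B 0 j + A i 1 * B 1 j.
Proof.
rewrite mxE big_ord_recl big_ord1; congr (_ + _ * _); congr (_ _ _); exact: val_inj.
Qed.

Section Diagonal.
Variables (a d : R) (u w : 'M[R]_m).
Hypotheses (a0 : a != 0) (d0 : d != 0) (uw : u *m w = 1%:M) (wu : w *m u = 1%:M).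

Definition diag_weight (a d : R) : 'M[R]_n.+1 :=
  \matrix_(j, i) (a ^+ (n - i) * d ^+ i * (j == i)%:R).

(** The adjoint action of the diagonal matrix with entries [a], [d] and of [u], where
    [w] is the inverse of [u]. *)
Definition diag_Ad (a d : R) (u w : 'M[R]_m) (A : galg) : galg :=
  ((A.1.1.1.1 * (a / d), A.1.1.1.2, A.1.1.2 * (d / a)), u *m A.1.2 *m w,
   diag_weight a d *m A.2 *m u^T).

Lemma diag_weightE p a' d' (v : 'M[R]_(n.+1, p)) j i :
  (diag_weight a' d' *m v) j i = a' ^+ (n - j) * d' ^+ j * v j i.
Proof.
rewrite mxE (bigD1 j) //= big1 ?addr0 ?mxE ?eqxx ?mulr1 // => k kj.
by rewrite mxE eq_sym (negPf kj) mulr0 mul0r.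
Qed.

Lemma diag_Ad_linear a' d' u' w' : linear (diag_Ad a' d' u' w').
Proof.
move=> t A B; apply: galg_ext => /=.
- apply: sl2_ext => /=; rewrite -![t *: _]/(t * _); ring.
- by rewrite mulmxDr mulmxDl -scalemxAr -scalemxAl.
- by rewrite mulmxDr mulmxDl -scalemxAr -scalemxAl.
Qed.

Lemma diag_AdK A : diag_Ad a d u w (diag_Ad a^-1 d^-1 w u A) = A.
Proof.
apply: galg_ext => /=.
- by apply: sl2_ext => //=; field; rewrite ?a0 ?d0.
- by rewrite !mulmxA uw mul1mx -mulmxA uw mulmx1.
- rewrite !mulmxA -mulmxA -trmx_mul uw trmx1 mulmx1.
  apply/matrixP => j i; rewrite -mulmxA !diag_weightE mulrA mulrACA -!exprMn.
  by rewrite !divff // !expr1n !mul1r.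
Qed.

Lemma diag_weight_act (b : sl2 R) :
  diag_weight a d *m sl2_act n b =
  sl2_act n (b.1.1 * (a / d), b.1.2, b.2 * (d / a)) *m diag_weight a d.
Proof.
apply/matrixP => j i; rewrite diag_weightE.
have -> (P : 'M[R]_n.+1) : (P *m diag_weight a d) j i = P j i * (a ^+ (n - i) * d ^+ i).
  rewrite mxE (bigD1 i) //= big1 ?addr0 ?mxE ?eqxx ?mulr1 // => k ki.
  by rewrite mxE (negPf ki) !mulr0.
case: b => [[x h] y]; rewrite !mxE /=.
rewrite !mulrDr !mulrDl; congr (_ + _ + _).
- case: eqP => [ji|_] /=; last by ring.
  have jn : (j < n)%N by have := ltn_ord i; rewrite -ji ltnS.
  by rewrite -ji -(subnSK jn) !exprS; field.
- by case: eqP => [->|_] /=; ring.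
- case: eqP => [ji|_] /=; last by ring.
  have i_n : (i < n)%N by have := ltn_ord j; rewrite ji ltnS.
  by rewrite ji -(subnSK i_n) !exprS; field.
Qed.

Lemma diag_Ad_br A B : diag_Ad a d u w (br A B) = br (diag_Ad a d u w A) (diag_Ad a d u w B).
Proof.
rewrite !brE; apply: galg_ext => /=.
- by apply: sl2_ext => //=; field; rewrite ?a0 ?d0.
- rewrite mulmxBr mulmxBl !mulmxA.
  have E P Q : u *m P *m w *m u *m Q *m w = u *m P *m Q *m w.
    by rewrite -(mulmxA _ w u) wu mulmx1.
  by rewrite !E.
have E C D : gact (diag_Ad a d u w C) (diag_weight a d *m D.2 *m u^T) =
    diag_weight a d *m gact C D.2 *m u^T.
  rewrite /gact mulmxDr mulmxDl; congr (_ + _).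
    by rewrite !mulmxA diag_weight_act.
  rewrite /= !trmx_mul !mulmxA; congr (_ *m _).
  by rewrite -(mulmxA _ u^T) -trmx_mul wu trmx1 mulmx1.
by rewrite mulmxBr mulmxBl -!E.
Qed.

Lemma diag_Ad_gZ : diag_Ad a d u w gZ = gZ.
Proof.
have lD := diag_Ad_linear a d u w.
rewrite /gZ (linZ lD) (linD lD) (linZ lD); congr (_ *: (_ + _ *: _)).
- apply: galg_ext => /=; first by apply: sl2_ext => //=; rewrite mul0r.
    by rewrite mulmx0 mul0mx.
  by rewrite mulmx0 mul0mx.
- apply: galg_ext => /=; first by apply: sl2_ext => //=; rewrite mul0r.
    by rewrite mulmx1.
  by rewrite mulmx0 mul0mx.
Qed.

Lemma diag_Ad_negpart a' d' u' w' A :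
  negpart (diag_Ad a' d' u' w' A) = diag_Ad a' d' u' w' (negpart A).
Proof.
apply: galg_ext => //=; first by apply: sl2_ext => //=; rewrite mul0r.
by rewrite mulmx0 mul0mx.
Qed.

End Diagonal.

Definition is_diag (p : pmx) := [/\ p.1 0 1 = 0, p.1 1 0 = 0, p.1 0 0 != 0, p.1 1 1 != 0
  & p.2 \in unitmx].

Lemma diag_unit (p : pmx) : is_diag p -> p.1 \in unitmx.
Proof.
move=> [p01 p10 p00 p11 _].
pose q : 'M[R]_2 := \matrix_(i, j) if i == j then (p.1 i i)^-1 else 0.
suff /mulmx1_unit[] : p.1 *m q = 1%:M by [].
apply/matrixP => i j; rewrite mulmx2E !mxE.
have ord2 (k : 'I_2) : k = 0 \/ k = 1.
  by case: k => [[|[|k]] kl] //; [left | right]; exact: val_inj.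
case: (ord2 i) => ->; case: (ord2 j) => -> /=;
  by rewrite ?p01 ?p10 ?mul0r ?mulr0 ?addr0 ?add0r ?divff.
Qed.

Lemma diag_inv (p : pmx) : is_diag p -> [/\ (invmx p.1) 0 1 = 0, (invmx p.1) 1 0 = 0,
  (invmx p.1) 0 0 = (p.1 0 0)^-1 & (invmx p.1) 1 1 = (p.1 1 1)^-1].
Proof.
move=> dp; have up := diag_unit dp; have [p01 p10 p00 p11 _] := dp.
have E i j := (congr1 (fun M : 'M[R]_2 => M i j) (mulmxV up)).
have := E 0 0; rewrite mulmx2E p01 mul0r addr0 mxE /= => e00.
have := E 0 1; rewrite mulmx2E p01 mul0r addr0 mxE /= => e01.
have := E 1 0; rewrite mulmx2E p10 mul0r add0r mxE /= => e10.
have := E 1 1; rewrite mulmx2E p10 mul0r add0r mxE /= => e11.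
split.
- by apply: (mulfI p00); rewrite e01 mulr0.
- by apply: (mulfI p11); rewrite e10 mulr0.
- by apply: (mulfI p00); rewrite e00 divff.
- by apply: (mulfI p11); rewrite e11 divff.
Qed.

Lemma sym_act_diag (p : pmx) : is_diag p ->
  sym_act n p.1 = diag_weight (p.1 0 0) (p.1 1 1).
Proof.
move=> [p01 p10 _ _ _]; apply/matrixP => j i; rewrite !mxE p01 p10 scale0r addr0 add0r.
rewrite -polyC_exp exprZn -scalerAr coefZ coefCM coefXn.
case: eqP => [/val_inj ->|ji].
  have : (i`!)%:R != 0 :> R by rewrite pnatr_eq0 -lt0n fact_gt0.
  move: (i`!%:R) => F F0.
  by rewrite (divff F0) mul1r eqxx !mulr1 mulrC.
by rewrite !mulr0 (introF eqP) ?mulr0 // => e; apply: ji; rewrite e.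
Qed.

Lemma Ad_diag (p : pmx) A : is_diag p ->
  Ad p A = diag_Ad (p.1 0 0) (p.1 1 1) p.2 (invmx p.2) A.
Proof.
move=> dp; have [i01 i10 i00 i11] := diag_inv dp; have [p01 p10 p00 p11 _] := dp.
apply: galg_ext => //=; last by rewrite sym_act_diag.
case: A => [[[[x h] y] b] v]; apply: sl2_ext => /=; rewrite !mulmx2E !mxE /= ?p01 ?p10 ?i01 ?i10 ?i00 ?i11.
- by ring.
- by field.
- by ring.
Qed.

Lemma diag_pinv (p : pmx) : is_diag p -> is_diag (Defs.pinv p).
Proof.
move=> dp; have [i01 i10 i00 i11] := diag_inv dp; have [p01 p10 p00 p11 u2] := dp.
by split; rewrite /Defs.pinv //= ?i00 ?i11 ?invr_eq0 // unitmx_inv.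
Qed.

(** The component of Ad_p H in g_1 vanishes only if the lower left entry of [p] does,
    since [p] is lower triangular. *)
Lemma G0_diag (p : pmx) : @G0 R n m p -> is_diag p.
Proof.
move=> [[p01 u1 u2 _] pG].
have H0 : grade 0 gH by apply/gradeP; rewrite br_gZE scale0r; apply: galg_ext => //=;
   [apply: sl2_ext => //=; rewrite oppr0 | apply/matrixP => i j; rewrite !mxE mulr0].
set M := p.1 *m sl2_mx gH.1.1 *m invmx p.1.
have Mp : M *m p.1 = p.1 *m sl2_mx gH.1.1 by rewrite /M -mulmxA mulVmx // mulmx1.
have [_ M10 _] := grade0E (pG _ H0).
have {}M10 : M 1 0 = 0 by []. clearbody M.
have E i j := (congr1 (fun M : 'M[R]_2 => M i j) Mp).
have := E 1 1; rewrite !mulmx2E M10 p01 !mxE /= !mul0r !mulr0 !add0r => e11.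
have := E 1 0; rewrite !mulmx2E M10 !mxE /= mul0r add0r mulr0 addr0 mulr1 => e10.
have dp : p.1 0 0 * p.1 1 1 != 0.
  have E' i j := (congr1 (fun M : 'M[R]_2 => M i j) (mulmxV u1)).
  have := E' 0 0; rewrite mulmx2E p01 mul0r addr0 mxE /= => e.
  have := E' 0 1; rewrite mulmx2E p01 mul0r addr0 mxE /= => e1.
  have p00 : p.1 0 0 != 0 by apply/eqP => z; move/eqP: e; rewrite z mul0r eq_sym oner_eq0.
  have q01 : (invmx p.1) 0 1 = 0 by apply: (mulfI p00); rewrite e1 mulr0.
  have := E' 1 1; rewrite mulmx2E q01 mulr0 add0r mxE /= => e2.
  rewrite mulf_neq0 //; apply/eqP => z; move/eqP: e2; rewrite z mul0r eq_sym oner_eq0 //.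
move: dp; rewrite mulf_eq0 negb_or => /andP[p00 p11]; split=> //.
have M11 : M 1 1 = -1 by apply: (mulIf p11); rewrite e11 mulrN1 mulN1r.
move: e10; rewrite M11 mulN1r => /eqP; rewrite eq_sym -addr_eq0 -mulr2n mulrn_eq0 /=.
by move/eqP.
Qed.

End LeviGroup.

(** * Dimensions and associated graded spaces *)

Section Dimension.
Context (R : realType).

Definition independent (V : lmodType R) k (v : 'I_k -> V) : Prop :=
  forall c : 'I_k -> R, \sum_i c i *: v i = 0 -> forall i, c i = 0.

Lemma dim_of_le (V V' : lmodType R) (A : set V) (B : set V') :
  (forall k (v : 'I_k -> V), (forall i, A (v i)) -> independent v ->
     exists w : 'I_k -> V', (forall i, B (w i)) /\ independent w) ->
  (dim_of A <= dim_of B)%E.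
Proof.
move=> AB; apply: le_ereal_sup => _ [k [v [Av iv]] <-]; exists k => //; exact: AB.
Qed.

Variable V : vectType R.

Lemma independent_free k (v : 'I_k -> V) : independent v <-> free [tuple v i | i < k].
Proof.
split=> [iv | /freeP fv c c0 i].
  by apply/freeP => c c0; apply: iv; rewrite -{}[RHS]c0; apply: eq_bigr => i _; rewrite -tnth_nth tnth_mktuple.
by apply: fv; rewrite -[RHS]c0; apply: eq_bigr => j _; rewrite -tnth_nth tnth_mktuple.
Qed.

Lemma dim_span_independent k (v : 'I_k -> V) : independent v ->
  \dim <<[tuple v i | i < k]>> = k.
Proof. by move=> /independent_free; rewrite /free size_tuple => /eqP. Qed.

Lemma dim_of_setT : ((\dim {:V})%:R%:E <= dim_of [set: V])%E.
Proof.
apply: ereal_sup_ubound; exists (\dim {:V}) => //.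
exists (fun i => (vbasis {:V})`_i); split=> //.
have /basis_free/freeP fb := vbasisP {:V}.
exact: fb.
Qed.

Lemma span_closed (T : set V) k (v : 'I_k -> V) u : T 0 ->
  (forall t u v, T u -> T v -> T (t *: u + v)) -> (forall i, T (v i)) ->
  u \in <<[tuple v i | i < k]>>%VS -> T u.
Proof.
move=> T0 TL Tv /coord_span ->; elim/big_rec: _ => // i w _ Tw; apply: TL => //.
by rewrite -tnth_nth tnth_mktuple.
Qed.

Lemma dim_of_proper (T : set V) : T 0 ->
  (forall t u v, T u -> T v -> T (t *: u + v)) -> (exists v, ~ T v) ->
  (dim_of T <= ((\dim {:V}).-1)%:R%:E)%E.
Proof.
move=> T0 TL [v0 nT]; apply: ge_ereal_sup => _ [k [v [Tv iv]] <-].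
rewrite lee_fin ler_nat; have dk := dim_span_independent iv.
rewrite -ltnS; have [d0|d0] := posnP (\dim {:V}).
  rewrite d0.
  by have := dimvS (subvf <<[tuple v i | i < k]>>); rewrite dk d0.
rewrite prednK // ltnNge; apply/negP => kd; apply: nT.
have full : <<[tuple v i | i < k]>>%VS = fullv.
  by apply/eqP; rewrite eqEdim subvf dk.
by apply: (span_closed T0 TL Tv); rewrite full memvf.
Qed.

End Dimension.

Section Graded.
Context (R : realType) (n m : nat).
Local Notation galg := (galg R n m).
Local Notation gpr := (@gpr R n m).
Implicit Types (A B C D : galg).

Let gprl k : linear (gpr k) := @gpr_linear R n m k.
Let deg (j : nat) : int := j%:Z - n.+1%:Z.

(** The associated graded space of [T] for the filtration of g; for [T] the space
    f(u), this is s(u). *)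
Definition gr (T : set galg) : set galg :=
  [set A | forall k : int, exists C, [/\ T C, filt k C & gpr k C = gpr k A]].

Lemma gpr_out k A : (forall j : 'I_n.+3, k != deg j) -> gpr k A = 0.
Proof.
move=> kd; rewrite [A]gpr_sum (lin_sum (gprl k)) big1 // => j _.
by rewrite gpr_gpr (negPf (kd j)).
Qed.

Let G (j : nat) : 'End(galg : vectType R) :=
  linfun (HB.pack (gpr (deg j)) (GRing.isLinear.Build _ _ _ _ _ (gprl (deg j))) : {linear galg -> galg}).

Let GE j A : G j A = gpr (deg j) A. Proof. by rewrite lfunE. Qed.

(** The elements of [F] without components in the [j] lowest degrees. *)
Fixpoint fil_space (F : {vspace galg}) (j : nat) : {vspace galg} :=
  if j is j'.+1 then (fil_space F j' :&: lker (G j'))%VS else F.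

Lemma fil_spaceP F j A : A \in fil_space F j <->
  A \in F /\ forall l, (l < j)%N -> gpr (deg l) A = 0.
Proof.
elim: j => [|j IH] /=; first by split=> [|[]//].
rewrite memv_cap memv_ker GE; split.
  move=> /andP[/IH[AF lA] /eqP jA]; split=> // l; rewrite ltnS leq_eqVlt.
  by move=> /orP[/eqP-> //|/lA].
move=> [AF lA]; apply/andP; split; last by rewrite lA.
by apply/IH; split=> // l lj; apply: lA; exact: ltnW.
Qed.

Let Gr F j := (G j @: fil_space F j)%VS.

Lemma dim_fil_space F j : \dim F = (\sum_(l < j) \dim (Gr F l) + \dim (fil_space F j))%N.
Proof.
elim: j => [|j IH]; first by rewrite big_ord0.
by rewrite big_ord_recr /= {1}IH -addnA -(limg_ker_dim (G j) (fil_space F j)) [(\dim (_ :&: _) + _)%N]addnC.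
Qed.

(** Rank-nullity for the projection onto one degree after the other. *)
Lemma dim_gr F : \dim F = \dim (\sum_(l < n.+3) Gr F l)%VS.
Proof.
rewrite {1}(dim_fil_space F n.+3).
have -> : fil_space F n.+3 = 0%VS.
  apply/eqP; rewrite -subv0; apply/subvP => A /fil_spaceP[_ A0].
  rewrite memv0 [A]gpr_sum big1 // => j _; exact: A0.
rewrite dimv0 addn0; apply/esym.
suff /directvP /= : directv (\sum_(l < n.+3) Gr F l) by [].
apply/directv_sum_independent => us usG us0 i _.
have usE l : exists C, us l = gpr (deg l) C.
  by have /memv_imgP[C _ ->] := usG l isT; exists C; rewrite GE.
have := congr1 (gpr (deg i)) us0; rewrite (lin_sum (gprl _)) (lin0 (gprl _)).
rewrite (bigD1 i) //= big1 ?addr0.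
  by have [C ->] := usE i; rewrite gpr_gpr eqxx.
move=> j ji; have [C ->] := usE j; rewrite gpr_gpr ifF //.
by apply/eqP => /addIr[] /val_inj e; rewrite e eqxx in ji.
Qed.

(** The leading parts of the [v i] may be dependent, so the family [w] is a basis of
    the graded space of their span. *)
Lemma gr_independent (T : set galg) k (v : 'I_k -> galg) : T 0 ->
  (forall t u v, T u -> T v -> T (t *: u + v)) -> (forall i, T (v i)) -> independent v ->
  exists w : 'I_k -> galg, (forall i, gr T (w i)) /\ independent w.
Proof.
move=> T0 TL Tv iv; pose F := <<[tuple v i | i < k]>>%VS.
pose S := (\sum_(l < n.+3) Gr F l)%VS.
have dS : \dim S = k by rewrite -dim_gr dim_span_independent.
have FT A : A \in F -> T A by exact: span_closed.
have ST A : A \in S -> gr T A.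
  move=> /memv_sumP[u uS ->] l.
  have [[j lj]|out] := pselect (exists j : 'I_n.+3, l = deg j); last first.
    have lj (j : 'I_n.+3) : l != deg j by apply/eqP => e; apply: out; exists j.
    exists 0; split=> //; last by rewrite !gpr_out.
    by move=> i _; rewrite (lin0 (gprl i)).
  have /memv_imgP[C /fil_spaceP[CF C0] uC] := uS j isT.
  exists C; split; first exact: FT.
    move=> i il; have [[i' ii']|out] := pselect (exists j : 'I_n.+3, i = deg j).
      by rewrite ii'; apply: C0; move: il; rewrite lj ii' /deg; lia.
    by apply: gpr_out => i'; apply/eqP => e; apply: out; exists i'.
  rewrite (lin_sum (gprl l)) (bigD1 j) //= big1 ?addr0.
    by rewrite uC GE lj gpr_gpr eqxx.
  move=> i ij; have /memv_imgP[D _ ->] := uS i isT; rewrite GE gpr_gpr lj ifF //.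
  by apply/eqP => /addIr[] /val_inj e; rewrite e eqxx in ij.
exists (fun i => (vbasis S)`_i); split.
  by move=> i; apply: ST; apply: vbasis_mem; apply: mem_nth; rewrite size_tuple dS.
have /basis_free := vbasisP S; move: (vbasis S); rewrite dS => X fX.
by move/freeP: fX.
Qed.

End Graded.

(** * The effective part *)

Section Effective.
Context (R : realType) (n m : nat).
Local Notation galg := (galg R n m).
Local Notation br := (@br R n m).
Local Notation gpr := (@gpr R n m).
Local Notation gZ := (@gZ R n m).
Local Notation cochain2 := (cochain2 R n m).
Local Notation pmx := (pmx R m).
Implicit Types (A B C D : galg) (f g : cochain2).
#[local] Opaque Defs.br.

Let brl B : linear (br^~ B) := @br_linearl R n m B.
Let gprl k : linear (gpr k) := @gpr_linear R n m k.

Lemma B2_Z2 f : B2 f -> Z2 f.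
Proof.
move=> [hf [g [lg _] fg]]; apply/Z2P; split=> //.
have E : restrict2 f = restrict2 (d1 g).
  by apply/funext => A; apply/funext => B; apply: fg; exact: gneg_negpart.
rewrite -dneg_restrict2 E dneg_restrict2.
apply/funext => A; apply/funext => B; apply/funext => C; exact: d2_d1.
Qed.

Lemma B2_H2plus f : B2 f -> H2plus f.
Proof.
move=> Bf; split; first exact: B2_Z2.
exists 0%N, (fun=> 0), (fun=> 0); split; first by case.
by rewrite big_ord0 subr0.
Qed.

Lemma H2plus_linear t f g : H2plus f -> H2plus g -> H2plus (t *: f + g).
Proof.
move=> [Zf Hf] [Zg Hg]; split; first exact: Z2_linear.
have lT : linear (lie_act gZ : cochain2 -> cochain2).
  by move=> s u v; rewrite lie_act_linear.
have key (h : cochain2) : (exists (r : nat) (c : 'I_r -> cochain2) (lam : 'I_r -> R),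
    (forall i, [/\ 0 < lam i, Z2 (c i) & B2 (lie_act gZ (c i) - lam i *: c i)])
    /\ B2 (h - \sum_i c i)) <->
    positive_eigen_span (@B2 R n m) (lie_act gZ) (@Z2 R n m) h.
  split=> -[r [c [lam [cS hS]]]]; exists r, c, lam; split; try refine hS;
    by move=> i; have [l0 Zc cB] := cS i; split; [| | refine cB].
have Zt (h : cochain2) : Z2 h -> Z2 (t *: h).
  by move=> Zh; rewrite -[t *: h]addr0; apply: Z2_linear => //; exact: Z2_0.
apply: (iffRL (key (t *: f + g))).
exact (@positive_eigen_span_linear R cochain2 (@B2 R n m) (lie_act gZ) (@B2_0 R n m)
  (@B2_linear R n m) lT (@Z2 R n m) t f g Zt (iffLR (key f) Hf) (iffLR (key g) Hg)).
Qed.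

Lemma grp_act_H2plus (p : pmx) f : @G0 R n m p -> H2plus f -> H2plus (grp_act p f).
Proof.
move=> /G0_diag dp; have dq := diag_pinv dp; have [i01 i10 i00 i11] := diag_inv dp.
have [_ _ p00 p11 u2] := dp.
pose a := p.1 0 0; pose d := p.1 1 1; pose u := p.2; pose w := invmx p.2.
have uw : u *m w = 1%:M by rewrite mulmxV.
have wu : w *m u = 1%:M by rewrite mulVmx.
have a'0 : a^-1 != 0 by rewrite invr_eq0.
have d'0 : d^-1 != 0 by rewrite invr_eq0.
have -> : grp_act p f = transport (diag_Ad a d u w) (diag_Ad a^-1 d^-1 w u) f.
  apply/funext => A; apply/funext => B; rewrite /grp_act /transport.
  by rewrite !(Ad_diag _ dp) !(Ad_diag _ dq) /= i00 i11 invmxK.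
apply: transport_H2plus.
- exact: diag_Ad_linear.
- exact: diag_Ad_linear.
- by move=> A; exact: diag_AdK.
- by move=> A; have := @diag_AdK _ _ _ _ _ _ _ a'0 d'0 wu A; rewrite !invrK.
- by move=> A B; exact: diag_Ad_br.
- exact: diag_Ad_gZ.
- by move=> A; exact: diag_Ad_negpart.
Qed.

(** Hence the effective part is contained in [H2plus], by minimality. *)
Lemma H2plus_submodule : G0_submodule (@H2plus R n m).
Proof.
split; [exact: B2_H2plus | by move=> f [] | exact: H2plus_linear | exact: grp_act_H2plus].
Qed.

Variable ip : galg -> galg -> R.
Hypothesis hip : suitable ip.

Lemma effective_H2plus f : effective ip f -> H2plus f.
Proof.
apply; [exact: H2plus_submodule | by [] |].
move=> X u h hh; have [N [e he]] := orthonormal_basis_exists hip.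
by apply: (harmonic_H2plus hip he hh) => i j A C; exact: og_regular.
Qed.

Lemma tanaka_linear f : bilin f -> tanaka (@B2 R n m) f 0 /\
  forall t A C, tanaka (@B2 R n m) f A -> tanaka (@B2 R n m) f C ->
    tanaka (@B2 R n m) f (t *: A + C).
Proof.
move=> bf.
have a0 : ann (@B2 R n m) f 0.
  split; first by rewrite /grade /= (lin0 (gprl 0)).
  have := lie_act_linear_l (-1) 0 0 bf; rewrite !scaleN1r oppr0 addr0 addNr => ->.
  exact: B2_0.
have aL t A C : ann (@B2 R n m) f A -> ann (@B2 R n m) f C -> ann (@B2 R n m) f (t *: A + C).
  move=> [gA BA] [gC BC]; split.
    by rewrite /grade /= gprl [gpr 0 A]gA [gpr 0 C]gC.
  by rewrite lie_act_linear_l //; exact: B2_linear.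
split.
  split; first by rewrite (lin0 (gprl 0)).
  by move=> B _; rewrite (lin0 (gprl 1)) (lin0 (brl B)).
move=> t A C [A0 A1] [C0 C1]; split; first by rewrite gprl; exact: aL.
by move=> B gB; rewrite gprl brl; apply: aL; [exact: A1 | exact: C1].
Qed.

(** A Tanaka algebra of full dimension contains Z, and Z only kills the zero class of
    [H2plus]. *)
Lemma max_tanaka_lt : (max_tanaka_dim ip < dim_of [set: galg])%E.
Proof.
have N0 : (0 < \dim {:galg})%N.
  rewrite lt0n; apply/eqP => d0.
  have : gX R n m \in fullv by rewrite memvf.
  have -> : (fullv : {vspace galg}) = 0%VS by apply/eqP; rewrite -dimv_eq0 d0.
  rewrite memv0 => /eqP /(congr1 (fun A => A.1.1.1.1)) /= /eqP.
  by rewrite oner_eq0.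
apply: (@le_lt_trans _ _ ((\dim {:galg}).-1)%:R%:E); last first.
  apply: lt_le_trans (dim_of_setT galg).
  by rewrite lte_fin ltr_nat prednK.
apply: ge_ereal_sup => _ [f [ef nBf] <-].
have Hf := effective_H2plus ef.
have bf : bilin f by apply/hor2_bilin/Z2_hor2; case: Hf.
have [T0 TL] := tanaka_linear bf.
apply: (dim_of_proper T0 TL); exists gZ => -[[_ Zf] _]; apply: nBf.
apply: H2plus_gZ => //; by rewrite (gpr_grade 0 (@gZ_grade0 R n m)) eqxx in Zf.
Qed.

End Effective.

(** * Tangent vectors and vector fields in charts *)

Section Charts.
Context (R : realType) (d : nat).
Local Notation E := 'rV[R]_d.

Section OneChart.
Context (M : topologicalType) (c : chart R M d).
Implicit Types (O : set M) (x : M) (y : E).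

Definition cimg : set E := cmap c @` cdom c.

Lemma cimg_open_set : open cimg. Proof. exact: cimg_open. Qed.

Lemma cmap_img x : cdom c x -> cimg (cmap c x). Proof. by exists x. Qed.

Lemma cinv_dom y : cimg y -> cdom c (cinv c y).
Proof. by move=> [x xc <-]; rewrite cmapK. Qed.

Lemma cinvK y : cimg y -> cmap c (cinv c y) = y.
Proof. by move=> [x xc <-]; rewrite cmapK. Qed.

Lemma cimgIP O y : (cmap c @` (cdom c `&` O)) y <-> cimg y /\ O (cinv c y).
Proof.
split=> [[x [xc xO] <-]|[yc yO]]; first by rewrite cmapK //; split=> //; exists x.
by exists (cinv c y); [split=> //; exact: cinv_dom | exact: cinvK].
Qed.

Lemma cimgI_open O : open O -> open (cmap c @` (cdom c `&` O)).
Proof.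
move=> oO; rewrite openE => y /cimgIP[yc yO].
have nc : \forall z \near y, cimg z by apply: open_nbhs_nbhs; split=> //; exact: cimg_open_set.
have nO : \forall z \near y, O (cinv c z).
  apply: (cinv_continuous yc); apply: open_nbhs_nbhs; split=> //.
by rewrite /interior /=; near=> z; apply/cimgIP; split; near: z.
Unshelve. all: by end_near. Qed.

Lemma near_cmap x (Q : E -> Prop) : cdom c x -> (\forall y \near cmap c x, Q y) ->
  \forall z \near x, cdom c z /\ Q (cmap c z).
Proof.
move=> xc nQ; near=> z; split; near: z.
  by apply: open_nbhs_nbhs; split=> //; exact: cdom_open.
exact: (cmap_continuous xc).
Unshelve. all: by end_near. Qed.

End OneChart.

Context (M : manifold R d).
Implicit Types (x u v : M) (y w : E) (xi eta : M -> E) (O : set M).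
Local Notation ch := (@chart_at R d M).

Definition trans u v : E -> E := cmap (ch v) \o cinv (ch u).

Definition overlap u v : set E := cmap (ch u) @` (cdom (ch u) `&` cdom (ch v)).

Lemma overlap_open u v : open (overlap u v).
Proof. by apply: cimgI_open; exact: cdom_open. Qed.

Lemma overlapP u v x : cdom (ch u) x -> cdom (ch v) x -> overlap u v (cmap (ch u) x).
Proof. by move=> xu xv; exists x. Qed.

Lemma trans_smooth u v : Csmooth (overlap u v) (trans u v).
Proof. exact: chart_compat. Qed.

Lemma trans_cmap u v x : cdom (ch u) x -> trans u v (cmap (ch u) x) = cmap (ch v) x.
Proof. by move=> xu; rewrite /trans /= cmapK. Qed.

Let hE : has_coordinates E := matrix_coordinates R 1 d.

Lemma dirD_linear (W : normedModType R) (h : M -> W) x O : has_coordinates W -> open O -> O x ->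
  Csmooth (cmap (ch x) @` (cdom (ch x) `&` O)) (h \o cinv (ch x)) -> linear (dirD h x).
Proof.
move=> hW oO Ox hs; have xx := chart_at_dom x.
apply: (derive_linear hW (cimgI_open oO) _ (hs 1%N)).
by exists x.
Qed.

(** The chain rule for the transition map: a derivative along a tangent vector at [x]
    may be computed in any chart of the atlas around [x]. *)
Lemma dirD_chart u (W : normedModType R) (h : M -> W) x (v : E) O : has_coordinates W ->
  open O -> O x -> cdom (ch u) x ->
  Csmooth (cmap (ch u) @` (cdom (ch u) `&` O)) (h \o cinv (ch u)) ->
  dirD h x v = 'D_(dirD (cmap (ch u)) x v) (h \o cinv (ch u)) (cmap (ch u) x).
Proof.
move=> hW oO Ox xu hs; have xx := chart_at_dom x.
have ov := overlapP xx xu.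
rewrite /dirD -/(trans x u) -(trans_cmap u xx).
rewrite -(derive_chain (f := h \o cinv (ch u)) v hW (@overlap_open x u) ov (@trans_smooth x u 1%N) (cimgI_open (c := ch u) oO) _ (hs 1%N)); last first.
  by rewrite trans_cmap //; exists x.
apply: near_eq_derive; apply: (near_open (@overlap_open x u) ov) => y /set_mem[z [zx zu] <-].
by rewrite /trans /= !cmapK.
Qed.

Lemma dirD_id x (v : E) : dirD (cmap (ch x)) x v = v.
Proof.
have xx := chart_at_dom x.
transitivity ('D_v (id : E -> E) (cmap (ch x) x)); last exact: derive_id.
apply: near_eq_derive.
apply: (@near_open R E E (cimg (ch x)) (cmap (ch x) \o cinv (ch x)) id).
- exact: cimg_open_set.
- exact: cmap_img.
- by move=> y /set_mem yx; rewrite /= cinvK.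
Qed.

Lemma dirD_trans u v x w : cdom (ch u) x -> cdom (ch v) x ->
  dirD (cmap (ch v)) x w = 'D_(dirD (cmap (ch u)) x w) (trans u v) (cmap (ch u) x).
Proof. by move=> xu xv; apply: (dirD_chart _ hE (cdom_open (ch v))) => //; exact: trans_smooth. Qed.

Lemma dirD_cmap_linear u x : cdom (ch u) x -> linear (dirD (cmap (ch u)) x).
Proof. by move=> xu; apply: (dirD_linear hE (cdom_open (ch u))) => //; exact: trans_smooth. Qed.

Lemma coord_vf_linear u x : cdom (ch u) x -> linear (fun w => coord_vf (ch u) w x).
Proof.
move=> xu; apply: (derive_linear hE (@overlap_open u x) _ (@trans_smooth u x 1%N)).
by apply: overlapP => //; exact: chart_at_dom.
Qed.

Lemma coord_vfK u x w : cdom (ch u) x -> dirD (cmap (ch u)) x (coord_vf (ch u) w x) = w.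
Proof.
move=> xu; have xx := chart_at_dom x; have ov := overlapP xu xx.
rewrite /dirD /coord_vf -/(trans u x) -/(trans x u) -(trans_cmap x xu).
rewrite -(derive_chain (f := trans x u) w hE (@overlap_open u x) ov (@trans_smooth u x 1%N) (@overlap_open x u) _ (@trans_smooth x u 1%N)); last first.
  by rewrite trans_cmap //; exact: overlapP.
transitivity ('D_w (id : E -> E) (cmap (ch u) x)); last exact: derive_id.
apply: near_eq_derive.
apply: (near_open (@overlap_open u x) ov) => y /set_mem[z [zu zx] <-].
by rewrite /trans /= !cmapK.
Qed.

Lemma dirDK u x w : cdom (ch u) x -> coord_vf (ch u) (dirD (cmap (ch u)) x w) x = w.
Proof.
move=> xu; have xx := chart_at_dom x.
by rewrite -[RHS](dirD_id x) (dirD_trans w xu xx).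
Qed.

Definition vf_in u xi : E -> E := vf_coord (ch u) xi \o cinv (ch u).

Lemma vf_inE u xi x : cdom (ch u) x -> vf_in u xi (cmap (ch u) x) = dirD (cmap (ch u)) x (xi x).
Proof. by move=> xu; rewrite /vf_in /= cmapK. Qed.

Lemma vf_in_trans u v xi y : overlap u v y ->
  vf_in v xi (trans u v y) = Dalong (vf_in u xi) (trans u v) y.
Proof.
by move=> [x [xu xv] <-]; rewrite (trans_cmap v xu) /Dalong (vf_inE _ xv) (vf_inE _ xu); exact: dirD_trans.
Qed.

Lemma smooth_vf_in u xi : smooth_vf xi -> Csmooth (cimg (ch u)) (vf_in u xi).
Proof. by move=> sxi k; have := sxi u u k; rewrite setIid. Qed.

(** On an overlap, one representative is the derivative of the transition map along
    the other. *)
Lemma smooth_vfP xi : (forall u, Csmooth (cimg (ch u)) (vf_in u xi)) -> smooth_vf xi.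
Proof.
move=> sxi v u k; have ou := @overlap_open u v.
have sub : overlap u v `<=` cimg (ch u) by move=> _ [x [xu _] <-]; exists x.
have s1 : Csmooth (overlap u v) (vf_in u xi) by move=> l; apply: Ck_subset (sxi u l).
apply: (Ck_ext ou _ (Csmooth_Dalong hE ou s1 (@trans_smooth u v) k)) => y /set_mem yo.
apply: (etrans (esym (vf_in_trans xi yo))); move: yo => [x [xu xv] <-].
by rewrite (trans_cmap v xu) (vf_inE _ xv) /= (cmapK xu).
Qed.

(** At each point, the bracket is defined in the preferred chart of that point.
    Applying the commutator of two fields to the transition map carries it over to a
    fixed chart. *)
Lemma lie_bracket_chart u xi eta x : cdom (ch u) x -> smooth_vf xi -> smooth_vf eta ->
  dirD (cmap (ch u)) x (lie_bracket xi eta x) =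
  field_bracket (vf_in u xi) (vf_in u eta) (cmap (ch u) x).
Proof.
move=> xu sxi seta; have xx := chart_at_dom x; have ov := overlapP xx xu.
pose V := overlap x u; have oV : open V := @overlap_open x u.
have sub : V `<=` cimg (ch x) by move=> _ [z [zx _] <-]; exists z.
have s1 (b : M -> E) : smooth_vf b -> Csmooth V (vf_in x b).
  by move=> sb l; apply: Ck_subset (smooth_vf_in x sb l).
have -> : lie_bracket xi eta x = field_bracket (vf_in x xi) (vf_in x eta) (cmap (ch x) x).
  have e (b : M -> E) : vf_in x b (cmap (ch x) x) = b x.
    by rewrite (vf_inE _ xx); exact: dirD_id.
  by rewrite /field_bracket /Dalong (e xi) (e eta).
have key (a b : M -> E) : smooth_vf a -> smooth_vf b ->
    Dalong (vf_in x a) (Dalong (vf_in x b) (trans x u)) (cmap (ch x) x) =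
    Dalong (vf_in u a) (vf_in u b) (cmap (ch u) x).
  move=> sa sb.
  rewrite -(Dalong_ext (f := vf_in u b \o trans x u) _ oV ov); last first.
    by move=> y /set_mem yV; rewrite /= vf_in_trans.
  have uV : cimg (ch u) (trans x u (cmap (ch x) x)) by rewrite (trans_cmap u xx); exact: cmap_img.
  have G (w w' y y' : E) f : w = w' -> y = y' -> 'D_w f y = 'D_w' f y' :> E by move=> -> ->.
  have C := derive_chain (vf_in x a (cmap (ch x) x)) hE oV ov (@trans_smooth x u 1%N)
    (@cimg_open_set _ (ch u)) uV (smooth_vf_in u sb 1%N).
  rewrite /Dalong; refine (etrans C _).
  apply: G; last exact: trans_cmap.
  by rewrite -(trans_cmap u xx); exact/esym/vf_in_trans.
have C := Dalong_comm hE oV ov (s1 _ sxi) (s1 _ seta) (@trans_smooth x u).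
have K := f_equal2 (fun p q : E => p - q) (key xi eta sxi seta) (key eta xi seta sxi).
refine (etrans (dirD_trans _ xx xu) _); rewrite dirD_id; exact (etrans (esym C) K).
Qed.

End Charts.

(** * Cartan connections in charts *)

Section CartanChart.
Context (R : realType) (n m : nat) (D : set (jet R n m)) (B : principal_bundle D).
Variable w : cartan_connection B.
Local Notation galg := (galg R n m).
Local Notation d := (bdim B).
Local Notation E := 'rV[R]_d.
Local Notation M := (tot B).
Local Notation ch := (@chart_at R d M).
Local Notation br := (@br R n m).
Implicit Types (u x : M) (y v : E) (A C : galg) (xi eta : M -> E).
#[local] Opaque Defs.br.

Let hg : has_coordinates galg := galg_coordinates R n m.

Definition om_in u : E -> E -> galg := fun y v =>
  om w (cinv (ch u) y) (coord_vf (ch u) v (cinv (ch u) y)).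

Definition const_vf A : M -> E := fun x => omi w x A.

Definition frame_in u A : E -> E := vf_in u (const_vf A).

Lemma om_in_linear u y : cimg (ch u) y -> linear (om_in u y).
Proof.
move=> yu t v v'; have yd := cinv_dom yu.
by rewrite /om_in (coord_vf_linear yd) om_linear.
Qed.

Lemma om_in_frame u y A : cimg (ch u) y -> om_in u y (frame_in u A y) = A.
Proof.
move=> yu; have yd := cinv_dom yu.
by rewrite /om_in /frame_in /vf_in /= /vf_coord (dirDK _ yd) omiK.
Qed.

Lemma frame_in_om u y v : cimg (ch u) y -> frame_in u (om_in u y v) y = v.
Proof.
move=> yu; have yd := cinv_dom yu.
by rewrite /om_in /frame_in /vf_in /= /vf_coord /const_vf omK (coord_vfK _ yd).
Qed.

Lemma om_in_smooth u v : Csmooth (cimg (ch u)) (fun y => om_in u y v).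
Proof. by move=> k; have := om_smooth w u v u k; rewrite setIid. Qed.

Lemma const_vf_smooth A : smooth_vf (const_vf A).
Proof.
apply: smooth_vfP => u.
exact: (frame_smooth hg (cimg_open_set (c := ch u)) (@om_in_linear u)
  (@om_in_frame u) (@frame_in_om u) (@om_in_smooth u)).
Qed.

Lemma om_in_cmap u x v : cdom (ch u) x ->
  om_in u (cmap (ch u) x) (dirD (cmap (ch u)) x v) = om w x v.
Proof. by move=> xu; rewrite /om_in cmapK // dirDK. Qed.

(** The values of the connection on constant fields are constant, so that only the
    bracket of these fields contributes to the exterior derivative. *)
Lemma kappa_chart u x : cdom (ch u) x ->
  kappa w x = flat_curv (om_in u) (frame_in u) br (cmap (ch u) x).
Proof.
move=> xu; apply/funext => A; apply/funext => C.
have cst_om A' v : dirD (fun z => om w z (omi w z A')) x v = 0.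
  rewrite /dirD (_ : _ \o _ = cst A'); first exact: derive_cst.
  by apply/funext => y /=; rewrite omiK.
rewrite /kappa /curvature /ext_d !cst_om !omiK subr0 sub0r addrC /flat_curv; congr (_ - _).
rewrite -(om_in_cmap _ xu); congr (om_in _ _ _).
by apply: lie_bracket_chart => //; exact: const_vf_smooth.
Qed.

(** The equation [L_xi omega = 0], evaluated on a constant field. *)
Lemma symmetry_bracket u xi A y : infinitesimal_symmetries w xi -> cimg (ch u) y ->
  field_bracket (vf_in u xi) (frame_in u A) y = 0.
Proof.
move=> [sxi _ lxi] [x xu <-]; have := lxi _ (const_vf_smooth A) x.
rewrite /lie_deriv.
have -> : dirD (fun z => om w z (const_vf A z)) x (xi x) = 0.
  rewrite /dirD (_ : _ \o _ = cst A); first exact: derive_cst.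
  by apply/funext => y' /=; rewrite /const_vf omiK.
rewrite sub0r => /eqP; rewrite oppr_eq0 => /eqP o0.
rewrite -(lie_bracket_chart xu sxi (const_vf_smooth A)).
have -> : lie_bracket xi (const_vf A) x = 0.
  by rewrite -[LHS](omK w x) o0 -[RHS](omK w x) (lin0 (om_linear w x)).
exact: (lin0 (dirD_cmap_linear xu)).
Qed.

End CartanChart.

(** * Symmetries and the Tanaka algebra *)

Section DerivativeOfCochains.
Context (R : realType) (n m : nat) (ip : galg R n m -> galg R n m -> R).
Hypothesis hip : suitable ip.
Local Notation galg := (galg R n m).
Local Notation cochain2 := (cochain2 R n m).
Context (V : normedModType R) (U : set V) (f : V -> cochain2) (y v : V).
Hypothesis oU : open U.
Hypothesis Uy : U y.
Hypothesis f_derivable : forall F G : galg, derivable (fun z => f z F G) y v.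
Hypothesis f_ker : forall z, U z -> ker_codiff ip (f z).

Let f' : cochain2 := fun F G => 'D_v (fun z => f z F G) y.

Let f'_eq F G (h : V -> galg) : (forall z, U z -> f z F G = h z) -> f' F G = 'D_v h y.
Proof.
move=> fh; apply: near_eq_derive; apply: (near_open oU Uy) => z /set_mem; exact: fh.
Qed.

(** The kernel of the codifferential is given by linear equations with constant
    coefficients, so it is stable under derivatives. *)
Lemma derive_ker_codiff : ker_codiff ip (fun F G => 'D_v (fun z => f z F G) y).
Proof.
have [N [e he]] := orthonormal_basis_exists hip.
have hf z : U z -> hor2 (f z) by move=> /f_ker /ker_hor2.
apply/(ker_codiffP hip he); split.
  have lin (h1 h2 h3 : V -> galg) (t : R) : derivable h1 y v -> derivable h2 y v ->
      (forall z, U z -> h3 z = t *: h1 z + h2 z) ->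
      'D_v h3 y = t *: 'D_v h1 y + 'D_v h2 y.
    exact: derive_lincomb oU Uy.
  split; first split.
  - move=> F t G G'; apply: lin => // z /hf[[lr _ _] _]; exact: lr.
  - move=> G t F F'; apply: lin => // z /hf[[_ ll _] _]; exact: ll.
  - move=> F; rewrite -[LHS]/(f' F F) (f'_eq (h := cst 0)); first exact: derive_cst.
    by move=> z /hf[[_ _ ->] _].
  - move=> F G pF; rewrite -[LHS]/(f' F G) (f'_eq (h := cst 0)); first exact: derive_cst.
    by move=> z /hf[_ ->].
move=> g lg; rewrite inner2_sum.
pose L i j : galg -> R := ip^~ (d1 g (e i) (e j)).
have lL i j : linear (L i j : galg -> R^o) by exact: ip_linl.
have cL i j : continuous (L i j) := linear_continuous_coordinates (galg_coordinates R n m) (lL i j).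
have dL i j := is_derive_linear (lL i j) (cL i j) (@f_derivable (e i) (e j)).
have S0 : is_derive y v (fun z => \sum_i \sum_j L i j (f z (e i) (e j)))
    (\sum_i \sum_j L i j (f' (e i) (e j))).
  have -> : (fun z => \sum_i \sum_j L i j (f z (e i) (e j))) =
      \sum_i \sum_j (L i j \o (fun z => f z (e i) (e j))).
    apply/funext => z; rewrite fct_sumE; apply: eq_bigr => i _.
    by rewrite fct_sumE.
  by do 2!apply: is_derive_sum => ?; exact: dL.
refine (etrans (esym (@derive_val _ _ _ _ _ _ _ S0)) _).
transitivity ('D_v (cst 0 : V -> R^o) y); last exact: derive_cst.
apply: near_eq_derive; apply: (near_open oU Uy) => z /set_mem zU.
have /(ker_codiffP hip he)[_ /(_ g lg)] := f_ker zU; by rewrite inner2_sum.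
Qed.

End DerivativeOfCochains.

Section RaisingElement.
Context (R : realType) (n m : nat).
Local Notation galg := (galg R n m).
Local Notation gpr := (@gpr R n m).
Local Notation gY := (@gY R n m).
Implicit Types (A C : galg).

Lemma lie_act_scale_l c A (f : cochain2 R n m) : bilin f ->
  lie_act (c *: A) f = c *: lie_act A f.
Proof.
move=> [fr fl]; apply/funext => F; apply/funext => G.
rewrite -[RHS]/(c *: lie_act A f F G) /lie_act.
have fZ H : f (c *: H) G = c *: f H G by exact: (linZ (fl G)).
rewrite !(linZ (@br_linearl R n m _)) (linZ (fr _)) fZ.
by rewrite -!scalerBr.
Qed.

Lemma gpr1E C : gpr 1 C = C.1.1.2 *: gY.
Proof.
rewrite gprE; apply: galg_ext => /=.
- by apply: sl2_ext => /=; rewrite -[_ *: _]/(C.1.1.2 * _) ?mulr0 ?mulr1.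
- by rewrite scaler0.
apply/matrixP => i j; rewrite !mxE mulr0 ifF //; apply/eqP; have := ltn_ord i; lia.
Qed.

Lemma gY_grade1 : grade 1 gY.
Proof. by rewrite /grade /= gpr1E scale1r. Qed.

(** In nonnegative degrees g is g_0 plus the line of Y. *)
Lemma gpr0E C : gp C -> gpr 0 C = (- C.1.1.2) *: gY + C.
Proof.
move=> /gpP nC; have x0 := congr1 (fun A : galg => A.1.1.1.1) nC.
have v0 := congr1 (fun A : galg => A.2) nC; rewrite /= in x0 v0.
rewrite gprE; apply: galg_ext => /=.
- by apply: sl2_ext => /=; rewrite -[- _ *: _]/(- C.1.1.2 * _) ?x0 ?mulr0 ?mulr1 ?add0r ?addNr.
- by rewrite scaler0 add0r.
apply/matrixP => i j; rewrite !mxE v0 mxE mulr0 addr0 if_same //.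
Qed.

End RaisingElement.

Section Tanaka.
Context (R : realType) (n m : nat) (ip : galg R n m -> galg R n m -> R).
Hypothesis hip : suitable ip.
Context (D : set (jet R n m)) (B : principal_bundle D) (w : cartan_connection B).
Hypothesis nw : normal w ip.
Local Notation galg := (galg R n m).
Local Notation E := 'rV[R]_(bdim B).
Local Notation M := (tot B).
Local Notation ch := (@chart_at R (bdim B) M).
Local Notation br := (@br R n m).
Local Notation gpr := (@gpr R n m).
Implicit Types (u x : M) (y : E) (A C : galg) (xi : M -> E).
#[local] Opaque Defs.br.

Let hg : has_coordinates galg := galg_coordinates R n m.

Section At.
Variable u : M.
Let U : set E := cimg (ch u).
Let Om := om_in w u.
Let X := frame_in w u.
Let k := flat_curv Om X br.
Let y0 : E := cmap (ch u) u.

Let oU : open U. Proof. exact: cimg_open_set. Qed.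
Let Uy0 : U y0. Proof. exact/cmap_img/chart_at_dom. Qed.
Let OmL : forall y, U y -> linear (Om y) := @om_in_linear _ _ _ _ _ w u.
Let OmK : forall y A, U y -> Om y (X A y) = A := @om_in_frame _ _ _ _ _ w u.
Let XK : forall y v, U y -> X (Om y v) y = v := @frame_in_om _ _ _ _ _ w u.
Let OmS : forall v, Csmooth U (fun y => Om y v) := @om_in_smooth _ _ _ _ _ w u.
Let brr : forall A, linear (br A) := @br_linearr R n m.

Let k_kappa y : U y -> k y = kappa w (cinv (ch u) y).
Proof.
by move=> Uy; rewrite (kappa_chart w (cinv_dom Uy)) cinvK.
Qed.

Let k_ker y : U y -> ker_codiff ip (k y).
Proof. by move=> Uy; rewrite k_kappa. Qed.

Let k_gp y A C : U y -> gp A -> k y A C = 0.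
Proof. by move=> Uy; have [_ ] := ker_hor2 (k_ker Uy); apply. Qed.

Let k_u : k y0 = kappa w u.
Proof. by rewrite (kappa_chart w (chart_at_dom u)). Qed.

Let k_smooth A C : Csmooth U (fun y => k y A C) :=
  flat_curv_smooth hg oU OmL OmK XK OmS br A C.

Section OneSymmetry.
Variable xi : M -> E.
Hypothesis sxi : infinitesimal_symmetries w xi.
Let C := om w u (xi u).

Let xi_smooth : Csmooth U (vf_in u xi).
Proof. by apply: smooth_vf_in; case: sxi. Qed.

Let xi_comm A y : U y -> field_bracket (vf_in u xi) (X A) y = 0.
Proof. exact: symmetry_bracket. Qed.

Let xi_y0 : vf_in u xi y0 = X C y0.
Proof. by rewrite /X /frame_in !(vf_inE _ (chart_at_dom u)) /const_vf omK. Qed.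

(** The curvature does not change along [xi], which agrees at [u] with the field
    omega^-1(C); along the latter, the curvature changes by the action of [- C]. *)
Lemma isotropy_lie_act : gp C -> lie_act C (kappa w u) = 0.
Proof.
move=> pC; apply/funext => F; apply/funext => G; rewrite -k_u.
have V := flat_curv_vertical hg oU OmL OmK XK OmS brr (@br_Jacobi R n m) (A := C) F G Uy0
  (fun z D' Uz => k_gp D' Uz pC).
have S := flat_curv_symmetry hg oU OmL OmK XK OmS br xi_smooth xi_comm F G Uy0.
rewrite /Dalong xi_y0 in S.
have := etrans (esym V) S => /eqP; rewrite oppr_eq0 => /eqP; exact.
Qed.

(** By [flat_curv_second_order], [br C A] acts on the curvature as a multiple of Y acts
    on the derivative of the curvature along omega^-1(A). By normality this derivative
    lies in the kernel of the codifferential, which Y maps to the image. *)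
Lemma isotropy_second_order c A : C = c *: gY R n m -> grade (-1) A ->
  im_codiff ip (lie_act (br C A) (kappa w u)).
Proof.
move=> Cc gA; have [N [e he]] := orthonormal_basis_exists hip.
have pY := gY_gp R n m.
have gY1 := @gY_grade1 R n m.
have C1 : grade 1 C by rewrite Cc /grade /= (linZ (@gpr_linear R n m 1)) gY1.
have pC : gp C by rewrite Cc; apply/gpP; rewrite (linZ (@negpart_linear R n m)) (iffLR (gpP _) pY) scaler0.
have pCA : gp (br C A) by apply: grade0_gp; rewrite -[0]/(1 + -1 : int); exact: grade_br.
pose k' : cochain2 R n m := fun F G => Dalong (X A) (fun z => k z F G) y0.
have K' : ker_codiff ip k'.
  apply: (derive_ker_codiff hip oU Uy0) => // F G.
  exact: (Csmooth_derivable Uy0 (k_smooth F G)).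
have S2 F G := flat_curv_second_order hg oU OmL OmK XK OmS brr (@br_Jacobi R n m) xi_smooth xi_comm
  (T := C) (B := A) F G Uy0 xi_y0 (fun z D' Uz => k_gp D' Uz pC) (fun z D' Uz => k_gp D' Uz pCA).
have -> : lie_act (br C A) (kappa w u) = (- c) *: lie_act (gY R n m) k' + 0.
  apply/funext => F; apply/funext => G; rewrite -k_u.
  apply: (etrans (S2 F G)).
  have bk : bilin k' := hor2_bilin (ker_hor2 K').
  rewrite addr0 -[RHS]/(- c *: lie_act (gY R n m) k' F G) scaleNr; congr (- _).
  exact: (congr1 (fun h : cochain2 R n m => h F G) (etrans (congr1 (fun A' => lie_act A' k') Cc)
    (lie_act_scale_l c (gY R n m) bk))).
apply: (im_codiff_linear hip he); last exact: (im_codiff0 hip he).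
exact: (lie_act_gY hip he).
Qed.

End OneSymmetry.

(** An element of f(u) in p differs from its component of degree 0 by a multiple of Y,
    and Y maps the curvature into the image of the codifferential. *)
Lemma sym_s_tanaka : sym_s w u `<=` tanaka (im_codiff ip) (kappa w u).
Proof.
have [N [e he]] := orthonormal_basis_exists hip.
move=> A sA; split.
  have [_ [[xi sxi <-] pC <-]] := sA 0; set C := om w u (xi u) in pC *.
  have hk : bilin (kappa w u) := hor2_bilin (ker_hor2 (nw u)).
  split; first exact: grade_gpr.
  rewrite (gpr0E pC) (lie_act_linear_l _ _ _ hk) (isotropy_lie_act sxi pC).
  apply: (im_codiff_linear hip he); first exact: (lie_act_gY hip he).
  exact: (im_codiff0 hip he).
move=> F gF; have [_ [[xi sxi <-] fC <-]] := sA 1; set C := om w u (xi u) in fC *.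
have pC : gp C by move=> j j0; apply: fC; lia.
have C1 : gpr 1 C = C.
  have := fC 0 isT; rewrite (gpr0E pC) gpr1E scaleNr addrC => /eqP.
  by rewrite subr_eq0 => /eqP.
rewrite C1; split.
  rewrite -[0]/(1 + -1 : int); apply: grade_br gF; by rewrite /grade /=.
exact: (isotropy_second_order sxi (etrans (esym C1) (gpr1E C)) gF).
Qed.
End At.

End Tanaka.

(** * The space of infinitesimal symmetries *)

Section StructureGroup.
Context (R : realType) (n m : nat).
Local Notation pmx := (pmx R m).
Implicit Types (p : pmx).

Lemma Ad_linear p : linear (@Ad R n m p).
Proof.
move=> t A C.
have lm (X Y : sl2 R) : sl2_mx (t *: X + Y) = t *: sl2_mx X + sl2_mx Y.
  move: X Y => [[x h] y] [[x' h'] y']; apply/matrixP => i j; rewrite !mxE /=.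
  by case: (i == 0); case: (j == 0); rewrite // opprD mulrN.
have e : sl2_mx (t *: A + C).1.1 = t *: sl2_mx A.1.1 + sl2_mx C.1.1 by exact: lm.
rewrite /Ad e mulmxDr mulmxDl -scalemxAr -scalemxAl; apply: galg_ext => /=.
- by apply: sl2_ext => /=; rewrite !mxE.
- by rewrite mulmxDr mulmxDl -scalemxAr -scalemxAl.
- by rewrite mulmxDr mulmxDl -scalemxAr -scalemxAl.
Qed.

Lemma P_one : P (pone R m).
Proof.
by split; rewrite /pone /= ?unitmx1 ?mxE //; case: ifP => // _; rewrite det1.
Qed.

Lemma P_inv p : P p -> P (Defs.pinv p).
Proof.
move=> [p01 u1 u2 pm]; split; rewrite /Defs.pinv /= ?unitmx_inv //.
  have := congr1 (fun A : 'M[R]_2 => A 0 1) (mulmxV u1).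
  have p00 : p.1 0 0 != 0.
    move: u1; rewrite unitmxE unitfE (expand_det_row _ 0) !big_ord_recl big_ord0 addr0.
    rewrite (_ : lift ord0 ord0 = 1); last exact: val_inj.
    by rewrite p01 mul0r addr0 mulf_eq0 negb_or => /andP[].
  rewrite mxE !big_ord_recl big_ord0 addr0 mxE (_ : lift ord0 ord0 = 1) /=; last exact: val_inj.
  by rewrite p01 mul0r addr0 => /eqP; rewrite mulf_eq0 (negPf p00) => /eqP.
case: ifP pm => _ pm; first by rewrite pm invmx1.
by rewrite det_inv pm invr1.
Qed.

Lemma pmul_inv p : P p -> pmul p (Defs.pinv p) = pone R m.
Proof. by move=> [_ u1 u2 _]; rewrite /pmul /= !mulmxV. Qed.

End StructureGroup.

Lemma lie_deriv_lincomb (R : realType) (d : nat) (M : manifold R d) (W : normedModType R)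
    (al : M -> 'rV[R]_d -> W) (xi xi' eta : M -> 'rV[R]_d) (t : R) (u : M) :
  linear (al u) -> linear (dirD (fun x => al x (eta x)) u) ->
  lie_bracket (t *: xi + xi') eta u = t *: lie_bracket xi eta u + lie_bracket xi' eta u ->
  lie_deriv (t *: xi + xi') al eta u = t *: lie_deriv xi al eta u + lie_deriv xi' al eta u.
Proof.
move=> lu ld bl.
have Q (a1 a2 b1 b2 : W) : (t *: a1 + a2) - (t *: b1 + b2) = t *: (a1 - b1) + (a2 - b2).
  by rewrite scalerBr opprD addrACA.
have l1 := lu t (lie_bracket xi eta u) (lie_bracket xi' eta u).
exact (etrans (f_equal2 (fun p q : W => p - q) (ld t (xi u) (xi' u))
  (etrans (congr1 (al u) bl) l1)) (Q _ _ _ _)).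
Qed.

Section Symmetries.
Context (R : realType) (n m : nat) (D : set (jet R n m)) (B : principal_bundle D).
Variable w : cartan_connection B.
Local Notation galg := (galg R n m).
Local Notation E := 'rV[R]_(bdim B).
Local Notation M := (tot B).
Local Notation ch := (@chart_at R (bdim B) M).
Local Notation br := (@br R n m).
Local Notation pmx := (pmx R m).
Local Notation inf := (infinitesimal_symmetries w).
Implicit Types (u x : M) (y : E) (A C : galg) (xi eta : M -> E) (p : pmx).
#[local] Opaque Defs.br.

Let hg : has_coordinates galg := galg_coordinates R n m.
Let hE : has_coordinates E := matrix_coordinates R 1 (bdim B).

(** Equivariance of the connection turns the tangent map of a right translation into
    the adjoint action; in particular this tangent map is linear. *)
Lemma tangent_actE u p v : P p ->
  tangent_map ((@act _ _ _ D B)^~ p) u v = omi w (act u p) (Ad (Defs.pinv p) (om w u v)).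
Proof. by move=> Pp; rewrite -(om_equivariant w u v Pp) omK. Qed.

Lemma omi_linear u : linear (omi w u).
Proof.
by move=> t A C; rewrite -[RHS](omK w u) om_linear !omiK.
Qed.

Lemma tangent_act_linear u p : P p -> linear (tangent_map ((@act _ _ _ D B)^~ p) u).
Proof. by move=> Pp t v v'; rewrite !tangent_actE // om_linear Ad_linear omi_linear. Qed.

Lemma vf_in_linear u t xi eta y : cimg (ch u) y ->
  vf_in u (t *: xi + eta) y = t *: vf_in u xi y + vf_in u eta y.
Proof. move=> /cinv_dom yd; exact: (dirD_cmap_linear yd). Qed.

Lemma smooth_vf_linear t xi eta : smooth_vf xi -> smooth_vf eta -> smooth_vf (t *: xi + eta).
Proof.
move=> sxi seta; apply: smooth_vfP => u k; have oU := @cimg_open_set _ _ _ (ch u).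
have := Ck_add oU (Ck_scale t oU (smooth_vf_in u sxi k)) (smooth_vf_in u seta k).
by apply: Ck_ext => // y /set_mem yU; rewrite vf_in_linear.
Qed.

Lemma om_vf_smooth u eta : smooth_vf eta ->
  Csmooth (cimg (ch u)) ((fun x => om w x (eta x)) \o cinv (ch u)).
Proof.
move=> seta k; have oU := @cimg_open_set _ _ _ (ch u).
have := Csmooth_coframe hg oU (@om_in_linear _ _ _ _ _ w u) (@om_in_smooth _ _ _ _ _ w u)
  (smooth_vf_in u seta) k.
by apply: Ck_ext => // y /set_mem yU; rewrite /= /om_in /vf_in /= /vf_coord (dirDK _ (cinv_dom yU)).
Qed.

Lemma lie_bracket_linear t xi xi' eta u : smooth_vf xi -> smooth_vf xi' -> smooth_vf eta ->
  lie_bracket (t *: xi + xi') eta u = t *: lie_bracket xi eta u + lie_bracket xi' eta u.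
Proof.
move=> sxi sxi' seta; have uu := chart_at_dom u; have Uu := cmap_img uu.
have oU := @cimg_open_set _ _ _ (ch u).
have sl := smooth_vf_linear t sxi sxi'.
have b z : smooth_vf z -> lie_bracket z eta u =
    field_bracket (vf_in u z) (vf_in u eta) (cmap (ch u) u).
  by move=> sz; rewrite -[LHS](@dirD_id R (bdim B) M u); exact: lie_bracket_chart.
rewrite !b // /field_bracket.
have e1 : Dalong (vf_in u (t *: xi + xi')) (vf_in u eta) (cmap (ch u) u) =
    t *: Dalong (vf_in u xi) (vf_in u eta) (cmap (ch u) u)
    + Dalong (vf_in u xi') (vf_in u eta) (cmap (ch u) u).
  rewrite /Dalong (vf_in_linear t xi xi' Uu).
  exact: (derive_linear hE oU Uu (smooth_vf_in u seta 1%N)).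
have e2 : Dalong (vf_in u eta) (vf_in u (t *: xi + xi')) (cmap (ch u) u) =
    t *: Dalong (vf_in u eta) (vf_in u xi) (cmap (ch u) u)
    + Dalong (vf_in u eta) (vf_in u xi') (cmap (ch u) u).
  apply: (derive_lincomb oU Uu); last by move=> z; exact: vf_in_linear.
  - exact: (Csmooth_derivable Uu (smooth_vf_in u sxi)).
  - exact: (Csmooth_derivable Uu (smooth_vf_in u sxi')).
have Q (a1 a2 b1 b2 : E) : (t *: a1 + a2) - (t *: b1 + b2) = t *: (a1 - b1) + (a2 - b2).
  by rewrite scalerBr opprD addrACA.
exact (etrans (f_equal2 (fun p q : E => p - q) e1 e2) (Q _ _ _ _)).
Qed.

Lemma lie_deriv_linear t xi xi' eta u : smooth_vf xi -> smooth_vf xi' -> smooth_vf eta ->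
  lie_deriv (t *: xi + xi') (om w) eta u =
  t *: lie_deriv xi (om w) eta u + lie_deriv xi' (om w) eta u.
Proof.
move=> sxi sxi' seta; have uu := chart_at_dom u; have Uu := cmap_img uu.
have oU := @cimg_open_set _ _ _ (ch u).
have dl : linear (dirD (fun x => om w x (eta x)) u).
  apply: (dirD_linear hg (cdom_open (ch u)) uu); rewrite setIid; exact: om_vf_smooth.
have bl := lie_bracket_linear t u sxi sxi' seta.
exact: (lie_deriv_lincomb (om_linear w u) dl bl).
Qed.

Lemma symmetries_linear t xi eta : inf xi -> inf eta -> inf (t *: xi + eta).
Proof.
move=> [sxi exi lxi] [seta eeta leta]; split.
- exact: smooth_vf_linear.
- by move=> u p Pp; rewrite (tangent_act_linear u Pp) -(exi u p Pp) -(eeta u p Pp).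
- by move=> z sz u; rewrite lie_deriv_linear // lxi // leta // scaler0 addr0.
Qed.

Lemma symmetries0 : inf (0 : M -> E).
Proof.
have v0 u y : cimg (ch u) y -> vf_in u (0 : M -> E) y = 0.
  by move=> yu; exact: (lin0 (dirD_cmap_linear (cinv_dom yu))).
have s0 : smooth_vf (0 : M -> E).
  apply: smooth_vfP => u k.
  apply: (Ck_ext (@cimg_open_set _ _ _ (ch u)) _ (@Ck_cst R E E k (cimg (ch u)) 0)).
  by move=> y /set_mem yu; rewrite v0.
split=> //.
- by move=> u p Pp; rewrite (lin0 (tangent_act_linear u Pp)).
- move=> eta seta u.
  have := lie_deriv_linear (-1) u s0 s0 seta.
  by rewrite !scaleN1r oppr0 addr0 addNr.
Qed.

End Symmetries.

(** * Uniqueness of symmetries and the theorem *)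

Section Uniqueness.
Context (R : realType) (n m : nat) (D : set (jet R n m)) (B : principal_bundle D).
Variable w : cartan_connection B.
Local Notation galg := (galg R n m).
Local Notation E := 'rV[R]_(bdim B).
Local Notation M := (tot B).
Local Notation ch := (@chart_at R (bdim B) M).
Local Notation pmx := (pmx R m).
Local Notation inf := (infinitesimal_symmetries w).
Implicit Types (u z : M) (x y : jet R n m) (xi eta : M -> E) (p : pmx).
#[local] Opaque Defs.br.

Let hg : has_coordinates galg := galg_coordinates R n m.

Lemma symmetry_zero_near xi u : inf xi -> xi u = 0 -> \forall z \near u, xi z = 0.
Proof.
move=> sxi xu0; have uu := chart_at_dom u; have Uu := cmap_img uu.
have xs : smooth_vf xi by case: sxi.
have x0 : vf_in u xi (cmap (ch u) u) = 0.
  by rewrite (vf_inE _ uu) xu0 (lin0 (dirD_cmap_linear uu)).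
have nz := symmetry_unique hg (@cimg_open_set _ _ _ (ch u)) (@om_in_linear _ _ _ _ _ w u)
  (@om_in_frame _ _ _ _ _ w u) (@frame_in_om _ _ _ _ _ w u) (@om_in_smooth _ _ _ _ _ w u)
  (smooth_vf_in u xs) Uu (fun C v => @symmetry_bracket _ _ _ _ _ w u xi C v sxi) x0.
apply: filterS (near_cmap uu nz) => z [zu].
by rewrite (vf_inE _ zu) -{2}(dirDK (xi z) zu) => ->; rewrite (lin0 (coord_vf_linear zu)).
Qed.

Lemma symmetry_nonzero_near xi u : inf xi -> xi u <> 0 -> \forall z \near u, xi z <> 0.
Proof.
move=> [sxi _ _] xu0; have uu := chart_at_dom u; have Uu := cmap_img uu.
have [cf _] := smooth_vf_in u sxi 0%N.
have nz : \forall y \near cmap (ch u) u, vf_in u xi y <> 0.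
  apply: (cf _ Uu [set v | v <> 0]); apply: open_nbhs_nbhs; split.
    by apply: (closed_openC (@accessible_closed_set1 E _ 0)); exact/hausdorff_accessible/norm_hausdorff.
  by rewrite /= (vf_inE _ uu) dirD_id.
apply: filterS (near_cmap uu nz) => z [zu]; rewrite (vf_inE _ zu) => nz0 xz; apply: nz0.
by rewrite xz (lin0 (dirD_cmap_linear zu)).
Qed.

Lemma symmetry_zero_act xi u p : inf xi -> P p -> xi u = 0 -> xi (act u p) = 0.
Proof.
by move=> [_ e _] Pp x0; rewrite e // x0 (lin0 (tangent_act_linear w u Pp)).
Qed.

(** Continuity comes from the smoothness of [act (s y) p] in [(y, p)] for a local
    trivialization, taken at [p = 1]. *)
Lemma local_section x : D x -> exists s : jet R n m -> M,
  [/\ {for x, continuous s}, Defs.proj (s x) = x &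
      \forall y \near x, [/\ D y, Defs.proj (s y) = y &
        forall u, Defs.proj u = y -> exists2 p, P p & act (s y) p = u]].
Proof.
move=> Dx; have [V [s [tau [[oV Vx VD] [ps st ts _ sF]]]]] := loc_triv B Dx.
exists s; split; last 1 first.
- have : \forall y \near x, V y by apply: open_nbhs_nbhs.
  apply: filterS => y Vy; split; [exact: VD | exact: ps |].
  by move=> u pu; rewrite -pu in Vy *; have [Pt tu] := st u Vy; exists (tau u).
- have [V' [F' [oV' Vx' [cF' _] F'E]]] := sF (x, pone R m) (conj Vx (P_one R m)).
  have Fs y : V' (y, pone R m) -> V y -> F' (y, pone R m) = s y.
    by move=> V'y Vy; rewrite F'E //= ?act1 //; split=> //; exact: P_one.
  have ci : {for x, continuous (fun y : jet R n m => (y, pone R m) : jet R n m * pmx)}.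
    apply: (@cvg_pair _ _ _ (nbhs x) (nbhs x) (nbhs (pone R m : pmx)) _ _ _ id (cst (pone R m : pmx))).
      exact: cvg_id.
    exact: cvg_cst.
  have cF : {for x, continuous (fun y => F' (y, pone R m))}.
    by apply: (continuous_comp (f := fun y => (y, pone R m)) ci); exact: cF'.
  suff cs : s y @[y --> x] --> F' (x, pone R m) by rewrite (Fs x Vx' Vx) in cs.
  apply: cvg_trans cF; apply: near_eq_cvg.
  have n1 : \forall y \near x, V y by apply: open_nbhs_nbhs.
  have n2 : \forall y \near x, V' (y, pone R m) by apply: (ci V'); apply: open_nbhs_nbhs.
  by near=> y; apply: Fs; near: y.
- exact: ps.
Unshelve. all: by end_near. Qed.

(** The zero set of [xi] is open by uniqueness for the first-order system that [xi]
    solves, it is closed, and it is a union of fibres by equivariance. Through local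
    sections, it corresponds to an open and closed subset of the connected base. *)
Lemma symmetry_zero xi u : open D -> connected D -> inf xi -> xi u = 0 -> xi = 0.
Proof.
move=> oD cD sxi xu0.
pose Z := [set x | D x /\ forall z, Defs.proj z = x -> xi z = 0].
have fibre z z' : xi z = 0 -> Defs.proj z = Defs.proj z' -> xi z' = 0.
  move=> xz pz; have [s [_ _ /nbhs_singleton[_ _ tr]]] := local_section (proj_dom z).
  have [p Pp pE] := tr z erefl; have [q Pq qE] := tr z' (esym pz).
  rewrite -qE; apply: symmetry_zero_act => //.
  have -> : s (Defs.proj z) = act z (Defs.pinv p).
    by rewrite -[in RHS]pE actM ?pmul_inv ?act1 //; exact: P_inv.
  by apply: symmetry_zero_act => //; exact: P_inv.
have ZE z : Z (Defs.proj z) <-> xi z = 0.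
  split=> [[_ Zz]|xz]; first exact: Zz.
  by split=> [|z' pz]; [exact: proj_dom | exact: fibre xz (esym pz)].
have near_s x (Q : set M) s : {for x, continuous s} -> (\forall z \near s x, Q z) ->
    \forall y \near x, Q (s y) by move=> cs; exact: cs.
have oZ x : Z x -> \forall y \near x, Z y.
  move=> [Dx Zx]; have [s [cs sx ns]] := local_section Dx.
  have n1 := near_s x _ s cs (symmetry_zero_near sxi (Zx _ sx)).
  near=> y; have [Dy sy _] : [/\ D y, Defs.proj (s y) = y &
        forall u, Defs.proj u = y -> exists2 p, P p & act (s y) p = u] by near: y.
  by rewrite -sy; apply/ZE; near: y.
have oN x : D x -> ~ Z x -> \forall y \near x, D y /\ ~ Z y.
  move=> Dx nZ; have [s [cs sx ns]] := local_section Dx.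
  have xs : xi (s x) <> 0 by move=> /ZE; rewrite sx.
  have n1 := near_s x _ s cs (symmetry_nonzero_near sxi xs).
  near=> y; have [Dy sy _] : [/\ D y, Defs.proj (s y) = y &
        forall u, Defs.proj u = y -> exists2 p, P p & act (s y) p = u] by near: y.
  by split=> // Zy; suff : xi (s y) = 0; [near: y | apply/ZE; rewrite sy].
have ZD : Z = D.
  apply: cD.
  - by exists (Defs.proj u); exact/ZE.
  - exists Z; last by rewrite setIC; apply/seteqP; split=> [x Zx|x []//]; split=> //; case: Zx.
    by rewrite openE => x Zx; exact: oZ.
  - exists (~` (D `\` Z)).
      by apply: open_closedC; rewrite openE => x [Dx nZ]; exact: oN.
    apply/seteqP; split=> x; first by move=> Zx; split; [case: Zx | case].
    by move=> [Dx /not_andP[//|/contrapT]].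
by apply/funext => z; apply/ZE; rewrite ZD; exact: proj_dom.
Unshelve. all: by end_near. Qed.

(** Evaluation at [u] embeds the symmetries in f(u), which has the same dimension as
    its associated graded space s(u). *)
Lemma dim_symmetries u : open D -> connected D ->
  (dim_of inf <= dim_of (sym_s w u))%E.
Proof.
move=> oD cD; apply: dim_of_le => k v vi iv.
pose f i := om w u (v i u).
have lf (c : 'I_k -> R) : om w u ((\sum_i c i *: v i) u) = \sum_i c i *: f i.
  rewrite fct_sumE (lin_sum (om_linear w u)); apply: eq_bigr => i _.
  exact: (linZ (om_linear w u)).
have ifr : independent f.
  move=> c; rewrite -lf => c0; apply: iv; apply: (symmetry_zero (u := u)) => //.
    elim: (index_enum _) => [|i r IH]; rewrite (big_nil, big_cons).
      exact (symmetries0 w).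
    exact (symmetries_linear (c i) (vi i) IH).
  by rewrite -[LHS](omK w u) c0 -[RHS](omK w u) (lin0 (om_linear w u)).
apply: (gr_independent (T := sym_f w u)) ifr.
- exists 0; first exact: symmetries0.
  exact: (lin0 (om_linear w u)).
- move=> t _ _ [xi sxi <-] [eta seta <-]; exists (t *: xi + eta).
    exact: symmetries_linear.
  exact: om_linear.
- by move=> i; exists (v i).
Qed.

End Uniqueness.

Lemma dim_of_subset (R : realType) (V : lmodType R) (S T : set V) : S `<=` T ->
  (dim_of S <= dim_of T)%E.
Proof. by move=> ST; apply: dim_of_le => k v Sv iv; exists v; split=> // i; exact: ST. Qed.

Local Close Scope ring_scope.

Theorem theorem2p11 (R : realType) (n m : nat)
    (hnm : (m = 1 /\ 3 <= n)%N \/ (2 <= m /\ 2 <= n)%N)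
    (ip : galg R n m -> galg R n m -> R) (hip : suitable ip) :
  (forall (X : ode_geometry ip) (u : og_bundle X),
     sym_s (og_conn X) u
       `<=` tanaka (im_codiff ip) (kappa (og_conn X) u)) /\
  (submax_sym_dim ip <= max_tanaka_dim ip)%E /\
  (max_tanaka_dim ip < dim_of [set: galg R n m])%E.
Proof.
have part1 (X : ode_geometry ip) (u : og_bundle X) :
    sym_s (og_conn X) u `<=` tanaka (im_codiff ip) (kappa (og_conn X) u).
  exact: (sym_s_tanaka hip (@og_normal _ _ _ _ X)).
split; first exact: part1.
split; last exact: max_tanaka_lt.
apply: ge_ereal_sup => _ [X [[u nim] ->]].
have [N [e he]] := orthonormal_basis_exists hip.
have kk := og_normal u.
have [h hh] := harmonic_rep_exists hip he kk.
have dS := dim_symmetries (og_conn X) u (@odom_open R n m (og_ode X)) (@odom_connected R n m (og_ode X)).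
apply: (le_trans dS); apply: (le_trans (dim_of_subset (part1 X u))).
apply: (le_trans (dim_of_subset (harmonic_tanaka hip he hh))).
apply: ereal_sup_ubound; exists h => //; split; first by move=> S _ _ /(_ X u h hh).
move=> Bh; apply: nim; have [_ kh _ imd] := hh.
by rewrite (harmonic_B2 hip he kh Bh) subr0 in imd.
Qed.
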